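(* Let $0<\alpha<1$, $d\ge 2$, $\nu>0$, $T>0$, and let $u:[0,T)\times\mathbb{T}^d\to\mathbb{R}^d$ be a weak solution of the incompressible Navier–Stokes equations $$\partial_t u+u\cdot\nabla u+\nabla p-\nu\Delta u=0,\qquad \operatorname{div}u=0,\qquad u(0,\cdot)=u_0,$$ with $\operatorname{div}u_0=0$, belonging to the class $L^\infty_tC^\alpha_x$. Let $\tilde u=u-e^{\nu t\Delta}u_0$ be the difference between $u$ and the solution of the free heat equation $\partial_t v=\nu\Delta v$ with the same initial data. Then $$\|\tilde u\|_{L^\infty_x\dot C^\alpha_t}\le C\|u\|_{L^\infty_{t,x}}^\alpha\|u\|_{L^\infty_t\dot C^\alpha_x},$$ and for every $a>0$, $$\|u\|_{C^\alpha_{t,x}((a\nu,T)\times\mathbb{T}^d)}\le C\left(\|u\|_{L^\infty_{t,x}}^\alpha\|u\|_{L^\infty_t\dot C^\alpha_x}+\|u\|_{L^\infty_tC^\alpha_x}+a^{-\alpha/2}\|u_0\|_{\dot C^\alpha_x}\right),$$ where the constant $C=C_{\alpha,d}$ depends only on $\alpha$ and $d$, and is independent of $\nu>0$ and $a>0$.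
   Context: $\mathbb{T}^d=\mathbb{R}^d/\mathbb{Z}^d$. $\|u\|_{L^\infty_t\dot C^\alpha_x}=\sup_t\sup_{x\ne y}|u(t,x)-u(t,y)|/|x-y|^\alpha$ (time-uniform spatial Hölder seminorm); $\|u\|_{L^\infty_tC^\alpha_x}$ is the corresponding full Hölder norm (sup norm plus seminorm); $\|\tilde u\|_{L^\infty_x\dot C^\alpha_t}=\sup_x\sup_{t\ne s}|\tilde u(t,x)-\tilde u(s,x)|/|t-s|^\alpha$; $\|\cdot\|_{C^\alpha_{t,x}(I\times\mathbb{T}^d)}$ is the joint space–time Hölder norm on $I\times\mathbb{T}^d$ (sup norm plus the seminorm $\sup|u(t,x)-u(s,y)|/(|t-s|+|x-y|)^\alpha$). $e^{\nu t\Delta}$ denotes the heat semigroup on $\mathbb{T}^d$. *)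

(* Defs.v *)
From HB Require Import structures.
From mathcomp Require Import all_boot all_order all_algebra.
From mathcomp Require Import all_classical all_reals all_analysis.
Set Implicit Arguments. Unset Strict Implicit. Unset Printing Implicit Defensive.
Import Order.TTheory GRing.Theory Num.Theory.
Import numFieldNormedType.Exports.
Local Open Scope classical_set_scope.
Local Open Scope ring_scope.

Section NSDefs.
Variables (R : realType) (d : nat).

(* Points of R^d (and of T^d = R^d/Z^d, via Z^d-Zd_periodic functions) and
   vectors of R^d are row vectors 'rV[R]_d. *)
Local Notation pt := 'rV[R]_d.

Definition evec (i : 'I_d) : pt := delta_mx 0 i.

Definition enorm (v : pt) : R := Num.sqrt (\sum_(i < d) v 0 i ^+ 2).

Definition pderiv (i : 'I_d) (f : pt -> R) : pt -> R :=
  fun x => 'D_(evec i) f x.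

Fixpoint Ck (k : nat) (f : pt -> R) : Prop :=
  continuous f /\
  match k with
  | 0 => True
  | k'.+1 => forall i : 'I_d, (forall x, derivable f x (evec i)) /\ Ck k' (pderiv i f)
  end.

Definition smooth_fn (f : pt -> R) : Prop := forall k, Ck k f.

Definition Zd_periodic {V : Type} (f : pt -> V) : Prop :=
  forall (x : pt) (i : 'I_d), f (x + evec i) = f x.

Definition upd (x : pt) (k : nat) (s : R) : pt :=
  \row_j (if (j : nat) == k then s else x 0 j).

Fixpoint iint (k : nat) (f : pt -> R) (x : pt) : R :=
  match k with
  | 0 => f x
  | k'.+1 => \int[lebesgue_measure]_(s in `[0, 1]) iint k' f (upd x k' s)
  end.

(** integral over the torus T^d (for continuous Zd_periodic integrands this is
    the Lebesgue integral over the fundamental domain [0,1]^d, by Fubini) *)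
Definition tint (f : pt -> R) : R := iint d f 0.

(** 1D heat kernel (for the operator s*Delta, s > 0) and its periodization *)
Definition gauss (s y : R) : R :=
  (Num.sqrt (4 * pi * s))^-1 * expR (- (y ^+ 2) / (4 * s)).

Definition theta (s y : R) : R :=
  limn (fun N => \sum_(n < N) (gauss s (y + n%:R) + gauss s (y - n.+1%:R))).

Definition heat_kernel (s : R) (y : pt) : R := \prod_(i < d) theta s (y 0 i).

Definition heat (s : R) (f : pt -> pt) : pt -> pt :=
  fun x => if s == 0 then f x
           else \row_j tint (fun y => heat_kernel s y * f (x - y) 0 j).

Definition div_free_test (psi : pt -> pt) : Prop :=
  (forall j : 'I_d, smooth_fn (fun x => psi x 0 j)) /\ Zd_periodic psi /\
  (forall x, \sum_(i < d) pderiv i (fun y => psi y 0 i) x = 0).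

Definition weak_div_free (f : pt -> pt) : Prop :=
  forall th : pt -> R, smooth_fn th -> Zd_periodic th ->
    tint (fun x => \sum_(i < d) f x 0 i * pderiv i th x) = 0.

(** u is a weak solution on [0,T) x T^d of the incompressible Navier-Stokes
    equations  d_t u + u.grad u + grad p - nu Lap u = 0, div u = 0, u(0) = u0
    (pressure eliminated by testing against divergence-free fields; time
    integrated form, which selects the weakly continuous representative):
    for all t in [0,T) and all such psi,
      int u(t).psi = int u0.psi
        + int_0^t int ( sum_ij u_i u_j d_i psi_j + nu u . Lap psi ) dx ds. *)
Definition weak_NS (nu T : R) (u : R -> pt -> pt) (u0 : pt -> pt) : Prop :=
  weak_div_free u0 /\
  (forall t, 0 <= t < T -> weak_div_free (u t)) /\
  (forall t, 0 <= t < T -> forall psi, div_free_test psi ->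
     tint (fun x => \sum_(j < d) u t x 0 j * psi x 0 j)
     = tint (fun x => \sum_(j < d) u0 x 0 j * psi x 0 j)
       + \int[lebesgue_measure]_(s in `[0, t])
           tint (fun x =>
             \sum_(i < d) \sum_(j < d)
                 u s x 0 i * u s x 0 j * pderiv i (fun y => psi y 0 j) x
             + nu * \sum_(j < d) u s x 0 j *
                 \sum_(i < d) pderiv i (pderiv i (fun y => psi y 0 j)) x)).

Local Open Scope ereal_scope.

Definition supnorm (T : R) (u : R -> pt -> pt) : \bar R :=
  ereal_sup [set z | exists t x, (0 <= t < T)%R /\ z = (enorm (u t x))%:E].

(** || f ||_{\dot C^alpha_x} (x, y range over R^d; by periodicity this equals
    the seminorm w.r.t. the torus distance) *)
Definition holx (alpha : R) (f : pt -> pt) : \bar R :=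
  ereal_sup [set z | exists x y, x != y /\
               z = (enorm (f x - f y) / enorm (x - y) `^ alpha)%:E].

Definition Linf_holx (alpha T : R) (u : R -> pt -> pt) : \bar R :=
  ereal_sup [set z | exists t, (0 <= t < T)%R /\ z = holx alpha (u t)].

Definition Linf_Cx (alpha T : R) (u : R -> pt -> pt) : \bar R :=
  adde (supnorm T u) (Linf_holx alpha T u).

Definition Linfx_holt (alpha T : R) (v : R -> pt -> pt) : \bar R :=
  ereal_sup [set z | exists x t s, (0 <= t < T)%R /\ (0 <= s < T)%R /\ t != s /\
               z = (enorm (v t x - v s x) / `|t - s| `^ alpha)%:E].

Definition Chol_tx (alpha t0 T : R) (u : R -> pt -> pt) : \bar R :=
  ereal_sup [set z | exists t x, (t0 < t < T)%R /\ z = (enorm (u t x))%:E]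
  + ereal_sup [set z | exists t x s y, (t0 < t < T)%R /\ (t0 < s < T)%R /\
                 (t, x) != (s, y) /\
                 z = (enorm (u t x - u s y) / (`|t - s| + enorm (x - y)) `^ alpha)%:E].

End NSDefs.

(* Main.v *)
Require Import Defs.
From HB Require Import structures.
From mathcomp Require Import all_boot all_order all_algebra.
From mathcomp Require Import all_classical all_reals all_analysis.
From mathcomp Require Import measurable_realfun ring lra zify.
Set Implicit Arguments. Unset Strict Implicit. Unset Printing Implicit Defensive.
Import Order.TTheory GRing.Theory Num.Theory.
Import numFieldNormedType.Exports.
Local Open Scope classical_set_scope.
Local Open Scope ring_scope.

(** The proof works in physical space. Let [w t tau] be the value at a fixed point of a component
    of [u t] convolved with the heat kernel of the torus at scale [tau]. As [div u = 0], testing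
    the equation with [psi_j = d_j d_l chi - delta_jl Delta chi] removes the pressure and gives
    [(d_t - nu d_tau) g = N] for [g = d_tau w], where three derivatives of the kernel fall on
    [u (x) u], so that [|N| <= C |u|_oo |u|_alpha tau^((alpha-3)/2)]. Integrating along
    [tau + nu t = const] and then in [tau] from infinity, where [w] tends to the conserved mean,
    bounds the increment over a time [h] of [w t tau - w 0 (tau + nu t)] by
    [C |u|_oo |u|_alpha h tau^((alpha-1)/2)], uniformly in [nu]. Replacing [w t tau] by [u t] and
    [w 0 (tau + nu t)] by the heat flow costs [C |u|_alpha tau^(alpha/2)]; the choice
    [tau = (h |u|_oo)^2] gives the first estimate. For the second one it remains to bound the time
    increments of the heat flow. *)

(** Only divergence-free tests are available, and on the fields above they see [u] through
    Laplacians of kernels. The equation is therefore accessible for [g], not for [w], which has to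
    be recovered by integration in scale from a boundary value; constant test fields provide that
    value at infinite scale. Nothing is assumed on the time regularity of [u] beyond measurability
    and the time-integrated equation, so the transport of [g] is stated with finite differences,
    whose quadratic errors vanish under subdivision. The obstacle to uniformity in [nu] is that the
    heat flow shifts the scale by [nu * t]. Over the increment [h] the source is bounded by [h]
    times its largest value, which is integrable in scale at infinity since [(alpha - 3) / 2 < -1].
    Over the earlier times it is bounded by its integral over all larger scales: this has size
    [nu^-1] whatever the elapsed time, but it is used only on a scale interval of length [nu * h],
    so that [nu] cancels. The kernels are tensor products of periodized Gaussians, hence every
    moment estimate reduces to one variable. *)

Section Calculus.

(** * Taylor remainders and series on the real line *)

Context {R : realType}.
Implicit Types (f g k : R -> R) (a : R ^nat).

(* A plain definition, since [is_derive] is a type class whose instances would be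
   inferred in place of the intended derivation. *)
Definition deriv_at f (x l : R) : Prop := is_derive x 1 f l.

(** Differentiation under a sum or an integral is always reduced to this criterion: a uniform
    second-order Taylor remainder survives summation and integration. *)
Lemma deriv_at_quad f (x l K delta : R) : 0 < delta ->
  (forall h, `|h| < delta -> `|f (x + h) - f x - h * l| <= K * h ^+ 2) ->
  deriv_at f x l.
Proof.
move=> d0 H.
have K0 : 0 <= K.
  have h2 : 0 < (delta / 2) ^+ 2 by rewrite exprn_gt0// divr_gt0.
  have lt : `|delta / 2| < delta by rewrite ger0_norm; lra.
  by have := le_trans (normr_ge0 _) (H (delta / 2) lt); rewrite pmulr_lge0.
have cv : (fun h => h^-1 *: ((f \o shift x) (h *: (1:R)) - f x)) @ 0^' --> l.
  apply/cvgrPdist_le => e e0.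
  have K1 : 0 < K + 1 by lra.
  have eK := divr_gt0 e0 K1.
  near=> h.
  have hn0 : h != 0 by near: h; exact: nbhs_dnbhs_neq.
  have hK : `|h| * K <= e.
    have : `|h| <= e / (K + 1) by near: h; exact: dnbhs0_le.
    by rewrite ler_pdivlMr//; have := normr_ge0 h; nra.
  have hd : `|h| < delta by near: h; exact: dnbhs0_lt.
  rewrite /= distrC.
  have -> : h^-1 *: (f (h *: (1:R) + x) - f x) - l = h^-1 * (f (x + h) - f x - h * l).
    by rewrite /GRing.scale /= mulr1 [h + x]addrC; field.
  suff : `|h^-1 * (f (x + h) - f x - h * l)| <= e :> R by [].
  rewrite normrM normfV ler_pdivrMl ?normr_gt0//.
  apply: le_trans (H _ hd) _.
  rewrite -(real_normK (num_real h)).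
  have := normr_ge0 h; nra.
by apply: DeriveDef; [apply/cvg_ex; exists l | apply/cvg_lim].
Unshelve. all: by end_near. Qed.

Lemma deriv_at_continuous f (x l : R) : deriv_at f x l -> {for x, continuous f}.
Proof. by move=> [d _]; exact/differentiable_continuous/derivable1_diffP. Qed.

Lemma MVT_oo f g (l r : R) : (forall z : R, l < z < r -> deriv_at f z (g z)) ->
  forall x y, l < x < r -> l < y < r ->
  exists c, [/\ Num.min x y <= c, c <= Num.max x y & f y - f x = g c * (y - x)].
Proof.
move=> df; have main x y : x <= y -> l < x < r -> l < y < r ->
    exists c, [/\ x <= c, c <= y & f y - f x = g c * (y - x)].
  move=> xy xlr ylr; have [||c] := @MVT_segment R f g x y xy.
  - by move=> z; rewrite in_itv/= => ?; apply: (df z); lra.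
  - apply: continuous_in_subspaceT => z; rewrite inE/= in_itv/= => ?.
    by apply: (@deriv_at_continuous _ _ (g z)); apply: df; lra.
  by rewrite in_itv/= => /andP[? ?] ?; exists c.
move=> x y xlr ylr; have [xy|/ltW yx] := leP x y; first by apply: main.
have [c [c1 c2 c3]] := main _ _ yx ylr xlr.
by exists c; split => //; lra.
Qed.

(** The mean value theorem is applied twice, which gives the constant [M] rather than [M / 2]; the
    size of the constant does not matter later. *)
Lemma taylor2_oo f g k (l r M : R) :
  (forall z : R, l < z < r -> deriv_at f z (g z)) ->
  (forall z : R, l < z < r -> deriv_at g z (k z)) ->
  (forall z, l < z < r -> `|k z| <= M) ->
  forall x y, l < x < r -> l < y < r ->
  `|f y - f x - (y - x) * g x| <= M * (y - x) ^+ 2.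
Proof.
move=> df dg kM x y xlr ylr.
have [c [c1 c2 ->]] := MVT_oo df xlr ylr.
have clr : l < c < r.
  by move: c1 c2; rewrite minElt maxElt; case: ifP => _ ? ?; lra.
have [e [e1 e2 egc]] := MVT_oo dg xlr clr.
have elr : l < e < r.
  by move: e1 e2; rewrite minElt maxElt; case: ifP => _ ? ?; lra.
have -> : g c * (y - x) - (y - x) * g x = k e * (c - x) * (y - x) by rewrite -egc; ring.
rewrite !normrM -(real_normK (num_real (y - x))) expr2 mulrA.
apply: ler_wpM2r => //; apply: ler_pM => //; first exact: kM.
move: c1 c2; rewrite minElt maxElt; case: ifP => xy c1 c2.
  by rewrite !ger0_norm; lra.
by rewrite !ler0_norm; lra.
Qed.

Lemma summable_bounded a (K : R) : (forall N, \sum_(n < N) `|a n| <= K) ->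
  cvgn (series a) /\ `|limn (series a)| <= K.
Proof.
move=> aK; have E N : [normed series a] N = \sum_(n < N) `|a n|.
  by rewrite -[LHS]/(\sum_(0 <= k < N) `|a k|) big_mkord.
have c : cvgn [normed series a].
  apply: nondecreasing_is_cvgn; first by apply: nondecreasing_series => i _ _; exact: normr_ge0.
  by exists K => _ [N _ <-]; rewrite E.
split; first exact: normed_cvg.
apply: le_trans (lim_series_norm c) _.
by apply: limr_le => //; near=> N; rewrite E.
Unshelve. all: by end_near. Qed.

Lemma series_tail_le a N (K : R) :
  (forall M, \sum_(n < M) `|a (N + n)%N| <= K) ->
  `|limn (series a) - \sum_(n < N) a n| <= K.
Proof.
move=> aK; have [c1 c2] := summable_bounded (a := fun n => a (N + n)%N) aK.
have E n : (N <= n)%N -> series a n = \sum_(i < N) a i + series (fun i => a (N + i)%N) (n - N)%N.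
  move=> Nn; rewrite /series/= (big_cat_nat _ (n := N))//= big_mkord; congr (_ + _).
  rewrite -{1}[N]add0n big_addn; apply: eq_bigr => i _; by rewrite addnC.
have cv : series a n @[n --> \oo] --> \sum_(i < N) a i + limn (series (fun i => a (N + i)%N)).
  rewrite -(cvg_shiftn N).
  have -> : [sequence series a (n + N)%N]_n = fun n => \sum_(i < N) a i + series (fun i => a (N + i)%N) n.
    by apply/funext => n /=; rewrite E ?leq_addl// addnK.
  by apply: cvgD; [exact: cvg_cst|].
by rewrite (cvg_lim _ cv)// addrC addKr.
Qed.

End Calculus.

(** * Differentiation rules at a point *)

Section PointwiseDerivatives.
Context {R : realType}.
Implicit Types f g : R -> R.

Lemma deriv_at_eq f (x a b : R) : deriv_at f x a -> a = b -> deriv_at f x b.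
Proof. by move=> df <-. Qed.

Lemma deriv_atD f g (x a b : R) : deriv_at f x a -> deriv_at g x b ->
  deriv_at (fun y => f y + g y) x (a + b).
Proof. by move=> df dg; exact: (@is_deriveD _ _ _ f g). Qed.

Lemma deriv_atN f (x a : R) : deriv_at f x a -> deriv_at (fun y => - f y) x (- a).
Proof. by move=> df; exact: (@is_deriveN _ _ _ f). Qed.

Lemma deriv_atM f g (x a b : R) : deriv_at f x a -> deriv_at g x b ->
  deriv_at (fun y => f y * g y) x (a * g x + f x * b).
Proof.
move=> df dg; have := @is_deriveM _ _ f g x 1 _ _ df dg.
by rewrite addrC /GRing.scale /= [a * _]mulrC.
Qed.

Lemma deriv_at_comp f g (x a b : R) : deriv_at f (g x) a -> deriv_at g x b ->
  deriv_at (fun y => f (g y)) x (a * b).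
Proof. by move=> df dg; have := @is_derive1_comp _ f g x a b df dg. Qed.

Lemma deriv_atX n f (x a : R) : deriv_at f x a ->
  deriv_at (fun y => f y ^+ n) x (n%:R * f x ^+ n.-1 * a).
Proof.
move=> df; have -> : (fun y => f y ^+ n) = f ^+ n by apply/funext => y; rewrite exprfctE.
exact: (@is_deriveX _ _ f n x 1 _ df).
Qed.

Lemma deriv_atV f (x a : R) : f x != 0 -> deriv_at f x a ->
  deriv_at (fun y => (f y)^-1) x (- (f x) ^- 2 * a).
Proof.
move=> fx0 [df va]; have h := @derivableV _ _ f x 1 fx0 df.
apply: DeriveDef; first exact: h.
by rewrite deriveV// va /GRing.scale/=.
Qed.

Lemma deriv_at_cst (c x : R) : deriv_at (fun=> c) x 0.
Proof. exact: is_derive_cst. Qed.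

Lemma deriv_at_id (x : R) : deriv_at (fun y => y) x 1.
Proof. exact: is_derive_id. Qed.

Lemma deriv_at_horner (p : {poly R}) (x : R) : deriv_at (fun y => p.[y]) x (p^`().[x]).
Proof. exact: is_derive_poly. Qed.

Lemma deriv_at_expR (x : R) : deriv_at expR x (expR x).
Proof. exact: is_derive_expR. Qed.

Lemma deriv_at_sqrt (x : R) : 0 < x -> deriv_at Num.sqrt x (2 * Num.sqrt x)^-1.
Proof. by move=> x0; exact: is_derive1_sqrt. Qed.

End PointwiseDerivatives.

(** * Derivatives of the Gaussian kernel in space and scale *)

Section GaussDerivatives.
Context {R : realType}.
Implicit Types (p : {poly R}) (s y r alpha : R) (b n N : nat).

(** Hermite polynomials up to sign and scaling: [herm b] is the polynomial that [b] derivatives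
    bring in front of exp(-x^2/4). *)
Fixpoint herm b : {poly R} :=
  if b is b'.+1 then (herm b')^`() - 2^-1 *: ('X * herm b') else 1.

(** The Hermite equation at [b] gives the lowering relation at [b], which in turn gives the equation
    at [b.+1]; so only the equation is proved by induction. The lowering relation is what makes all
    derivatives of the kernel solve the heat equation. *)
Lemma herm_ode b :
  (herm b.+1)^`() = - (b.+1%:R / 2) *: herm b /\
  (herm b)^`()^`() - 2^-1 *: ('X * (herm b)^`()) + (b%:R / 2) *: herm b = 0.
Proof.
have [h [h2 hE nE]] : exists h : {poly R},
    [/\ 2 * h = 1, (2^-1)%:P = h & forall n, (n%:R / 2)%:P = n%:R * h].
  exists (2^-1)%:P; split=> //; last by move=> n; rewrite polyCM polyC_natr.
  by rewrite -polyC_natr -polyCM divff.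
suff IH : (herm b)^`()^`() - h * ('X * (herm b)^`()) + (b%:R * h) * herm b = 0.
  split; last by rewrite -!mul_polyC nE hE.
  rewrite /= derivB derivZ derivM derivX mul1r -!mul_polyC polyCN nE hE -natr1.
  by move: IH => /(canRL (addrK _))/(canRL (subrK _)) ->; ring.
elim: b => [|b IH] /=; first by rewrite !derivC mulr0 mul0r; ring.
rewrite -!mul_polyC hE; set p := herm b in IH *.
have E : (p^`() - h * ('X * p))^`() = - (b.+1%:R * h) * p.
  rewrite derivB derivM -{1}hE derivC derivM derivX mul1r -natr1.
  by move: IH => /(canRL (addrK _))/(canRL (subrK _)) ->; ring.
have dh : h^`() = 0 by rewrite -hE derivC.
by rewrite E derivM derivN derivM -polyC_natr derivC dh; ring.
Qed.

Lemma horner_herm b (x : R) :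
  (herm b.+1).[x] = (herm b)^`().[x] - x / 2 * (herm b).[x].
Proof. by rewrite /= hornerD hornerN hornerZ hornerM hornerX; ring. Qed.

Lemma horner_deriv_herm b (x : R) : (herm b.+1)^`().[x] = - (b.+1%:R / 2) * (herm b).[x].
Proof. by rewrite (herm_ode b).1 !hornerE. Qed.

(** The [b]-th derivative in [y] of the heat kernel on the line, in a closed form that displays the
    parabolic scaling. *)
Definition gamma b s y : R :=
  (Num.sqrt s)^-1 ^+ b * (herm b).[y / Num.sqrt s] * gauss s y.

Lemma gamma0 s y : gamma 0 s y = gauss s y.
Proof. by rewrite /gamma expr0 /= hornerC !mul1r. Qed.

Lemma deriv_at_gauss_y s y : 0 < s ->
  deriv_at (gauss s) y (- (y / (2 * s)) * gauss s y).
Proof.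
move=> s0; rewrite /gauss.
apply: deriv_at_eq.
- apply: deriv_atM; first exact: deriv_at_cst.
  apply: deriv_at_comp; first exact: deriv_at_expR.
  apply: deriv_atM; last exact: deriv_at_cst.
  by apply: deriv_atN; apply: deriv_atX; exact: deriv_at_id.
- have : Num.sqrt (4 * pi * s) != 0 by rewrite gt_eqF// sqrtr_gt0 !mulr_gt0// pi_gt0.
  move: (Num.sqrt _) (expR _) => Q e Q0 /=; field.
  by rewrite Q0 gt_eqF.
Qed.

Lemma deriv_at_gauss_s s y : 0 < s ->
  deriv_at (fun s => gauss s y) s ((y ^+ 2 / (4 * s ^+ 2) - (2 * s)^-1) * gauss s y).
Proof.
move=> s0; rewrite /gauss.
have q0 : 0 < 4 * pi * s :> R by rewrite !mulr_gt0// pi_gt0.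
have sq : Num.sqrt (4 * pi * s) != 0 by rewrite gt_eqF// sqrtr_gt0.
apply: deriv_at_eq.
- apply: deriv_atM.
    apply: deriv_atV => //.
    apply: deriv_at_comp; first exact: deriv_at_sqrt.
    by apply: deriv_atM; [exact: deriv_at_cst | exact: deriv_at_id].
  apply: deriv_at_comp; first exact: deriv_at_expR.
  apply: deriv_atM; first exact: deriv_at_cst.
  apply: deriv_atV; first by rewrite mulf_neq0// gt_eqF.
  by apply: deriv_atM; [exact: deriv_at_cst | exact: deriv_at_id].
- have : Num.sqrt (4 * pi * s) ^+ 2 = 4 * pi * s by rewrite sqr_sqrtr// ltW.
  set Q := Num.sqrt _ in sq *; set e := expR _ => QE.
  have pi0 : pi != 0 :> R by rewrite gt_eqF// pi_gt0.
  have -> : Q ^- 2 = (4 * pi * s)^-1 by rewrite QE.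
  move: pi pi0 => p p0; field.
  by rewrite sq p0 gt_eqF.
Qed.

Lemma deriv_at_gamma_y b s y : 0 < s -> deriv_at (gamma b s) y (gamma b.+1 s y).
Proof.
move=> s0; have r0 : Num.sqrt s != 0 by rewrite gt_eqF// sqrtr_gt0.
rewrite /gamma; apply: deriv_at_eq.
- apply: deriv_atM; last exact: deriv_at_gauss_y.
  apply: deriv_atM; first exact: deriv_at_cst.
  apply: deriv_at_comp; first exact: (deriv_at_horner (herm b)).
  by apply: deriv_atM; [exact: deriv_at_id | exact: deriv_at_cst].
- have sE : s = Num.sqrt s ^+ 2 by rewrite sqr_sqrtr// ltW.
  rewrite horner_herm; move: (gauss s y) => G.
  move: sE; move: (Num.sqrt s) r0 => r r0 ->.
  by rewrite [_ ^+ b.+1]exprS; move: (r^-1 ^+ b) => q; field.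
Qed.

Lemma deriv_at_gamma_s b s y : 0 < s ->
  deriv_at (fun s => gamma b s y) s (gamma b.+2 s y).
Proof.
move=> s0; have r0 : Num.sqrt s != 0 by rewrite gt_eqF// sqrtr_gt0.
have dr : deriv_at (fun s => (Num.sqrt s)^-1) s (- Num.sqrt s ^- 2 * (2 * Num.sqrt s)^-1).
  by apply: deriv_atV => //; exact: deriv_at_sqrt.
rewrite /gamma; apply: deriv_at_eq.
- apply: deriv_atM; last exact: deriv_at_gauss_s.
  apply: deriv_atM; first exact: deriv_atX dr.
  apply: deriv_at_comp; first exact: (deriv_at_horner (herm b)).
  by apply: deriv_atM; [exact: deriv_at_cst | exact: dr].
- have sE : s = Num.sqrt s ^+ 2 by rewrite sqr_sqrtr// ltW.
  have X (x : R) : (herm b.+2).[x] = - (b.+1%:R / 2) * (herm b).[x]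
      - x / 2 * ((herm b)^`().[x] - x / 2 * (herm b).[x]).
    by rewrite horner_herm horner_deriv_herm horner_herm.
  rewrite X; move: (gauss s y) => G; move: sE {X}; move: (Num.sqrt s) r0 => r r0 ->.
  case: b => [|b]; first by rewrite /= derivC !hornerC; field.
  by rewrite !exprS -!natr1; move: (r^-1 ^+ b) => q; field.
Qed.

End GaussDerivatives.

(** * Scale-invariant bounds for the Gaussian derivatives *)

Section GaussBounds.
Context {R : realType}.
Implicit Types (p : {poly R}) (r s x y z : R) (b n N M : nat).

Lemma poly_growth p : exists n (A : R), 0 <= A /\ forall x, `|p.[x]| <= A * (1 + `|x|) ^+ n.
Proof.
elim/poly_ind: p => [|p c [n [A [A0 IH]]]].
  by exists 0%N, 0; split=> // x; rewrite horner0 normr0 mul0r.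
exists n.+1, (A + `|c|); split=> [|x]; first by rewrite addr_ge0.
rewrite hornerMXaddC (le_trans (ler_normD _ _))// normrM mulrDl lerD//.
  rewrite exprSr mulrA ler_pM//.
  by rewrite lerDr.
by rewrite ler_peMr// exprn_ege1// lerDl.
Qed.

(** With m = n + 1, exp(x^2/4) is the m-th power of exp(x^2/(4m)), and (1 + |x|)^2 <= 8m + 2x^2 = 8m
    (1 + x^2/(4m)) <= 8m exp(x^2/(4m)). *)
Lemma exp_growth n : exists B : R, 0 <= B /\
  forall x, (1 + `|x|) ^+ n * expR (- (x ^+ 2) / 4) <= B.
Proof.
pose m : R := n.+1%:R; have m0 : 0 < m by rewrite ltr0n.
have m1 : 1 <= m by rewrite ler1n.
exists (((8 * m) ^+ n.+1)); split=> [|x]; first by rewrite exprn_ge0// mulr_ge0// ltW.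
have x2 : x ^+ 2 = `|x| ^+ 2 by rewrite real_normK// num_real.
have e : expR (- (x ^+ 2) / 4) = (expR (x ^+ 2 / 4 / m) ^+ n.+1)^-1.
  rewrite -expRM_natl -expRN; congr expR; rewrite -/m; field.
  by rewrite gt_eqF.
rewrite e ler_pdivrMr ?exprn_gt0 ?expR_gt0// -exprMn.
apply: (@le_trans _ _ ((1 + `|x|) ^+ (2 * n.+1))).
  by rewrite ler_weXn2l ?lerDl//; lia.
rewrite exprM; apply: lerXn2r; rewrite ?nnegrE ?exprn_ge0 ?addr_ge0//.
  by rewrite !mulr_ge0 ?expR_ge0// ltW.
apply: (@le_trans _ _ (8 * m * (1 + x ^+ 2 / 4 / m))); last first.
  by rewrite ler_wpM2l ?expR_ge1Dx// mulr_ge0// ltW.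
have -> : 8 * m * (1 + x ^+ 2 / 4 / m) = 8 * m + 2 * x ^+ 2 by field; rewrite gt_eqF.
by rewrite x2; have := normr_ge0 x; nra.
Qed.

Lemma poly_exp_bounded p n : exists C : R, 0 <= C /\
  forall x, `|p.[x]| * (1 + `|x|) ^+ n * expR (- (x ^+ 2) / 4) <= C.
Proof.
have [k [A [A0 pA]]] := poly_growth p; have [B [B0 hB]] := exp_growth (k + n).
exists (A * B); split=> [|x]; first exact: mulr_ge0.
apply: le_trans (ler_wpM2l A0 (hB x)).
by rewrite exprD !mulrA ler_wpM2r ?expR_ge0// ler_wpM2r// exprn_ge0//.
Qed.

(** A majorant of width [r] that replaces the Gaussian. Its decay is only quadratic, but its sums
    over the integers telescope and its antiderivative on the half line is y / (r + y), so that sums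
    and integrals are bounded uniformly in [r]. *)
Definition kap r z : R := r / (r + `|z|) ^+ 2.

Lemma kap_ge0 r z : 0 < r -> 0 <= kap r z.
Proof. by move=> r0; rewrite /kap divr_ge0 ?exprn_ge0 ?addr_ge0// ltW. Qed.

Lemma kap_le r z w : 0 < r -> `|w| <= `|z| -> kap r z <= kap r w.
Proof.
move=> r0 wz; rewrite /kap ler_pM2l// lef_pV2 ?posrE ?exprn_gt0 ?ltr_wpDr//.
by rewrite ler_pXn2r ?nnegrE ?addr_ge0 ?lerD2l// ltW.
Qed.

Lemma kap_le_inv r z : 0 < r -> kap r z <= r^-1.
Proof.
move=> r0; apply: (@le_trans _ _ (kap r 0)); first by rewrite kap_le// normr0.
by rewrite /kap normr0 addr0 expr2 invfM mulrA divff ?mul1r// gt_eqF.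
Qed.

(* Telescoping: [r / (r + n + 1)^2 <= (n + 1) / (r + n + 1) - n / (r + n)]. *)
Lemma sum_kap_tail r N M : 0 < r -> \sum_(n < M) kap r (N + n).+1%:R <= r / (r + N%:R).
Proof.
move=> r0; apply: (@le_trans _ _ ((N + M)%:R / (r + (N + M)%:R) - N%:R / (r + N%:R))); last first.
  have h1 : 0 <= N%:R :> R by []. have h2 : 0 <= (N + M)%:R :> R by [].
  have d1 : 0 < r + N%:R by lra. have d2 : 0 < r + (N + M)%:R by lra.
  rewrite lerBlDr -mulrDl divff ?gt_eqF// ler_pdivrMr//; lra.
elim: M => [|M IH]; first by rewrite big_ord0 addn0 subrr.
rewrite big_ord_recr /= addnS.
apply: (le_trans (lerD IH (lexx _))).
rewrite /kap ger0_norm// -natr1; move: (N + M)%N => k.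
set q : R := k%:R; have q0 : 0 <= q by rewrite ler0n.
have d1 : 0 < r + q by lra. have d2 : 0 < r + (q + 1) by lra.
rewrite addrAC lerD2r -lerBrDl.
have -> : (q + 1) / (r + (q + 1)) - q / (r + q) = r / ((r + q) * (r + (q + 1))).
  by field; rewrite !gt_eqF.
rewrite ler_pM2l// lef_pV2 ?posrE ?exprn_gt0 ?mulr_gt0//.
by rewrite expr2 ler_pM2r//; lra.
Qed.

(** The term of index 0 is kept, since it can be as large as [r^-1]; all the others together
    contribute at most 1, for every [r]. *)
Lemma sum_kap r y M : 0 < r -> 0 <= y -> \sum_(n < M) kap r (y + n%:R) <= kap r y + 1.
Proof.
move=> r0 y0; case: M => [|M]; first by rewrite big_ord0 addr_ge0 ?kap_ge0.
rewrite big_ord_recl addr0 lerD2l; apply: (@le_trans _ _ (r / (r + 0%:R))); last first.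
  by rewrite addr0 divff// gt_eqF.
apply: le_trans (sum_kap_tail 0 M r0); apply: ler_sum => i _.
by rewrite kap_le// lift0 add0n ger0_norm// ger0_norm ?addr_ge0// lerDr.
Qed.

(** The extra factor on the left will absorb the weight coming from a Hölder increment. *)
Lemma gamma_bound b : exists C : R, 0 <= C /\ forall s y, 0 < s ->
  `|gamma b s y| * (1 + `|y| / Num.sqrt s) <= C * (Num.sqrt s)^-1 ^+ b * kap (Num.sqrt s) y.
Proof.
(* Here 3 = 2 + 1: two powers of [1 + |x|] for the denominator of [kap], one for the extra
   factor. *)
have [C [C0 hC]] := poly_exp_bounded (herm b) 3.
exists C; split=> // s y s0; have r0 : 0 < Num.sqrt s by rewrite sqrtr_gt0.
have sE : s = Num.sqrt s ^+ 2 by rewrite sqr_sqrtr// ltW.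
have pi1 : 1 <= 4 * pi :> R by have := @pi_ge2 R; lra.
rewrite /gamma /gauss sqrtrM ?mulr_ge0 ?pi_ge0//.
set q := Num.sqrt (4 * pi).
have q1 : 1 <= q by rewrite -sqrtr1 ler_wsqrtr.
have -> : - (y ^+ 2) / (4 * s) = - ((y / Num.sqrt s) ^+ 2) / 4.
  rewrite [in LHS]sE; field; by rewrite gt_eqF.
move: (Num.sqrt s) r0 => r r0.
have yE : `|y| = r * `|y / r| by rewrite normrM normfV (gtr0_norm r0) mulrCA divff ?mulr1 ?gt_eqF.
rewrite /kap yE [r * `|_| / r]mulrAC divff ?gt_eqF// mul1r.
move: (y / r) (hC (y / r)) => x {yE} hx; set e := expR _ in hx *.
have x0 : 0 < 1 + `|x| by rewrite ltr_wpDr.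
have e0 : 0 <= e by exact: expR_ge0.
rewrite invfM !normrM (ger0_norm e0) normrX !normfV (gtr0_norm (lt_le_trans ltr01 q1)) (gtr0_norm r0).
have -> : r / (r + r * `|x|) ^+ 2 = r^-1 * (1 + `|x|) ^- 2.
  have -> : r + r * `|x| = r * (1 + `|x|) by ring.
  by field; rewrite !gt_eqF.
have rb : 0 <= r^-1 ^+ b by rewrite exprn_ge0// invr_ge0 ltW.
rewrite [C * _]mulrC -!mulrA ler_wpM2l//.
rewrite [leRHS]mulrCA.
have -> : `|(herm b).[x]| * (q^-1 * (r^-1 * (e * (1 + `|x|)))) =
  r^-1 * (q^-1 * (`|(herm b).[x]| * e * (1 + `|x|))).
  by ring.
rewrite ler_pM2l ?invr_gt0//.
apply: (@le_trans _ _ (`|(herm b).[x]| * e * (1 + `|x|))).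
  by rewrite ler_piMl ?mulr_ge0 ?(ltW x0)// invf_le1// (lt_le_trans ltr01).
rewrite ler_pdivlMr ?exprn_gt0//; apply: le_trans hx.
by rewrite le_eqVlt; apply/orP; left; apply/eqP; ring.
Qed.

Lemma gamma_bound1 b : exists C : R, 0 <= C /\ forall s y, 0 < s ->
  `|gamma b s y| <= C * (Num.sqrt s)^-1 ^+ b * kap (Num.sqrt s) y.
Proof.
have [C [C0 hC]] := gamma_bound b; exists C; split=> // s y s0.
by apply: le_trans (hC s y s0); rewrite ler_peMr// lerDl divr_ge0// sqrtr_ge0.
Qed.

(* The bound is uniform for [s] in a compact subinterval of [(0, +oo)] and [y] bounded:
   [n <= |z| + Y] gives [r0 + n <= (r + |z|) (1 + Y / r0)] for [r >= r0]. *)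
Lemma gamma_locally_summable b (s0 s1 Y : R) : 0 < s0 -> 0 <= Y -> exists K : R, 0 <= K /\
  forall s y n, s0 <= s <= s1 -> `|y| <= Y ->
  `|gamma b s (y + n%:R)| + `|gamma b s (y - n.+1%:R)| <= K * kap (Num.sqrt s0) n%:R.
Proof.
move=> s00 Y0; have [C [C0 hC]] := gamma_bound1 b.
set r0 := Num.sqrt s0; set r1 := Num.sqrt s1.
have r00 : 0 < r0 by rewrite sqrtr_gt0.
have r10 : 0 <= r1 by exact: sqrtr_ge0.
set D := C * r0^-1 ^+ b * (r1 / r0 * (1 + Y / r0) ^+ 2).
have A0 : 0 <= 1 + Y / r0 by rewrite addr_ge0// divr_ge0// ltW.
have rb0 : 0 <= r0^-1 ^+ b by rewrite exprn_ge0// invr_ge0 ltW.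
exists (2 * D); split.
  by rewrite !mulr_ge0// ?exprn_ge0// invr_ge0 ltW.
move=> s y n /andP[s0s ss1] yY.
have s_gt0 : 0 < s := lt_le_trans s00 s0s.
have key z : n%:R <= `|z| + Y -> `|gamma b s z| <= D * kap r0 n%:R.
  move=> nz; apply: le_trans (hC s z s_gt0) _.
  have : r0 <= Num.sqrt s by rewrite ler_wsqrtr.
  have : Num.sqrt s <= r1 by rewrite ler_wsqrtr.
  move: (Num.sqrt s) => r rr1 r0r; have r_gt0 : 0 < r := lt_le_trans r00 r0r.
  rewrite /D -!mulrA ler_wpM2l//; apply: ler_pM.
  - by rewrite exprn_ge0// invr_ge0 ltW.
  - exact: kap_ge0.
  - by apply: lerXn2r; rewrite ?nnegrE ?invr_ge0 ?(ltW r00) ?(ltW r_gt0)// lef_pV2 ?posrE.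
  rewrite /kap [`|n%:R|]ger0_norm//; set a := r + `|z|; set c := r0 + n%:R.
  have a0 : 0 < a by rewrite ltr_wpDr.
  have c0 : 0 < c by rewrite ltr_wpDr.
  have ca : c <= a * (1 + Y / r0).
    have z0 := normr_ge0 z.
    have : 0 <= (a - r0) * (Y / r0).
      by rewrite mulr_ge0 ?divr_ge0 ?(ltW r00)// /a; lra.
    have e1 : r0 * (Y / r0) = Y by rewrite mulrC divfK// gt_eqF.
    by rewrite mulrBl e1 /a /c mulrDr mulr1 => h; lra.
  apply: (@le_trans _ _ (r1 * ((1 + Y / r0) ^+ 2 / c ^+ 2))); last first.
    by rewrite le_eqVlt; apply/orP; left; apply/eqP; field; rewrite !gt_eqF.
  apply: ler_pM => //; [exact: ltW|by rewrite invr_ge0 exprn_ge0// ltW|].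
  rewrite -exprVn -expr_div_n ler_pXn2r ?nnegrE ?invr_ge0 ?divr_ge0 ?(ltW a0) ?(ltW c0)//.
  by rewrite ler_pdivlMr// mulrC ler_pdivrMr// mulrC.
have k1 : `|gamma b s (y + n%:R)| <= D * kap r0 n%:R.
  apply: key; have := ler_normB (y + n%:R) y; rewrite addrAC subrr add0r ger0_norm//; lra.
have k2 : `|gamma b s (y - n.+1%:R)| <= D * kap r0 n%:R.
  apply: key; have := ler_normB y (y - n.+1%:R); rewrite opprB addrC subrK ger0_norm// -natr1; lra.
lra.
Qed.

End GaussBounds.

(** * The periodized kernel: derivatives, periodicity, pointwise bounds *)

Section ThetaDerivatives.
Context {R : realType}.
Implicit Types (r s x y z : R) (b n N M : nat).

Lemma series_comb (u v w : R ^nat) (h : R) :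
  cvgn (series u) -> cvgn (series v) -> cvgn (series w) ->
  limn (series (fun n => u n - v n - h * w n)) =
  limn (series u) - limn (series v) - h * limn (series w).
Proof.
move=> cu cv cw; apply/cvg_lim => //.
have -> : series (fun n => u n - v n - h * w n) =
    fun n => series u n - series v n - h * series w n.
  by apply/funext => n; rewrite /series/= !sumrB mulr_sumr.
by apply: cvgB; [apply: cvgB|apply: cvgMr].
Qed.

Lemma deriv_at_series (F G H : nat -> R -> R) (m : R ^nat) (x delta S : R) : 0 < delta ->
  (forall n z, x - delta < z < x + delta ->
    [/\ deriv_at (F n) z (G n z), deriv_at (G n) z (H n z) & `|H n z| <= m n]) ->
  (forall N, \sum_(n < N) m n <= S) ->
  (forall z, x - delta < z < x + delta -> cvgn (series (F ^~ z))) ->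
  cvgn (series (G ^~ x)) ->
  deriv_at (fun z => limn (series (F ^~ z))) x (limn (series (G ^~ x))).
Proof.
move=> d0 FGH mS cF cG; apply: (@deriv_at_quad _ _ _ _ S delta) => // h hd.
have hd' : x - delta < x + h < x + delta by move: hd; rewrite ltr_norml; lra.
have xd : x - delta < x < x + delta by lra.
rewrite -series_comb//; try exact: cF.
apply: (summable_bounded _).2 => N.
apply: (@le_trans _ _ (\sum_(n < N) m n * h ^+ 2)); last first.
  by rewrite -mulr_suml ler_wpM2r// sqr_ge0.
apply: ler_sum => i _.
have := @taylor2_oo _ (F i) (G i) (H i) (x - delta) (x + delta) (m i)
  (fun z hz => let: And3 a _ _ := FGH i z hz in a)
  (fun z hz => let: And3 _ a _ := FGH i z hz in a)
  (fun z hz => let: And3 _ _ a := FGH i z hz in a) x (x + h) xd hd'.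
by rewrite [x + h]addrC addrK.
Qed.

Lemma archimedean_eq0 r x (K : R) : 0 < r -> (forall N, `|x| <= K * (r / (r + N%:R))) -> x = 0.
Proof.
move=> r0 H; apply/eqP; rewrite -normr_eq0 eq_le normr_ge0 andbT leNgt; apply/negP => x0.
have K0 : 0 <= K.
  have := le_trans (normr_ge0 _) (H 0%N); rewrite addr0 divff ?mulr1//.
  by rewrite gt_eqF.
have [N] : exists N : nat, K * r / `|x| < N%:R.
  by exists (Num.truncn (K * r / `|x|)).+1; exact: truncnS_gt.
rewrite ltr_pdivrMr// => h; have := H N.
have rN : 0 < r + N%:R by rewrite ltr_wpDr.
rewrite mulrA ler_pdivlMr// => h2; have := mulr_gt0 x0 r0; lra.
Qed.

(** The shifts [n] and [- n.+1] together run through the integers once, in the order used by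
    [theta]. *)
Definition thterm b s n y : R := gamma b s (y + n%:R) + gamma b s (y - n.+1%:R).

(** With the order [b] as a parameter, differentiation only moves an index: by 1 for a derivative in
    [y], by 2 for one in [s]. *)
Definition th b s y : R := limn (series (fun n => thterm b s n y)).

Lemma theta_th s y : theta s y = th 0 s y.
Proof.
rewrite /theta /th; congr (limn _); apply/funext => N.
rewrite /series /= big_mkord; apply: eq_bigr => i _.
by rewrite /thterm !gamma0.
Qed.

Lemma thterm_bound b (s0 s1 Y : R) : 0 < s0 -> 0 <= Y -> exists K : R, 0 <= K /\
  forall s y n, s0 <= s <= s1 -> `|y| <= Y -> `|thterm b s n y| <= K * kap (Num.sqrt s0) n%:R.
Proof.
move=> s00 Y0; have [K [K0 hK]] := gamma_locally_summable b s1 s00 Y0.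
by exists K; split=> // s y n ss yY; apply: le_trans (ler_normD _ _) _; exact: hK.
Qed.

Lemma sum_kap_le r (K : R) N : 0 < r -> 0 <= K -> \sum_(n < N) K * kap r n%:R <= K * (r^-1 + 1).
Proof.
move=> r0 K0; rewrite -mulr_sumr ler_wpM2l//.
under eq_bigr do rewrite -[_%:R]add0r.
by apply: le_trans (sum_kap _ r0 (lexx _)) _; rewrite lerD2r kap_le_inv.
Qed.

Lemma is_cvg_th b s y : 0 < s -> cvgn (series (fun n => thterm b s n y)).
Proof.
move=> s0; have [K [K0 hK]] := thterm_bound b s s0 (normr_ge0 y).
have r0 : 0 < Num.sqrt s by rewrite sqrtr_gt0.
apply: (summable_bounded (K := K * ((Num.sqrt s)^-1 + 1)) _).1 => N.
apply: le_trans (sum_kap_le N r0 K0); apply: ler_sum => i _.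
by apply: hK; rewrite ?lexx.
Qed.

Lemma th_locally_bounded b (s0 s1 Y : R) : 0 < s0 -> 0 <= Y -> exists K : R, 0 <= K /\
  forall s y, s0 <= s <= s1 -> `|y| <= Y -> `|th b s y| <= K.
Proof.
move=> s00 Y0; have [K [K0 hK]] := thterm_bound b s1 s00 Y0.
have r0 : 0 < Num.sqrt s0 by rewrite sqrtr_gt0.
exists (K * ((Num.sqrt s0)^-1 + 1)); split.
  by rewrite mulr_ge0// addr_ge0// invr_ge0 ltW.
move=> s y ss yY; apply: (summable_bounded _).2 => N.
by apply: le_trans (sum_kap_le N r0 K0); apply: ler_sum => i _; exact: hK.
Qed.

(** Periodicity and total mass hold for finite sums only up to boundary terms, so a rate of
    convergence, uniform for bounded [y], is needed to pass to the limit. The partial sum has [N.+1]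
    terms because the tail estimate for [kap] starts at index [N.+1]. *)
Lemma th_tail b s (Y : R) : 0 < s -> 0 <= Y -> exists K : R, 0 <= K /\
  forall y N, `|y| <= Y ->
  `|th b s y - \sum_(n < N.+1) thterm b s n y| <= K * (Num.sqrt s / (Num.sqrt s + N%:R)).
Proof.
move=> s0 Y0; have [K [K0 hK]] := thterm_bound b s s0 Y0.
have r0 : 0 < Num.sqrt s by rewrite sqrtr_gt0.
exists K; split=> // y N yY; apply: series_tail_le => M.
apply: le_trans (ler_wpM2l K0 (sum_kap_tail N M r0)).
rewrite mulr_sumr; apply: ler_sum => i _.
by rewrite -addSn; apply: hK; rewrite ?lexx.
Qed.

Lemma deriv_at_thterm_y b s n y : 0 < s -> deriv_at (thterm b s n) y (thterm b.+1 s n y).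
Proof.
move=> s0; have sh (c : R) : deriv_at (fun y => gamma b s (y + c)) y (gamma b.+1 s (y + c)).
  apply: deriv_at_eq.
    apply: deriv_at_comp; first exact: deriv_at_gamma_y.
    by apply: deriv_atD; [exact: deriv_at_id|exact: deriv_at_cst].
  by rewrite addr0 mulr1.
by apply: deriv_atD; exact: sh.
Qed.

Lemma deriv_at_thterm_s b s n y : 0 < s ->
  deriv_at (fun s => thterm b s n y) s (thterm b.+2 s n y).
Proof. by move=> s0; apply: deriv_atD; exact: deriv_at_gamma_s. Qed.

Lemma deriv_at_th_y b s y : 0 < s -> deriv_at (th b s) y (th b.+1 s y).
Proof.
move=> s0; have Y0 : 0 <= `|y| + 1 by rewrite addr_ge0.
have [K [K0 hK]] := thterm_bound b.+2 s s0 Y0.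
have r0 : 0 < Num.sqrt s by rewrite sqrtr_gt0.
apply: (@deriv_at_series (thterm b s) (thterm b.+1 s) (thterm b.+2 s)
  (fun n => K * kap (Num.sqrt s) n%:R) y 1 (K * ((Num.sqrt s)^-1 + 1))) => //.
- move=> n z zy; split; [exact: deriv_at_thterm_y|exact: deriv_at_thterm_y|].
  apply: hK; rewrite ?lexx// ler_norml.
  by have := ler_norm y; have := ler_norm (- y); rewrite normrN; lra.
- by move=> N; exact: sum_kap_le.
- by move=> z _; exact: is_cvg_th.
- exact: is_cvg_th.
Qed.

Lemma deriv_at_th_s b s y : 0 < s -> deriv_at (fun s => th b s y) s (th b.+2 s y).
Proof.
move=> s0; have s20 : 0 < s / 2 by rewrite divr_gt0.
have [K [K0 hK]] := thterm_bound b.+4 (s + s / 2) s20 (normr_ge0 y).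
have r0 : 0 < Num.sqrt (s / 2) by rewrite sqrtr_gt0.
apply: (@deriv_at_series (fun n s => thterm b s n y) (fun n s => thterm b.+2 s n y)
  (fun n s => thterm b.+4 s n y) (fun n => K * kap (Num.sqrt (s / 2)) n%:R) s (s / 2)
  (K * ((Num.sqrt (s / 2))^-1 + 1))) => //.
- move=> n z zs; have z0 : 0 < z by lra.
  split; [exact: deriv_at_thterm_s|exact: deriv_at_thterm_s|].
  by apply: hK => //; lra.
- by move=> N; exact: sum_kap_le.
- by move=> z zs; apply: is_cvg_th; lra.
- exact: is_cvg_th.
Qed.

Lemma sum_thterm_shift b s y N : \sum_(n < N) thterm b s n (y + 1) =
  \sum_(n < N) thterm b s n y + gamma b s (y + N%:R) - gamma b s (y - N%:R).
Proof.
elim: N => [|N IH]; first by rewrite !big_ord0 addr0 subr0 add0r subrr.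
rewrite !big_ord_recr /= IH /thterm.
have -> : y + 1 + N%:R = y + N.+1%:R by rewrite -natr1; ring.
have -> : y + 1 - N.+1%:R = y - N%:R by rewrite -natr1; ring.
ring.
Qed.

(** Translating a partial sum by one period changes it by two boundary terms, which tend to 0 at the
    rate of the tail. *)
Lemma th_periodic b s y : 0 < s -> th b s (y + 1) = th b s y.
Proof.
move=> s0; have r0 : 0 < Num.sqrt s by rewrite sqrtr_gt0.
have Y0 : 0 <= `|y| + 1 by rewrite addr_ge0.
have [K [K0 hK]] := th_tail b s0 Y0.
have [D [D0 hD]] := gamma_locally_summable b s s0 Y0.
apply/eqP; rewrite -subr_eq0; apply/eqP.
apply: (@archimedean_eq0 (Num.sqrt s) _ (2 * K + 2 * D)) => // N.
have yY : `|y| <= `|y| + 1 by rewrite lerDl.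
have yY1 : `|y + 1| <= `|y| + 1 by rewrite (le_trans (ler_normD _ _))// normr1.
have ss : s <= s <= s by rewrite lexx.
have h1 := hK (y + 1) N yY1; have h2 := hK y N yY; rewrite sum_thterm_shift in h1.
have := sum_kap_tail N 1 r0; rewrite big_ord1 addn0 => hk.
(* The bound at [y] controls the boundary term at [y + N.+1%:R], and the bound at [y + 1] the one at
   [y - N.+1%:R]. *)
have h3 := le_trans (hD s y N.+1 ss yY) (ler_wpM2l D0 hk).
have := le_trans (hD s (y + 1) N.+1 ss yY1) (ler_wpM2l D0 hk).
have -> : y + 1 - N.+2%:R = y - N.+1%:R by rewrite -!natr1; ring.
move: h1 h2 h3; set q := _ / (_ + _); set P := \sum_(n < _) _.
set u := gamma b s (y + N.+1%:R); set v := gamma b s (y - N.+1%:R).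
have := normr_ge0 (gamma b s (y - N.+2%:R)).
have := normr_ge0 (gamma b s (y + 1 + N.+1%:R)).
rewrite !ler_norml => + + /andP[+ +] /andP[+ +] + +.
have := ler_norm u; have := ler_norm (- u); have := ler_norm v; have := ler_norm (- v).
rewrite !normrN mulrDl => *; apply/andP; split; lra.
Qed.

Lemma th_Nper b s y n : 0 < s -> th b s (y + n%:R) = th b s y.
Proof.
by move=> s0; elim: n => [|n IH]; rewrite ?addr0// -natr1 addrA th_periodic.
Qed.

Lemma th_reduce s y : 0 < s -> exists x, 0 <= x <= 1 /\ forall b, th b s y = th b s x.
Proof.
move=> s0; have h := floor_itv y.
exists (y - (Num.floor y)%:~R); split.
  by move: h; rewrite intrD; lra.
move=> b; case: (Num.floor y) => n /=.
  by rewrite -[in LHS](subrK n%:R y) th_Nper// .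
by rewrite NegzE mulrNz opprK -pmulrn th_Nper.
Qed.

Lemma th_bounded b (s0 s1 : R) : 0 < s0 -> exists K : R, 0 <= K /\
  forall s y, s0 <= s <= s1 -> `|th b s y| <= K.
Proof.
move=> s00; have [K [K0 hK]] := th_locally_bounded b s1 s00 ler01.
exists K; split=> // s y ss; have [|x [x01 ->]] := @th_reduce s y; first by lra.
by apply: hK => //; rewrite ger0_norm; lra.
Qed.

(** Every image [y + n] and [y - n.+1] is at distance at least [w] from 0, because [w] does not
    exceed the distance from [y] to the integers. The weight can thus be moved inside the sum, where
    [gamma_bound] absorbs it. The two nearest images are kept; the others account for the constant
    2. *)
Lemma th_bound b : exists C : R, 0 <= C /\ forall s y w, 0 < s -> 0 <= y <= 1 ->
  0 <= w -> w <= y -> w <= 1 - y ->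
  (1 + w / Num.sqrt s) * `|th b s y| <=
    C * (Num.sqrt s)^-1 ^+ b * (kap (Num.sqrt s) y + kap (Num.sqrt s) (1 - y) + 2).
Proof.
have [C [C0 hC]] := @gamma_bound R b.
exists C; split=> // s y w s0 y01 w0 wy wy1.
have r0 : 0 < Num.sqrt s by rewrite sqrtr_gt0.
have W0 : 0 < 1 + w / Num.sqrt s by rewrite ltr_wpDr// divr_ge0// ltW.
have D0 : 0 <= C * (Num.sqrt s)^-1 ^+ b by rewrite mulr_ge0// exprn_ge0// invr_ge0 ltW.
rewrite mulrC -ler_pdivlMr//.
apply: (summable_bounded _).2 => N; rewrite ler_pdivlMr// mulr_suml.
apply: (@le_trans _ _ (\sum_(n < N) C * (Num.sqrt s)^-1 ^+ b *
    (kap (Num.sqrt s) (y + n%:R) + kap (Num.sqrt s) (1 - y + n%:R)))); last first.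
  rewrite -mulr_sumr ler_wpM2l// big_split /=.
  have := sum_kap N r0 (y := y) _; have := sum_kap N r0 (y := 1 - y) _.
  by move=> /(_ _)/[swap]; move=> /(_ _) + h2; lra.
apply: ler_sum => n _.
have key z : w <= `|z| -> `|gamma b s z| * (1 + w / Num.sqrt s) <=
    C * (Num.sqrt s)^-1 ^+ b * kap (Num.sqrt s) z.
  move=> wz; apply: le_trans (hC s z s0); rewrite ler_wpM2l// lerD2l.
  by rewrite ler_pM2r ?invr_gt0.
apply: (@le_trans _ _ ((`|gamma b s (y + n%:R)| + `|gamma b s (y - n.+1%:R)|) * (1 + w / Num.sqrt s))).
  by rewrite ler_pM2r// ler_normD.
have n0 : 0 <= n%:R :> R by [].
rewrite mulrDl [leRHS]mulrDr lerD//.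
  by apply: key; rewrite ger0_norm; lra.
have e : y - n.+1%:R = - (1 - y + n%:R) by rewrite -natr1; ring.
have <- : kap (Num.sqrt s) (y - n.+1%:R) = kap (Num.sqrt s) (1 - y + n%:R).
  by rewrite /kap e normrN.
by apply: key; rewrite e normrN ger0_norm; lra.
Qed.

End ThetaDerivatives.

(** * Integration over a period of continuous functions *)

Section SegmentIntegral.
Context {R : realType}.
Local Notation mu := (@lebesgue_measure R).
Implicit Types (f g F : R -> R) (a b c x y : R).

Lemma integrable_continuous f a b : continuous f -> mu.-integrable `[a, b] (EFin \o f).
Proof.
move=> cf; apply: continuous_compact_integrable; first exact: segment_compact.
exact: continuous_subspaceT.
Qed.

Lemma FTC_segment f F a b : a < b -> continuous f ->
  (forall x, a <= x <= b -> deriv_at F x (f x)) ->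
  \int[mu]_(x in `[a, b]) f x = F b - F a.
Proof.
move=> ab cf dF; rewrite /Rintegral (@continuous_FTC2 _ _ F)//.
- exact: continuous_subspaceT.
- have cF x : a <= x <= b -> {for x, continuous F}.
    by move=> xab; exact: deriv_at_continuous (dF x xab).
  split.
  + by move=> x; rewrite in_itv/= => xab; have [] : deriv_at F x (f x) by apply: dF; lra.
  + by apply: cvg_at_right_filter; apply: cF; rewrite lexx ltW.
  + by apply: cvg_at_left_filter; apply: cF; rewrite lexx ltW.
- move=> x; rewrite in_itv/= => xab; rewrite derive1E.
  by have [_ ->] : deriv_at F x (f x) by apply: dF; lra.
Qed.

Lemma antiderivative_exists f a b : continuous f ->
  exists F, forall x, a <= x <= b -> deriv_at F x (f x).
Proof.
(* Starting the integral at [a - 1] makes [a] an interior point, where the derivative is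
   two-sided. *)
move=> cf; exists (fun x => \int[mu]_(t in `[a - 1, x]) f t) => x xab.
have x1 : x < x + 1 by lra.
have ax : a - 1 < x by lra.
have [dF vF] := @continuous_FTC1_closed R f (a - 1) x (x + 1) x1
  (integrable_continuous _ _ cf) ax (cf x).
apply: DeriveDef; first exact: dF.
by rewrite -derive1E.
Qed.

Definition intJ f : R := \int[mu]_(y in `[0, 1]) f y.

Lemma intJD f g : continuous f -> continuous g ->
  intJ (fun y => f y + g y) = intJ f + intJ g.
Proof. by move=> cf cg; rewrite /intJ RintegralD//; exact: integrable_continuous. Qed.

Lemma intJZ k f : continuous f -> intJ (fun y => k * f y) = k * intJ f.
Proof. by move=> cf; rewrite /intJ RintegralZl//; exact: integrable_continuous. Qed.

Lemma intJ_cst k : intJ (fun=> k) = k.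
Proof.
rewrite /intJ Rintegral_cst//= lebesgue_measure_itv/= lte_fin ltr01.
by rewrite -EFinB/= subr0 mulr1.
Qed.

Lemma intJ_le f g : continuous f -> continuous g -> (forall y, 0 <= y <= 1 -> f y <= g y) ->
  intJ f <= intJ g.
Proof.
by move=> cf cg fg; apply: le_Rintegral => //; exact: integrable_continuous.
Qed.

Lemma eq_intJ f g : (forall y, 0 <= y <= 1 -> f y = g y) -> intJ f = intJ g.
Proof.
by move=> fg; apply: eq_Rintegral => y; rewrite inE/= in_itv/=; exact: fg.
Qed.

Lemma intJ_norm f : continuous f -> `|intJ f| <= intJ (fun y => `|f y|).
Proof. by move=> cf; apply: le_normr_Rintegral => //; exact: integrable_continuous. Qed.

Lemma continuous_compf f g : continuous f -> continuous g -> continuous (fun y => f (g y)).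
Proof. by move=> cf cg y; exact: (@continuous_comp _ _ _ g f y (cg y) (cf _)). Qed.

Lemma continuous_reflect f c : continuous f -> continuous (fun y => f (c - y)).
Proof.
move=> cf; apply: (continuous_compf (g := fun y => c - y)) => // y.
by apply: cvgB; [exact: cvg_cst|exact: cvg_id].
Qed.

Lemma continuous_shift f c : continuous f -> continuous (fun y => f (y + c)).
Proof.
move=> cf; apply: (continuous_compf (g := fun y => y + c)) => // y.
by apply: cvgD; [exact: cvg_id|exact: cvg_cst].
Qed.

Lemma continuous_normf f : continuous f -> continuous (fun y => `|f y|).
Proof. by move=> cf x; apply: cvg_norm; exact: cf. Qed.

Lemma intJ_norm_le f k : continuous f -> (forall y, 0 <= y <= 1 -> `|f y| <= k) ->
  `|intJ f| <= k.
Proof.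
move=> cf fk; apply: le_trans (intJ_norm cf) _; rewrite -[leRHS](intJ_cst k).
by apply: intJ_le => //; [exact: continuous_normf | move=> ?; exact: cvg_cst].
Qed.

Lemma intJ_FTC f F : continuous f -> (forall x, 0 <= x <= 1 -> deriv_at F x (f x)) ->
  intJ f = F 1 - F 0.
Proof. by move=> cf dF; exact: FTC_segment. Qed.

Lemma intJ_sum (h : nat -> R -> R) N : (forall n, continuous (h n)) ->
  intJ (fun y => \sum_(n < N) h n y) = \sum_(n < N) intJ (h n).
Proof.
move=> ch; have cs M : continuous (fun y => \sum_(n < M) h n y).
  elim: M => [|M IH] x.
    by under eq_fun do rewrite big_ord0; exact: cvg_cst.
  under eq_fun do rewrite big_ord_recr /=.
  by apply: cvgD; [exact: IH | exact: ch].
elim: N => [|N IH].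
  by rewrite big_ord0; under eq_intJ do rewrite big_ord0; rewrite intJ_cst.
rewrite big_ord_recr /= -IH -intJD//.
by apply: eq_intJ => y _; rewrite big_ord_recr.
Qed.

(** For an antiderivative F, the function F(z + 1) - F(z) is constant by periodicity, so all
    intervals of length 1 carry the same integral; the bound [M] only has to leave room for 0, 1,
    [c - 1] and [c]. *)
Lemma intJ_reflect f c : continuous f -> (forall x, f (x + 1) = f x) ->
  intJ (fun y => f (c - y)) = intJ f.
Proof.
move=> cf pf; pose M := `|c| + 3.
have [F dF] := @antiderivative_exists f (- M) M cf.
have cM := ler_norm c; have cM' := ler_norm (- c); rewrite normrN in cM'.
have c0 : 0 <= `|c| by [].
have dG z : - M < z < M - 1 -> deriv_at (fun z => F (z + 1) - F z) z ((fun=> 0) z).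
  move=> zM; apply: deriv_at_eq.
    apply: deriv_atD; last first.
      by apply: deriv_atN; apply: dF; lra.
    apply: (@deriv_at_comp _ F (fun z => z + 1)); first by apply: dF; lra.
    by apply: deriv_atD; [exact: deriv_at_id|exact: deriv_at_cst].
  by rewrite pf addr0 mulr1 subrr.
have [_ [_ _]] := MVT_oo dG (x := 0) (y := c - 1) ltac:(rewrite /M; lra) ltac:(rewrite /M; lra).
rewrite mul0r add0r subrK => /eqP; rewrite subr_eq0 => /eqP E.
rewrite (@intJ_FTC f F)//; last by move=> x x01; apply: dF; rewrite /M; lra.
rewrite (@intJ_FTC _ (fun y => - F (c - y))).
- by rewrite subr0 opprK addrC -E.
- exact: continuous_reflect.
- move=> x x01; apply: deriv_at_eq.
    apply: deriv_atN; apply: deriv_at_comp; first by apply: dF; rewrite /M; lra.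
    by apply: deriv_atD; [exact: deriv_at_cst|apply: deriv_atN; exact: deriv_at_id].
  by rewrite add0r mulrN mulr1 opprK.
Qed.

(** This serves the measurability of integrals that depend on a parameter: they become limits of
    finite sums. *)
Lemma intJ_riemann f : continuous f ->
  (forall e, 0 < e -> exists d, 0 < d /\ forall x y, `|x - y| < d -> `|f x - f y| < e) ->
  (fun n => n.+1%:R^-1 * \sum_(j < n.+1) f (j%:R / n.+1%:R)) @ \oo --> intJ f.
Proof.
move=> cf ucf; apply/cvgrPdist_le => e e0.
have [d [d0 hd]] := ucf e e0.
have [F dF] := @antiderivative_exists f (-1) 2 cf.
near=> n.
have nd : d^-1 < n%:R by near: n; exact: nbhs_infty_gtr.
set m : R := n.+1%:R.
have m0 : 0 < m by rewrite ltr0n.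
have md : m^-1 < d.
  rewrite -[ltRHS]invrK ltf_pV2 ?posrE ?invr_gt0//.
  by rewrite (lt_trans nd)// ltr_nat.
rewrite (@intJ_FTC _ F)//; last by move=> x x01; apply: dF; lra.
have -> : F 1 - F 0 = \sum_(j < n.+1) (F (j.+1%:R / m) - F (j%:R / m)).
  rewrite -(big_mkord xpredT (fun j => F (j.+1%:R / m) - F (j%:R / m))).
  by rewrite telescope_sumr// mul0r divff// gt_eqF.
rewrite mulr_sumr -sumrB (le_trans (ler_norm_sum _ _ _))//.
apply: (@le_trans _ _ (\sum_(j < n.+1) e / m)); last first.
  by rewrite sumr_const card_ord -mulr_natr divfK// gt_eqF.
apply: ler_sum => j _.
have jm : j%:R / m + m^-1 <= 1.
  by rewrite -[X in _ + X]mul1r -mulrDl ler_pdivrMr// mul1r natr1 ler_nat.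
have j0 : 0 <= j%:R / m by rewrite divr_ge0// ltW.
have mi0 : 0 < m^-1 by rewrite invr_gt0.
have jS : j.+1%:R / m = j%:R / m + m^-1 by rewrite -natr1 mulrDl mul1r.
rewrite jS; suff main (x w : R) : 0 <= x -> x + w <= 1 -> 0 < w -> w < d ->
    `|F (x + w) - F x - w * f x| <= e * w by exact: main.
move=> {jm j0 mi0 md jS j m m0} x0 jm mi0 md.
have dF' z : -1 < z < 2 -> deriv_at F z (f z) by move=> zz; apply: dF; lra.
have l1 : -1 < x < 2 by lra.
have l2 : -1 < x + w < 2 by lra.
have [c [c1 c2 ->]] := MVT_oo dF' l1 l2.
rewrite addrAC subrr add0r mulrC -mulrBr normrM (gtr0_norm mi0) mulrC ler_pM2r//.
rewrite ltW// hd//; move: c1 c2; rewrite minElt maxElt ltrDl mi0 => c1 c2.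
by rewrite ger0_norm; lra.
Unshelve. all: by end_near. Qed.

End SegmentIntegral.

(** * Moments and mass of the periodized kernel *)

Section ThetaIntegrals.
Context {R : realType}.
Implicit Types (r s x y : R) (b n N : nat).

Lemma continuous_th b s : 0 < s -> continuous (th b s : R -> R).
Proof. by move=> s0 y; exact: deriv_at_continuous (deriv_at_th_y b y s0). Qed.

Lemma continuous_gamma b s : 0 < s -> continuous (gamma b s : R -> R).
Proof. by move=> s0 y; exact: deriv_at_continuous (deriv_at_gamma_y b y s0). Qed.

Lemma continuous_kap r : 0 < r -> continuous (kap r).
Proof.
move=> r0 y; rewrite /kap; apply: cvgM; first exact: cvg_cst.
have h : r + `|y| != 0 by rewrite gt_eqF// ltr_wpDr.
apply: cvgV; first by rewrite expf_neq0.
under eq_fun do rewrite expr2; rewrite expr2.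
by apply: cvgM; (apply: cvgD; [exact: cvg_cst | exact: cvg_norm]).
Qed.

Lemma intJ_kap_le r : 0 < r -> intJ (kap r) <= 1.
Proof.
move=> r0; rewrite (@intJ_FTC _ _ (fun y => y / (r + y))).
- rewrite mul0r subr0 ler_pdivrMr ?mul1r ?ltr_wpDr//; lra.
- exact: continuous_kap.
- move=> x x01; have h : r + x != 0 by rewrite gt_eqF//; lra.
  apply: deriv_at_eq.
    apply: deriv_atM; first exact: deriv_at_id.
    apply: (deriv_atV (f := fun y => r + y)); first exact: h.
    by apply: deriv_atD; [exact: deriv_at_cst|exact: deriv_at_id].
  by rewrite /kap ger0_norm; [field|lra].
Qed.

Lemma intJ_kap_reflect_le r : 0 < r -> intJ (fun y => kap r (1 - y)) <= 1.
Proof.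
move=> r0; rewrite (@intJ_FTC _ _ (fun y => - ((1 - y) / (r + (1 - y))))).
- rewrite subrr mul0r subr0 opprK oppr0 add0r ler_pdivrMr ?mul1r ?ltr_wpDr//; lra.
- exact/continuous_reflect/continuous_kap.
- move=> x x01; have h : r + (1 - x) != 0 by rewrite gt_eqF//; lra.
  apply: deriv_at_eq.
    have d1 : deriv_at (fun y => 1 - y) x (0 - 1).
      by apply: deriv_atD; [exact: deriv_at_cst|apply: deriv_atN; exact: deriv_at_id].
    apply: deriv_atN; apply: deriv_atM; first exact: d1.
    apply: (deriv_atV (f := fun y => r + (1 - y))); first exact: h.
    by apply: deriv_atD; [exact: deriv_at_cst|exact: d1].
  by rewrite /kap ger0_norm; [field|lra].
Qed.

Lemma intJ_th_succ b s : 0 < s -> intJ (th b.+1 s : R -> R) = 0.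
Proof.
move=> s0; rewrite (@intJ_FTC _ _ (th b s)).
- by rewrite -[in th b s 1](add0r 1) th_periodic// subrr.
- exact: continuous_th.
- by move=> x _; exact: deriv_at_th_y.
Qed.

(** On the unit interval this is the distance to the nearest integer to the power [alpha]; the
    maximum with 0 makes it vanish outside, hence continuous on the whole line for positive
    [alpha]. *)
Definition torus_weight alpha (y : R) : R := Num.max 0 (Num.min y (1 - y)) `^ alpha.

(** With z = w / sqrt s, the inequality z^alpha <= 1 + z trades the weight for sqrt(s)^alpha times
    the factor already present in [th_bound]. The constant 4 = 1 + 1 + 2 bounds the integral of the
    right-hand side there. *)
Lemma intJ_th_bound b (alpha : R) : 0 <= alpha <= 1 -> exists C : R, 0 <= C /\
  forall s, 0 < s -> continuous (torus_weight alpha) ->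
  intJ (fun y => `|th b s y|) <= C * (Num.sqrt s)^-1 ^+ b /\
  intJ (fun y => `|th b s y| * torus_weight alpha y) <=
    C * (Num.sqrt s)^-1 ^+ b * Num.sqrt s `^ alpha.
Proof.
move=> al01; have [C [C0 hC]] := @th_bound R b.
exists (4 * C); split; first by rewrite mulr_ge0.
move=> s s0 cw; set r := Num.sqrt s; have r0 : 0 < r by rewrite sqrtr_gt0.
have D0 : 0 <= C * r^-1 ^+ b by rewrite mulr_ge0// exprn_ge0// invr_ge0 ltW.
have ckap' : continuous (fun y => kap r (1 - y)).
  exact/continuous_reflect/continuous_kap.
have ck : continuous (fun y => kap r y + kap r (1 - y) + 2).
  move=> y; apply: cvgD; last exact: cvg_cst.
  by apply: cvgD; [exact: continuous_kap|exact: ckap'].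
have Jk : intJ (fun y => kap r y + kap r (1 - y) + 2) <= 4.
  rewrite (@intJD _ (fun y => kap r y + kap r (1 - y)) (fun=> 2)); last 2 first.
  - by move=> y; apply: cvgD; [exact: continuous_kap|exact: ckap'].
  - by move=> y; exact: cvg_cst.
  rewrite intJD//; last exact: continuous_kap.
  rewrite intJ_cst; have := intJ_kap_le r0; have := intJ_kap_reflect_le r0; lra.
have key (f : R -> R) c : 0 <= c -> continuous f -> (forall y, 0 <= y <= 1 ->
    f y <= C * r^-1 ^+ b * c * (kap r y + kap r (1 - y) + 2)) ->
    intJ f <= 4 * C * r^-1 ^+ b * c.
  move=> c0 cf hf; apply: (@le_trans _ _ (C * r^-1 ^+ b * c * 4)); last first.
    by rewrite le_eqVlt; apply/orP; left; apply/eqP; ring.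
  apply: le_trans (ler_wpM2l (mulr_ge0 D0 c0) Jk); rewrite -intJZ//.
  by apply: intJ_le => // y; apply: cvgM; [exact: cvg_cst|exact: ck].
have cth : continuous (fun y => `|th b s y|) by exact/continuous_normf/continuous_th.
split.
  rewrite -[leRHS]mulr1; apply: key => // y y01.
  have := hC s y 0 s0 y01 (lexx _); rewrite mul0r addr0 mul1r mulr1; apply; lra.
apply: key; first exact: powR_ge0.
  by move=> y; apply: cvgM; [exact: cth|exact: cw].
move=> y y01; set w := Num.min y (1 - y).
have w0 : 0 <= w by rewrite le_min; lra.
rewrite /torus_weight max_r//.
have := hC s y w s0 y01 w0 _ _; rewrite !ge_min !lexx orbT => /(_ isT isT).
rewrite -/r => h.
have wr : w `^ alpha <= r `^ alpha * (1 + w / r).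
  have -> : w = r * (w / r) by rewrite mulrCA divff ?mulr1 ?gt_eqF.
  have wr0 : 0 <= w / r by rewrite divr_ge0// ltW.
  rewrite powRM ?(ltW r0)// ler_wpM2l ?powR_ge0//.
  have -> : r * (w / r) / r = w / r by field; rewrite gt_eqF.
  have [h1|/ltW h1] := leP (w / r) 1.
    apply: (@le_trans _ _ 1); last by lra.
    by have -> : 1 = 1 `^ alpha :> R; [rewrite powR1|rewrite ge0_ler_powR ?nnegrE//; lra].
  apply: (@le_trans _ _ ((w / r) `^ 1)); first by rewrite ler_powR//; lra.
  by rewrite powRr1//; lra.
apply: (@le_trans _ _ (`|th b s y| * (r `^ alpha * (1 + w / r)))).
  by rewrite ler_wpM2l.
have := ler_wpM2l (powR_ge0 r alpha) h.
by congr (_ <= _); ring.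
Qed.

(** Summation over the images unfolds [0, 1] into [-N, N]; evenness and the substitution t = y /
    sqrt(4s) leave twice a Gaussian integral over a half line cut at [X]. *)
Lemma intJ_thterm0 s N : 0 < s -> exists X, X = N%:R / Num.sqrt (4 * s) /\
  intJ (fun y => \sum_(n < N) thterm 0 s n y) =
  2 * (Num.sqrt pi)^-1 * \int[lebesgue_measure]_(t in `[0, X]) gauss_fun t.
Proof.
move=> s0; set q := Num.sqrt (4 * s); have q0 : 0 < q by rewrite sqrtr_gt0 mulr_gt0.
exists (N%:R / q); split=> //.
have [P dP] := @antiderivative_exists R gauss_fun (- (1 / q)) ((N%:R + 1) / q) continuous_gauss_fun.
pose F x := (Num.sqrt pi)^-1 * P (x / q).
have qE : q ^+ 2 = 4 * s by rewrite sqr_sqrtr// mulr_ge0// ltW.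
have dF x : -1 <= x <= N%:R + 1 -> deriv_at F x (gamma 0 s x).
  move=> xN; rewrite gamma0; apply: deriv_at_eq.
    apply: deriv_atM; first exact: deriv_at_cst.
    apply: deriv_at_comp.
      by apply: dP; rewrite -mulNr !ler_pM2r ?invr_gt0.
    by apply: deriv_atM; [exact: deriv_at_id|exact: deriv_at_cst].
  rewrite /gauss /gauss_fun expr_div_n qE -mulNr.
  have -> : Num.sqrt (4 * pi * s) = Num.sqrt pi * q.
    by rewrite /q -sqrtrM ?pi_ge0//; congr Num.sqrt; ring.
  rewrite [(_ * q)^-1]invfM; ring.
have cg : continuous (gamma 0 s : R -> R) by exact: continuous_gamma.
have cs (c : R) : continuous (fun y => gamma 0 s (y + c)) by exact: continuous_shift.
have gN y : gamma 0 s (- y) = gamma 0 s y by rewrite !gamma0 /gauss sqrrN.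
have Jt n : (n < N)%N -> intJ (thterm 0 s n) = 2 * (F n.+1%:R - F n%:R).
  move=> nN; have nN' : n%:R + 1 <= N%:R :> R by rewrite natr1 ler_nat.
  have n0 : 0 <= n%:R :> R by [].
  have sh (e : R) x : deriv_at (fun y => y + e) x 1.
    by apply: deriv_at_eq; [apply: deriv_atD; [exact: deriv_at_id|exact: deriv_at_cst]|rewrite addr0].
  rewrite (@intJD _ (fun y => gamma 0 s (y + n%:R)) (fun y => gamma 0 s (y - n.+1%:R))); [|exact: cs..].
  rewrite (@intJ_FTC _ (fun y => gamma 0 s (y + n%:R)) (fun y => F (y + n%:R)))//; last first.
    move=> x x01; apply: deriv_at_eq; first by apply: deriv_at_comp; [apply: dF; lra|exact: sh].
    by rewrite mulr1.
  rewrite (@intJ_FTC _ (fun y => gamma 0 s (y - n.+1%:R)) (fun y => - F (n.+1%:R - y)))//; last first.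
    move=> x x01; apply: deriv_at_eq.
      apply: deriv_atN; apply: deriv_at_comp; first by apply: dF; rewrite -natr1; lra.
      by apply: deriv_atD; [exact: deriv_at_cst|apply: deriv_atN; exact: deriv_at_id].
    by rewrite add0r mulrN mulr1 opprK -gN opprB.
  rewrite subr0 add0r [1 + _]addrC -!natr1 addrK; ring.
rewrite intJ_sum; last first.
  by move=> n y; apply: cvgD; [exact: cs|exact: cs].
under eq_bigr do rewrite Jt//.
rewrite -mulr_sumr -(big_mkord xpredT (fun n => F n.+1%:R - F n%:R)) telescope_sumr//.
case: (posnP N) dP => [->|N0] dP.
  rewrite subrr mulr0 mul0r; have -> : `[0, 0]%classic = [set 0 : R] by exact: set_itv1.
  by rewrite Rintegral_set1 mulr0.
rewrite (@FTC_segment _ _ P)//.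
- by rewrite /F mul0r; ring.
- by rewrite divr_gt0// ltr0n.
- exact: continuous_gauss_fun.
- move=> x /andP[x0 xN]; apply: dP; apply/andP; split.
    by apply: le_trans x0; rewrite oppr_le0 divr_ge0// ltW.
  by apply: le_trans xN _; rewrite ler_pM2r ?invr_gt0// lerDl.
Qed.

(** The Gaussian integral enters through the limit pi/4 of its square, so the square of the mass is
    computed, and the sign comes from the nonnegative partial masses. *)
Lemma intJ_theta s : 0 < s -> intJ (th 0 s : R -> R) = 1.
Proof.
move=> s0; have [K [K0 hK]] := th_tail 0 s0 (ler01 : 0 <= 1 :> R).
have r0 : 0 < Num.sqrt s by rewrite sqrtr_gt0.
pose P N := intJ (fun y => \sum_(n < N.+1) thterm 0 s n y).
have ct n : continuous (thterm 0 s n : R -> R).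
  by move=> y; exact: deriv_at_continuous (deriv_at_thterm_y 0 n y s0).
have cP N : continuous (fun y : R => \sum_(n < N) thterm 0 s n y).
  elim: N => [|N IH] y.
    by under eq_fun do rewrite big_ord0; exact: cvg_cst.
  under eq_fun do rewrite big_ord_recr /=.
  by apply: cvgD; [exact: IH|exact: ct].
have PJ N : `|intJ (th 0 s) - P N| <= K * (Num.sqrt s / (Num.sqrt s + N%:R)).
  have -> : intJ (th 0 s) - P N = intJ (fun y => th 0 s y + -1 * (\sum_(n < N.+1) thterm 0 s n y)).
    rewrite intJD ?intJZ ?mulN1r//; first exact: continuous_th.
    by move=> y; apply: cvgM; [exact: cvg_cst|exact: cP].
  apply: intJ_norm_le.
    move=> y; apply: cvgD; first exact: continuous_th.
    by apply: cvgM; [exact: cvg_cst|exact: cP].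
  by move=> y y01; rewrite mulN1r; apply: hK; rewrite ger0_norm; lra.
have q0 : 0 < (Num.sqrt (4 * s))^-1 by rewrite invr_gt0 sqrtr_gt0 mulr_gt0.
have Pcv : (fun N => P N ^+ 2) @ \oo --> (1 : R).
  have Xoo : (fun N => N.+1%:R / Num.sqrt (4 * s) : R) @ \oo --> +oo%R.
    apply/cvgryPge => A; near=> N.
    have : A * Num.sqrt (4 * s) <= N%:R by near: N; exact: nbhs_infty_ger.
    rewrite ler_pdivlMr; last by rewrite -invr_gt0.
    by move=> h; rewrite (le_trans h)// ler_nat.
  have := cvg_comp _ _ Xoo (@gauss_integral_proof.cvg_integral0_gauss_sqr R).
  move=> /(cvgMr (a := (2 * (Num.sqrt pi)^-1) ^+ 2)).
  have -> : (2 * (Num.sqrt pi)^-1) ^+ 2 * (pi / 4) = 1 :> R.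
    have p0 : pi != 0 :> R by rewrite gt_eqF// pi_gt0.
    by rewrite exprMn exprVn sqr_sqrtr ?pi_ge0//; move: pi p0 => p p0; field.
  apply: cvg_trans; apply: near_eq_cvg; near=> N.
  rewrite /P; have [X [-> ->]] := intJ_thterm0 N.+1 s0.
  by rewrite [RHS]exprMn.
have PJcv : P @ \oo --> intJ (th 0 s).
  apply/cvgrPdist_le => e e0; near=> N; apply: le_trans (PJ N) _.
  have : K * Num.sqrt s / e <= N%:R by near: N; exact: nbhs_infty_ger.
  rewrite ler_pdivrMr// mulrA ler_pdivrMr ?ltr_wpDr// => h.
  by have := mulr_gt0 e0 r0; lra.
have J2 : intJ (th 0 s) ^+ 2 = 1.
  have h : (fun N => P N ^+ 2) @ \oo --> intJ (th 0 s) ^+ 2.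
    by rewrite expr2; under eq_fun do rewrite expr2; exact: cvgM.
  by rewrite -(cvg_lim _ h)// (cvg_lim _ Pcv).
have J0 : 0 <= intJ (th 0 s).
  rewrite -(cvg_lim _ PJcv)//; apply: limr_ge; first by apply/cvg_ex; eexists; exact: PJcv.
  near=> N; rewrite /P; have [X [_ ->]] := intJ_thterm0 N.+1 s0.
  rewrite mulr_ge0 ?mulr_ge0 ?invr_ge0 ?sqrtr_ge0//.
  by apply: Rintegral_ge0 => x _; exact: gauss_fun_ge0.
by have := sqrf_eq1 (intJ (th 0 s)); rewrite J2 eqxx => /esym/orP[] /eqP; lra.
Unshelve. all: by end_near. Qed.

End ThetaIntegrals.

(** * A class of integrands stable under iterated integration *)

Section UniformlyContinuousBounded.
Context {R : realType}.
Implicit Types (g h : R -> R).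

Definition ucb1 g : Prop := (exists M : R, forall x, `|g x| <= M) /\
  forall e : R, 0 < e -> exists d : R, 0 < d /\ forall x y, `|x - y| < d -> `|g x - g y| < e.

(** Uniform continuity passes to partial integrals, so that at each stage of [iint] the slice to be
    integrated is continuous; boundedness makes the class stable under products. *)
Definition ucb (d : nat) (F : 'rV[R]_d -> R) : Prop :=
  (exists M : R, forall x, `|F x| <= M) /\
  forall e : R, 0 < e -> exists del : R, 0 < del /\
    forall x y : 'rV[R]_d, (forall i, `|x 0 i - y 0 i| < del) -> `|F x - F y| < e.

Lemma ucb1_continuous g : ucb1 g -> continuous g.
Proof.
move=> [_ ug] x; apply/cvgrPdist_lt => e e0; have [d [d0 hd]] := ug e e0.
near=> y; apply: hd; near: y; exact: cvgr_dist_lt.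
Unshelve. all: by end_near. Qed.

Section Dim.
Context {d : nat}.
Implicit Types (F G : 'rV[R]_d -> R) (x y z : 'rV[R]_d).

Lemma ucb_continuous F : ucb F -> continuous F.
Proof.
move=> [_ uF] x U /nbhs_ballP[e /= e0 hU]; have [del [d0 hd]] := uF e e0.
by apply/nbhs_ballP; exists del => //= y [_ xy]; apply: hU; apply: hd => i; exact: (xy 0 i).
Qed.

Lemma ucb_cst (c : R) : ucb (fun _ : 'rV[R]_d => c).
Proof.
split; first by exists `|c|.
by move=> e e0; exists 1; split=> // x y _; rewrite subrr normr0.
Qed.

Lemma ucbD F G : ucb F -> ucb G -> ucb (fun x => F x + G x).
Proof.
move=> [[M hM] uF] [[N hN] uG]; split.
  by exists (M + N) => x; rewrite (le_trans (ler_normD _ _))// lerD.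
move=> e e0; have e2 : 0 < e / 2 by rewrite divr_gt0.
have [a [a0 ha]] := uF _ e2; have [b [b0 hb]] := uG _ e2.
exists (Num.min a b); split=> [|x y xy]; first by rewrite lt_min a0.
have xya i : `|x 0 i - y 0 i| < a by have := xy i; rewrite lt_min => /andP[].
have xyb i : `|x 0 i - y 0 i| < b by have := xy i; rewrite lt_min => /andP[].
have := ha x y xya; have := hb x y xyb.
rewrite !ltr_norml; lra.
Qed.

Lemma ucbM F G : ucb F -> ucb G -> ucb (fun x => F x * G x).
Proof.
move=> [[M hM] uF] [[N hN] uG].
have M0 : 0 <= M := le_trans (normr_ge0 _) (hM 0).
have N0 : 0 <= N := le_trans (normr_ge0 _) (hN 0).
split; first by exists (M * N) => x; rewrite normrM ler_pM.
move=> e e0; pose k := e / 2 / (M + N + 1).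
have MN : 0 < M + N + 1 by lra.
have k0 : 0 < k by rewrite !divr_gt0.
have [a [a0 ha]] := uF _ k0; have [b [b0 hb]] := uG _ k0.
exists (Num.min a b); split=> [|x y xy]; first by rewrite lt_min a0.
have xya i : `|x 0 i - y 0 i| < a by have := xy i; rewrite lt_min => /andP[].
have xyb i : `|x 0 i - y 0 i| < b by have := xy i; rewrite lt_min => /andP[].
have h1 := ltW (ha x y xya); have h2 := ltW (hb x y xyb).
have -> : F x * G x - F y * G y = (F x - F y) * G x + F y * (G x - G y) by ring.
apply: le_lt_trans (ler_normD _ _) _; rewrite !normrM.
apply: (@le_lt_trans _ _ (k * N + M * k)); first by rewrite lerD// ler_pM.
have kE : k * (M + N + 1) = e / 2 by rewrite /k divfK// gt_eqF.
nra.
Qed.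

Lemma ucbZ (c : R) F : ucb F -> ucb (fun x => c * F x).
Proof. by move=> uF; apply: ucbM => //; exact: ucb_cst. Qed.

Lemma ucbN F : ucb F -> ucb (fun x => - F x).
Proof. by move=> uF; under eq_fun do rewrite -mulN1r; exact: ucbZ. Qed.

Lemma ucbB F G : ucb F -> ucb G -> ucb (fun x => F x - G x).
Proof. by move=> uF uG; apply: ucbD => //; exact: ucbN. Qed.

Lemma ucb_sum (I : Type) (r : seq I) (P : pred I) (F : I -> 'rV[R]_d -> R) :
  (forall i, ucb (F i)) -> ucb (fun x => \sum_(i <- r | P i) F i x).
Proof.
move=> uF; elim: r => [|i r IH].
  by under eq_fun do rewrite big_nil; exact: ucb_cst.
under eq_fun do rewrite big_cons; case: (P i) => //.
by apply: ucbD.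
Qed.

Lemma ucb_prod (I : Type) (r : seq I) (P : pred I) (F : I -> 'rV[R]_d -> R) :
  (forall i, ucb (F i)) -> ucb (fun x => \prod_(i <- r | P i) F i x).
Proof.
move=> uF; elim: r => [|i r IH].
  by under eq_fun do rewrite big_nil; exact: ucb_cst.
under eq_fun do rewrite big_cons; case: (P i) => //.
by apply: ucbM.
Qed.

Lemma ucb_coord g i : ucb1 g -> ucb (fun x => g (x 0 i)).
Proof.
move=> [[M hM] ug]; split; first by exists M.
by move=> e e0; have [del [d0 hd]] := ug e e0; exists del; split=> // x y xy; exact: hd.
Qed.

Lemma ucb_norm F : ucb F -> ucb (fun x => `|F x|).
Proof.
move=> [[M hM] uF]; split; first by exists M => x; rewrite normr_id.
move=> e e0; have [del [d0 hd]] := uF e e0; exists del; split=> // x y xy.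
by apply: le_lt_trans (hd x y xy); exact: ler_dist_dist.
Qed.

Lemma ucb_reflect F z : ucb F -> ucb (fun x => F (z - x)).
Proof.
move=> [[M hM] uF]; split; first by exists M.
move=> e e0; have [del [d0 hd]] := uF e e0; exists del; split=> // x y xy.
apply: hd => i; rewrite !mxE (_ : _ - _ = y 0 i - x 0 i); last by ring.
by rewrite distrC; exact: xy.
Qed.

Lemma ucb_slice F x k : ucb F -> ucb1 (fun s => F (upd x k s)).
Proof.
move=> [[M hM] uF]; split; first by exists M.
move=> e e0; have [del [d0 hd]] := uF e e0; exists del; split=> // s t st.
by apply: hd => i; rewrite !mxE; case: ifP => // _; rewrite subrr normr0.
Qed.

Lemma ucb_iint k F : ucb F -> ucb (iint k F).
Proof.
move=> uF; elim: k => [//|k IH]; have cs x := ucb1_continuous (ucb_slice x k IH).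
have [[M hM] uI] := IH; split.
  by exists M => x; apply: intJ_norm_le.
move=> e e0; have e2 : 0 < e / 2 by rewrite divr_gt0.
have [del [d0 hd]] := uI _ e2; exists del; split=> // x y xy /=.
apply: (@le_lt_trans _ _ (e / 2)); last by lra.
rewrite -[X in X - _]/(intJ (fun s => iint k F (upd x k s))).
rewrite -[X in _ - X]/(intJ (fun s => iint k F (upd y k s))).
rewrite -mulN1r -intJZ// -intJD//; last by move=> s; apply: cvgM; [exact: cvg_cst|exact: cs].
apply: intJ_norm_le.
  by move=> s; apply: cvgD; [exact: cs|apply: cvgM; [exact: cvg_cst|exact: cs]].
move=> s _; rewrite mulN1r ltW// hd// => i; rewrite !mxE; case: ifP => // _.
by rewrite subrr normr0.
Qed.

Lemma iintS k F x : iint k.+1 F x = intJ (fun s => iint k F (upd x k s)).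
Proof. by []. Qed.

Lemma continuous_iint_slice F x k : ucb F -> continuous (fun s => iint k F (upd x k s)).
Proof. by move=> uF; apply: ucb1_continuous; apply: ucb_slice; exact: ucb_iint. Qed.

Lemma iintD k F G x : ucb F -> ucb G -> iint k (fun x => F x + G x) x = iint k F x + iint k G x.
Proof.
move=> uF uG; elim: k x => [//|k IH] x; rewrite !iintS -intJD//; try exact: continuous_iint_slice.
by apply: eq_intJ => s _; exact: IH.
Qed.

Lemma iintZ k (c : R) F x : ucb F -> iint k (fun x => c * F x) x = c * iint k F x.
Proof.
move=> uF; elim: k x => [//|k IH] x; rewrite !iintS -intJZ//; last exact: continuous_iint_slice.
by apply: eq_intJ => s _; exact: IH.
Qed.

Lemma tintD F G : ucb F -> ucb G -> tint (fun x => F x + G x) = tint F + tint G.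
Proof. exact: iintD. Qed.

Lemma tintZ (c : R) F : ucb F -> tint (fun x => c * F x) = c * tint F.
Proof. exact: iintZ. Qed.

Lemma tintN F : ucb F -> tint (fun x => - F x) = - tint F.
Proof.
move=> uF; rewrite -mulN1r -tintZ//; congr tint.
by apply/funext => x; rewrite mulN1r.
Qed.

Lemma tintB F G : ucb F -> ucb G -> tint (fun x => F x - G x) = tint F - tint G.
Proof. by move=> uF uG; rewrite tintD ?tintN//; exact: ucbN. Qed.

Lemma iint_cst k (c : R) x : iint k (fun=> c) x = c.
Proof.
elim: k x => [//|k IH] x; rewrite iintS.
by rewrite (@eq_intJ _ _ (fun=> c)) ?intJ_cst// => s _; exact: IH.
Qed.

Lemma tint_cst (c : R) : tint (fun _ : 'rV[R]_d => c) = c.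
Proof. exact: iint_cst. Qed.

Lemma tint_sum (I : Type) (r : seq I) (P : pred I) (F : I -> 'rV[R]_d -> R) :
  (forall i, ucb (F i)) ->
  tint (fun x => \sum_(i <- r | P i) F i x) = \sum_(i <- r | P i) tint (F i).
Proof.
move=> uF; elim: r => [|i r IH].
  by rewrite big_nil; under eq_fun do rewrite big_nil; exact: tint_cst.
rewrite big_cons; under eq_fun do rewrite big_cons; case: (P i) => //.
by rewrite tintD ?IH//; exact: ucb_sum.
Qed.

Definition unit_cube x : Prop := forall i, 0 <= x 0 i <= 1.

Lemma iint_le F G k x : ucb F -> ucb G -> (forall z, unit_cube z -> F z <= G z) ->
  (forall i : 'I_d, (k <= i)%N -> 0 <= x 0 i <= 1) -> iint k F x <= iint k G x.
Proof.
move=> uF uG FG; elim: k x => [|k IH] x hx; first by apply: FG => i; exact: hx.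
rewrite !iintS; apply: intJ_le; try exact: continuous_iint_slice.
move=> s s01; apply: IH => i ki; rewrite mxE; case: eqP => // /eqP ik.
by apply: hx; rewrite ltn_neqAle eq_sym ik.
Qed.

Lemma tint_le F G : ucb F -> ucb G -> (forall z, unit_cube z -> F z <= G z) ->
  tint F <= tint G.
Proof. by move=> uF uG FG; apply: iint_le => // i; rewrite mxE lexx ler01. Qed.

Lemma tint_norm F : ucb F -> `|tint F| <= tint (fun x => `|F x|).
Proof.
move=> uF; rewrite ler_norml; apply/andP; split.
  rewrite lerNl -tintN//; apply: tint_le => //; [exact: ucbN|exact: ucb_norm|].
  by move=> z _; rewrite -normrN ler_norm.
by apply: tint_le => //; [exact: ucb_norm|move=> z _; rewrite ler_norm].
Qed.

Lemma tint_norm_le F (M : R) : ucb F -> (forall z, unit_cube z -> `|F z| <= M) -> `|tint F| <= M.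
Proof.
move=> uF FM; apply: le_trans (tint_norm uF) _; rewrite -[leRHS](tint_cst M).
by apply: tint_le => //; [exact: ucb_norm|exact: ucb_cst].
Qed.

Lemma iint_prod (g : 'I_d -> R -> R) k x : (k <= d)%N -> (forall i, ucb1 (g i)) ->
  iint k (fun x => \prod_i g i (x 0 i)) x =
  \prod_(i < d) (if (i < k)%N then intJ (g i) else g i (x 0 i)).
Proof.
move=> + ug; elim: k x => [|k IH] x kd; first by apply: eq_bigr.
rewrite iintS; under eq_intJ do rewrite IH ?(ltnW kd)//.
pose o := Ordinal kd; rewrite (bigD1 o)//= ltnSn.
under eq_intJ do rewrite (bigD1 o)//= ltnn mxE eqxx mulrC.
rewrite mulrC.
under eq_intJ => s _.
  under eq_bigr => i io.
    rewrite mxE.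
    have -> : (if (i < k)%N then intJ (g i) else g i (if (i : nat) == k then s else x 0 i)) =
      (if (i < k.+1)%N then intJ (g i) else g i (x 0 i)).
      have ik : (i : nat) != k by apply: contra io => /eqP ik; apply/eqP/val_inj.
      by rewrite (negbTE ik) [in RHS]ltnS [in RHS]leq_eqVlt (negbTE ik).
    over.
  over.
by rewrite intJZ//; apply: ucb1_continuous.
Qed.

Lemma tint_prod (g : 'I_d -> R -> R) : (forall i, ucb1 (g i)) ->
  tint (fun x => \prod_i g i (x 0 i)) = \prod_i intJ (g i).
Proof.
by move=> ug; rewrite /tint iint_prod//; apply: eq_bigr => i _; rewrite ltn_ord.
Qed.

Lemma iint_indep F k x y : (forall i : 'I_d, (k <= i)%N -> x 0 i = y 0 i) ->
  iint k F x = iint k F y.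
Proof.
elim: k x y => [|k IH] x y xy; first by congr F; apply/rowP => i; rewrite xy.
rewrite !iintS; apply: eq_intJ => s _; apply: IH => i ki; rewrite !mxE.
by case: eqP => // /eqP ik; apply: xy; rewrite ltn_neqAle eq_sym ik.
Qed.

(** One coordinate is reflected at a time. *)
Lemma iint_reflect F z k x : ucb F -> Zd_periodic F -> (k <= d)%N ->
  iint k (fun y => F (z - y)) x = iint k F (z - x).
Proof.
move=> uF pF; elim: k x => [//|k IH] x kd; rewrite !iintS.
under eq_intJ do rewrite IH ?(ltnW kd)//.
pose o := Ordinal kd.
have E s : iint k F (z - upd x k s) = iint k F (upd (z - x) k (z 0 o - s)).
  congr (iint k F _); apply/rowP => i; rewrite !mxE; case: eqP => // ik.
  by congr (z _ _ - _); apply: val_inj.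
under eq_intJ do rewrite E.
apply: (@intJ_reflect _ (fun s => iint k F (upd (z - x) k s))).
  exact: continuous_iint_slice.
(* The one-variable lemma requires the partial integral to be still periodic in the coordinate
   integrated next. *)
move=> s; have pI j w : iint j F (w + evec R o) = iint j F w.
  elim: j w => [|j IHj] w; first exact: pF.
  rewrite !iintS; have [jo|jo] := eqVneq (j : nat) (o : nat).
    apply: eq_intJ => t _; congr (iint j F _); apply/rowP => i; rewrite !mxE.
    case: eqP => // ij; rewrite (_ : (i == o) = false) ?andbF ?addr0//.
    by apply/eqP => io; apply: ij; rewrite io jo.
  apply: eq_intJ => t _; rewrite -[RHS]IHj; congr (iint j F _); apply/rowP => i; rewrite !mxE.
  case: eqP => [ij|_]; last by [].
  rewrite (_ : (i == o) = false) ?andbF ?addr0//.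
  by apply/eqP => io; move: jo; rewrite -ij io eqxx.
rewrite -[RHS]pI; congr (iint k F _); apply/rowP => i; rewrite !mxE eqxx /=.
have [->|io] := eqVneq i o; first by rewrite eqxx.
case: eqP => [ik|_]; last by rewrite addr0.
by case/eqP: io; apply: val_inj.
Qed.

Lemma tint_reflect F z : ucb F -> Zd_periodic F -> tint (fun y => F (z - y)) = tint F.
Proof.
move=> uF pF; rewrite /tint iint_reflect//; apply: iint_indep => i.
by rewrite leqNgt ltn_ord.
Qed.

(** Measurability in [t] at each fixed point suffices, without joint measurability: each partial
    integral is a limit of Riemann sums of the preceding ones. *)
Lemma measurable_iint (D : set R) (F : R -> 'rV[R]_d -> R) k x : measurable D ->
  (forall t, D t -> ucb (F t)) -> (forall x, measurable_fun D (fun t => F t x)) ->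
  measurable_fun D (fun t => iint k (F t) x).
Proof.
move=> mD uF mF; elim: k x => [//|k IH] x.
apply: (@measurable_fun_cvg _ _ _ D (fun n t =>
  n.+1%:R^-1 * \sum_(j < n.+1) iint k (F t) (upd x k (j%:R / n.+1%:R)))).
  move=> n; apply: measurable_funM; first exact: measurable_cst.
  by apply: measurable_sum => j; exact: IH.
move=> t Dt; rewrite iintS; apply: intJ_riemann.
  exact/continuous_iint_slice/uF.
by have [] := ucb_slice x k (ucb_iint k (uF t Dt)).
Qed.

Lemma measurable_tint (D : set R) (F : R -> 'rV[R]_d -> R) : measurable D ->
  (forall t, D t -> ucb (F t)) -> (forall x, measurable_fun D (fun t => F t x)) ->
  measurable_fun D (fun t => tint (F t)).
Proof. exact: measurable_iint. Qed.

End Dim.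
End UniformlyContinuousBounded.

(** * Kernels on the torus, test functions and convolutions *)

Section TorusKernels.
Context {R : realType}.

Lemma ucb1_th b (s : R) : 0 < s -> ucb1 (th b s).
Proof.
move=> s0; have ss : s <= s <= s by rewrite lexx.
have [K [K0 hK]] := th_bounded b s s0; have [L [L0 hL]] := th_bounded b.+1 s s0.
split; first by exists K => y; exact: hK.
move=> e e0; have L1 : 0 < L + 1 by lra.
exists (e / (L + 1)); split=> [|x y]; first exact: divr_gt0.
rewrite ltr_pdivlMr// => xy.
have dth z : Num.min x y - 1 < z < Num.max x y + 1 -> deriv_at (th b s) z (th b.+1 s z).
  by move=> _; exact: deriv_at_th_y.
have xin : Num.min x y - 1 < x < Num.max x y + 1.
  by rewrite minElt maxElt; case: ifP => h; lra.
have yin : Num.min x y - 1 < y < Num.max x y + 1.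
  by rewrite minElt maxElt; case: ifP => h; lra.
have [c [_ _ E]] := MVT_oo dth xin yin.
rewrite distrC E normrM [`|y - x|]distrC.
apply: le_lt_trans xy; rewrite mulrC ler_wpM2l// (le_trans (hL s c ss))//; lra.
Qed.

Lemma deriv_at_prod_seq (I : eqType) (r : seq I) (g g' : I -> R -> R) x : uniq r ->
  (forall i, deriv_at (g i) x (g' i x)) ->
  deriv_at (fun s => \prod_(i <- r) g i s) x
    (\sum_(m <- r) \prod_(i <- r) (if i == m then g' i x else g i x)).
Proof.
move=> + dg; elim: r => [_|a r IH /= /andP[ar ur]].
  rewrite big_nil; under eq_fun do rewrite big_nil; exact: deriv_at_cst.
under eq_fun do rewrite big_cons.
apply: deriv_at_eq; first by apply: deriv_atM; [exact: dg|exact: IH].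
rewrite big_cons; congr (_ + _).
  rewrite big_cons eqxx; congr (_ * _); apply: eq_big_seq => i ir.
  by case: eqP => // ia; move: ar; rewrite -ia ir.
rewrite mulr_sumr; apply: eq_big_seq => m mr; rewrite big_cons.
by case: eqP => // am; move: ar; rewrite am mr.
Qed.

Lemma deriv_at_prod (I : finType) (g g' : I -> R -> R) x :
  (forall i, deriv_at (g i) x (g' i x)) ->
  deriv_at (fun s => \prod_i g i s) x
    (\sum_m \prod_i (if i == m then g' i x else g i x)).
Proof. by move=> dg; apply: deriv_at_prod_seq => //; exact: index_enum_uniq. Qed.

Lemma deriv_at_sum (I : Type) (r : seq I) (g g' : I -> R -> R) x :
  (forall i, deriv_at (g i) x (g' i x)) ->
  deriv_at (fun s => \sum_(i <- r) g i s) x (\sum_(i <- r) g' i x).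
Proof.
move=> dg; elim: r => [|i r IH].
  by rewrite big_nil; under eq_fun do rewrite big_nil; exact: deriv_at_cst.
by rewrite big_cons; under eq_fun do rewrite big_cons; exact: deriv_atD.
Qed.

Context {d : nat}.
Implicit Types (b c : 'I_d -> nat) (f F : 'rV[R]_d -> R) (x y z : 'rV[R]_d) (s : R).

Lemma derivable_line F y i (l : R) : deriv_at (fun h => F (h *: evec R i + y)) 0 l ->
  derivable F y (evec R i) /\ pderiv i F y = l.
Proof.
have E : (fun h => h^-1 *: ((F \o shift y) (h *: evec R i) - F y)) =
    (fun h : R => h^-1 *: (((fun h => F (h *: evec R i + y)) \o shift 0) (h *: (1 : R))
       - F (0 *: evec R i + y))).
  by apply/funext => h /=; rewrite scale0r add0r addr0 /GRing.scale/= mulr1.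
case=> dF vF; split; first by rewrite /derivable E.
by rewrite /pderiv /derive E; exact: vF.
Qed.

Definition up (n : nat) (m : 'I_d) b : 'I_d -> nat := fun i => (b i + (i == m) * n)%N.

Lemma up_up n m b : up n m (up n m b) = up (n + n) m b.
Proof. by apply/funext => i; rewrite /up; case: eqP => _ /=; lia. Qed.

Lemma up_comm n m k j b : up n m (up k j b) = up k j (up n m b).
Proof. by apply/funext => i; rewrite /up addnAC. Qed.

Definition mdeg b := (\sum_i b i)%N.

Lemma mdeg_up n m b : mdeg (up n m b) = (mdeg b + n)%N.
Proof.
rewrite /mdeg /up big_split /=; congr addn.
rewrite (bigD1 m)//= eqxx mul1n big1 ?addn0// => i /negbTE ->.
by rewrite mul0n.
Qed.

(** The derivative of multi-order [b] of the heat kernel of the torus, as a tensor product. *)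
Definition chi b s x : R := \prod_i th (b i) s (x 0 i).

Lemma ucb_chi b s : 0 < s -> ucb (chi b s).
Proof. by move=> s0; apply: ucb_prod => i; apply: ucb_coord; exact: ucb1_th. Qed.

Lemma chi_periodic b s : 0 < s -> Zd_periodic (chi b s).
Proof.
move=> s0 x i; apply: eq_bigr => j _; rewrite !mxE eqxx /=.
by case: eqP => _; rewrite ?addr0// th_periodic.
Qed.

Lemma chi_periodic_sub b s x y i : 0 < s -> chi b s (x - (y + evec R i)) = chi b s (x - y).
Proof. by move=> s0; rewrite -[LHS](chi_periodic b s0 _ i) opprD addrA subrK. Qed.

Lemma chi_bounded b (s0 s1 : R) : 0 < s0 -> exists K : R, 0 <= K /\
  forall s x, s0 <= s <= s1 -> `|chi b s x| <= K.
Proof.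
move=> s00; have [K hK] := choice (fun i => th_bounded (b i) s1 s00).
exists (\prod_i K i); split; first by apply: prodr_ge0 => i _; exact: (hK i).1.
move=> s x ss; rewrite /chi normr_prod; apply: ler_prod => i _.
by rewrite normr_ge0 (hK i).2.
Qed.

Lemma deriv_at_chi_s b s x : 0 < s ->
  deriv_at (fun s => chi b s x) s (\sum_m chi (up 2 m b) s x).
Proof.
move=> s0; apply: deriv_at_eq.
  apply: (@deriv_at_prod _ (fun i s => th (b i) s (x 0 i)) (fun i s => th (b i).+2 s (x 0 i))).
  by move=> i; exact: deriv_at_th_s.
apply: eq_bigr => m _; apply: eq_bigr => i _; rewrite /up.
by case: eqP => _; rewrite ?addn0// addn2.
Qed.

Lemma chi_line b s x y i : 0 < s ->
  deriv_at (fun h => chi b s (x - (h *: evec R i + y))) 0 (- chi (up 1 i b) s (x - y)).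
Proof.
move=> s0; pose P := \prod_(k | k != i) th (b k) s ((x - y) 0 k).
have -> : (fun h => chi b s (x - (h *: evec R i + y))) =
    (fun h => th (b i) s ((x - y) 0 i - h) * P).
  apply/funext => h; rewrite /chi (bigD1 i)//= !mxE !eqxx mulr1; congr (th _ _ _ * _).
    by ring.
  apply: eq_bigr => k /negbTE ki; rewrite !mxE ki andbF mulr0; congr (th _ _ _); ring.
apply: deriv_at_eq.
  apply: deriv_atM; last exact: deriv_at_cst.
  apply: deriv_at_comp; first exact: deriv_at_th_y.
  by apply: deriv_atD; [exact: deriv_at_cst|apply: deriv_atN; exact: deriv_at_id].
rewrite subr0 mulr0 addr0 add0r mulrN1 mulNr; congr (- _).
rewrite /chi [RHS](bigD1 i)//= {1}/up eqxx addn1; congr (_ * _).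
by apply: eq_bigr => k /negbTE ki; rewrite /up ki addn0.
Qed.

(* All test functions are finite combinations of the kernels [y |-> chi b s (x - y)]. *)
Definition comb s x (r : seq (R * ('I_d -> nat))) : 'rV[R]_d -> R :=
  fun y => \sum_(p <- r) p.1 * chi p.2 s (x - y).

(** Differentiation acts symbolically on the list of terms, with a sign because [y] enters through
    [x - y]; smoothness to all orders is then an immediate induction. *)
Definition dcomb (i : 'I_d) (r : seq (R * ('I_d -> nat))) :=
  [seq (- p.1, up 1 i p.2) | p <- r].

Lemma derivable_comb s x r y i : 0 < s ->
  derivable (comb s x r) y (evec R i) /\ pderiv i (comb s x r) y = comb s x (dcomb i r) y.
Proof.
move=> s0; apply: derivable_line; apply: deriv_at_eq.
  apply: (@deriv_at_sum _ r (fun p h => p.1 * chi p.2 s (x - (h *: evec R i + y)))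
    (fun p _ => p.1 * (- chi (up 1 i p.2) s (x - y)))) => p.
  apply: deriv_at_eq; first by apply: deriv_atM; [exact: deriv_at_cst|exact: chi_line].
  by rewrite mul0r add0r.
rewrite /comb /dcomb big_map; apply: eq_bigr => p _ /=; ring.
Qed.

Lemma pderiv_comb s x r i : 0 < s -> pderiv i (comb s x r) = comb s x (dcomb i r).
Proof. by move=> s0; apply/funext => y; exact: (derivable_comb x r y i s0).2. Qed.

Lemma ucb_comb s x r : 0 < s -> ucb (comb s x r).
Proof.
move=> s0; apply: ucb_sum => p; apply: ucbZ.
by apply: (ucb_reflect (F := chi p.2 s)); exact: ucb_chi.
Qed.

Lemma smooth_comb s x r : 0 < s -> smooth_fn (comb s x r).
Proof.
move=> s0 k; elim: k r => [|k IH] r; (split; first exact/ucb_continuous/ucb_comb) => //.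
move=> i; split; first by move=> y; exact: (derivable_comb x r y i s0).1.
by rewrite pderiv_comb.
Qed.

Lemma comb_periodic s x r : 0 < s -> Zd_periodic (comb s x r).
Proof.
move=> s0 y i; apply: eq_bigr => p _; congr (_ * _).
exact: chi_periodic_sub.
Qed.

Definition conv b s f x : R := tint (fun y => chi b s (x - y) * f y).

Lemma convE b s f x : 0 < s -> ucb f -> Zd_periodic f ->
  conv b s f x = tint (fun y => chi b s y * f (x - y)).
Proof.
move=> s0 uf pf; rewrite /conv.
rewrite -(@tint_reflect _ _ (fun y => chi b s (x - y) * f y) x).
- congr tint; apply/funext => y; congr (chi _ _ _ * _).
  by rewrite opprB addrC subrK.
- by apply: ucbM => //; apply: ucb_reflect; exact: ucb_chi.
- move=> y i; by rewrite pf chi_periodic_sub.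
Qed.

Lemma tint_comb s x r f : 0 < s -> ucb f ->
  tint (fun y => f y * comb s x r y) = \sum_(p <- r) p.1 * conv p.2 s f x.
Proof.
move=> s0 uf; have up p : ucb (fun y => chi p s (x - y) * f y).
  by apply: ucbM => //; apply: ucb_reflect; exact: ucb_chi.
transitivity (tint (fun y => \sum_(p <- r) p.1 * (chi p.2 s (x - y) * f y))).
  congr tint; apply/funext => y; rewrite /comb mulr_sumr.
  by apply: eq_bigr => p _; ring.
rewrite tint_sum; last by move=> p; exact: ucbZ.
by apply: eq_bigr => p _; rewrite tintZ.
Qed.

Lemma conv_bounded b (s0 s1 : R) : 0 < s0 -> exists K : R, 0 <= K /\
  forall s x f (M : R), s0 <= s <= s1 -> ucb f -> (forall y, `|f y| <= M) ->
  `|conv b s f x| <= K * M.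
Proof.
move=> s00; have [K [K0 hK]] := chi_bounded b s1 s00.
exists K; split=> // s x f M ss uf fM; have s_gt0 : 0 < s by lra.
apply: tint_norm_le => [|y _]; last by rewrite normrM ler_pM ?hK.
by apply: ucbM => //; apply: ucb_reflect; exact: ucb_chi.
Qed.

(** The constant depends on [f] only through the bound [M]. Applied to [u t], the remainder is
    therefore uniform in [t], as the transport argument demands. *)
Lemma conv_taylor b (s0 s1 : R) : 0 < s0 -> exists K : R, 0 <= K /\
  forall s s' x f (M : R), s0 < s < s1 -> s0 < s' < s1 -> ucb f -> (forall y, `|f y| <= M) ->
  `|conv b s' f x - conv b s f x - (s' - s) * \sum_m conv (up 2 m b) s f x|
    <= K * M * (s' - s) ^+ 2.
Proof.
move=> s00.
have [K hK] := choice (fun mn : 'I_d * 'I_d => chi_bounded (up 2 mn.1 (up 2 mn.2 b)) s1 s00).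
have K0 : 0 <= \sum_m \sum_n K (n, m) by apply: sumr_ge0 => m _; apply: sumr_ge0 => n _; exact: (hK _).1.
exists (\sum_m \sum_n K (n, m)); split=> //.
move=> s s' x f M ss ss' uf fM.
have s_gt0 : 0 < s by lra. have s'_gt0 : 0 < s' by lra.
have uc c t : 0 < t -> ucb (fun y => chi c t (x - y)).
  by move=> t0; apply: (ucb_reflect (F := chi c t)); exact: ucb_chi.
have uK c t : 0 < t -> ucb (fun y => chi c t (x - y) * f y).
  by move=> t0; apply: ucbM => //; exact: uc.
have -> : conv b s' f x - conv b s f x - (s' - s) * \sum_m conv (up 2 m b) s f x =
    tint (fun y => (chi b s' (x - y) - chi b s (x - y) -
      (s' - s) * \sum_m chi (up 2 m b) s (x - y)) * f y).
  transitivity (tint (fun y => chi b s' (x - y) * f y - chi b s (x - y) * f y -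
      (s' - s) * \sum_m (chi (up 2 m b) s (x - y) * f y))).
    rewrite tintB; [|by apply: ucbB; exact: uK|by apply: ucbZ; apply: ucb_sum => m; exact: uK].
    rewrite tintB; [|exact: uK..].
    rewrite tintZ; last by apply: ucb_sum => m; exact: uK.
    by rewrite tint_sum// => m; exact: uK.
  by congr tint; apply/funext => y; rewrite -mulr_suml; ring.
apply: tint_norm_le.
  apply: ucbM => //; apply: ucbB; first by apply: ucbB; exact: uc.
  by apply: ucbZ; apply: ucb_sum => m; exact: uc.
move=> y _; rewrite normrM mulrAC; apply: ler_pM => //.
apply: (@taylor2_oo _ (fun s => chi b s (x - y)) (fun s => \sum_m chi (up 2 m b) s (x - y))
  (fun s => \sum_m \sum_n chi (up 2 n (up 2 m b)) s (x - y)) s0 s1) => //.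
- by move=> z zs; apply: deriv_at_chi_s; lra.
- move=> z zs; apply: (@deriv_at_sum _ _ (fun m s => chi (up 2 m b) s (x - y))
    (fun m s => \sum_n chi (up 2 n (up 2 m b)) s (x - y))) => m.
  by apply: deriv_at_chi_s; lra.
- move=> z zs; apply: le_trans (ler_norm_sum _ _ _) _; apply: ler_sum => m _.
  apply: le_trans (ler_norm_sum _ _ _) _; apply: ler_sum => n _.
  by apply: (hK (n, m)).2; lra.
Qed.

Lemma deriv_at_conv b s f x : 0 < s -> ucb f ->
  deriv_at (fun s => conv b s f x) s (\sum_m conv (up 2 m b) s f x).
Proof.
move=> s0 uf; have s20 : 0 < s / 2 by rewrite divr_gt0.
have [K [K0 hK]] := conv_taylor b (s + s / 2) s20; have [[M hM] _] := uf.
apply: (@deriv_at_quad _ _ _ _ (K * M) (s / 2)) => // h hs.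
have := hK s (s + h) x f M _ _ uf hM.
rewrite [s + h]addrC addrK; apply; first by lra.
by move: hs; rewrite ltr_norml; lra.
Qed.

(** Only the undifferentiated kernel has mass; the vanishing mean of its derivatives is the
    cancellation behind [conv_holder]. *)
Lemma tint_chi b s : 0 < s -> tint (chi b s) = (mdeg b == 0%N)%:R.
Proof.
move=> s0; rewrite (@tint_prod _ _ (fun i => th (b i) s)); last by move=> i; exact: ucb1_th.
rewrite /mdeg sum_nat_eq0; have [/forallP b0|/forallPn[i bi]] := boolP [forall i, b i == 0%N].
  by rewrite big1// => i _; rewrite (eqP (b0 i)) intJ_theta.
rewrite (bigD1 i)//=; case E : (b i) bi => [|n]// _.
by rewrite intJ_th_succ// mul0r.
Qed.

End TorusKernels.

(** * The abstract transport estimate, uniform in the viscosity *)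

Section Transport.
Context {R : realType}.
Implicit Types (F P f p Phi Psi : R -> R).

Lemma powR_anti (a b p : R) : 0 < a -> a <= b -> p <= 0 -> b `^ p <= a `^ p.
Proof.
move=> a0 ab p0; have b0 := lt_le_trans a0 ab.
rewrite -[p]opprK !(powRN _ (- p)) lef_pV2 ?posrE ?powR_gt0//.
by rewrite ge0_ler_powR ?nnegrE ?oppr_ge0// ltW.
Qed.

Lemma deriv_at_powR (a x : R) : 0 < x -> deriv_at (fun y => y `^ a) x (a * x `^ (a - 1)).
Proof. by move=> x0; exact: is_derive1_powR. Qed.

(** Over N equal pieces the increments of [Psi] telescope, while the quadratic errors add up to K (t
    - s)^2 / N. This replaces differentiation along a characteristic, where [Phi] is not known to be
    differentiable. *)
Lemma quad_increment Phi Psi (s t K : R) : s <= t ->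
  (forall r r', s <= r -> r <= r' -> r' <= t ->
    `|Phi r' - Phi r| <= Psi r' - Psi r + K * (r' - r) ^+ 2) ->
  `|Phi t - Phi s| <= Psi t - Psi s.
Proof.
move=> st H; rewrite leNgt; apply/negP => lt0.
pose X : R := `|Phi t - Phi s| - (Psi t - Psi s); have X0 : 0 < X by rewrite subr_gt0.
have part n : X <= K * (t - s) ^+ 2 / n.+1%:R.
  set N : R := n.+1%:R; have N0 : 0 < N by rewrite ltr0n.
  pose h := (t - s) / N; have h0 : 0 <= h by rewrite divr_ge0 ?subr_ge0// ltW.
  have hN : N * h = t - s by rewrite mulrC divfK// gt_eqF.
  have ind j : (j <= n.+1)%N -> `|Phi (s + j%:R * h) - Phi s| <=
      Psi (s + j%:R * h) - Psi s + j%:R * (K * h ^+ 2).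
    elim: j => [_|j IH jn]; first by rewrite !mul0r !addr0 !subrr normr0.
    have jN : j.+1%:R * h <= t - s by rewrite -hN ler_wpM2r// ler_nat.
    have j0 : 0 <= j%:R * h by rewrite mulr_ge0.
    have jS : j.+1%:R * h = j%:R * h + h by rewrite -natr1 mulrDl mul1r.
    have := H (s + j%:R * h) (s + j.+1%:R * h).
    rewrite jS in jN *; move=> /(_ _ _ _) H1.
    have {H1} := H1 ltac:(lra) ltac:(lra) ltac:(lra); have := IH (ltnW jn).
    have -> : s + (j%:R * h + h) - (s + j%:R * h) = h by ring.
    have -> : j.+1%:R * (K * h ^+ 2) = j%:R * (K * h ^+ 2) + K * h ^+ 2.
      by rewrite -natr1; ring.
    move=> h1 h2; have -> : Phi (s + (j%:R * h + h)) - Phi s =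
      (Phi (s + (j%:R * h + h)) - Phi (s + j%:R * h)) + (Phi (s + j%:R * h) - Phi s) by ring.
    by apply: le_trans (ler_normD _ _) _; lra.
  have := ind n.+1 (leqnn _); rewrite -/N hN (addrC s) subrK => h1.
  have -> : K * (t - s) ^+ 2 / N = N * (K * h ^+ 2).
    by rewrite /h; field; rewrite gt_eqF.
  by rewrite /X; lra.
pose n := Num.truncn (K * (t - s) ^+ 2 / X).
have : K * (t - s) ^+ 2 / X < n.+1%:R by exact: truncnS_gt.
have n0 : 0 < n.+1%:R :> R by rewrite ltr0n.
have := part n; rewrite ler_pdivlMr// ltr_pdivrMr//; lra.
Qed.

Lemma deriv_dominated F P f p (a b l r : R) : l < a -> a <= b -> b < r ->
  (forall x, l < x < r -> deriv_at F x (f x)) ->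
  (forall x, l < x < r -> deriv_at P x (p x)) ->
  (forall x, a <= x <= b -> `|f x| <= p x) -> `|F b - F a| <= P b - P a.
Proof.
move=> la ab br dF dP fp.
have al : l < a < r by lra.
have bl : l < b < r by lra.
have key G g : (forall x, l < x < r -> deriv_at G x (g x)) ->
    (forall x, a <= x <= b -> 0 <= g x) -> G a <= G b.
  move=> dG g0; have [c [+ + E]] := MVT_oo dG al bl.
  rewrite (min_idPl ab) (max_idPr ab) => ac cb.
  by rewrite -subr_ge0 E mulr_ge0 ?g0 ?ac// subr_ge0.
have h1 : P a + F a <= P b + F b.
  apply: (key (fun x => P x + F x) (fun x => p x + f x)).
    by move=> x xlr; apply: deriv_atD; [exact: dP|exact: dF].
  by move=> x xab; have := fp x xab; rewrite ler_norml; lra.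
have h2 : P a - F a <= P b - F b.
  apply: (key (fun x => P x - F x) (fun x => p x - f x)).
    by move=> x xlr; apply: deriv_atD; [exact: dP|apply: deriv_atN; exact: dF].
  by move=> x xab; have := fp x xab; rewrite ler_norml; lra.
by rewrite ler_norml; lra.
Qed.

(* [w t sigma] is the solution at time [t] mollified at scale [sigma], and [g] its
   [sigma]-derivative. Up to [O(h^2)], [g] is transported along [sigma + nu t = const]
   with a source bounded by [B sigma^((al-3)/2)]; integrating first along these lines and
   then in [sigma], from infinity, gives the estimate, whose constant is free of [nu]. *)
Lemma transport_estimate (al nu B T m : R) (w g q : R -> R -> R) :
  0 < al < 1 -> 0 < nu -> 0 <= B ->
  (forall t x, 0 <= t < T -> 0 < x -> deriv_at (w t) x (g t x)) ->
  (forall s0 s1, 0 < s0 -> exists K : R, forall t x x', 0 <= t < T ->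
    s0 < x < s1 -> s0 < x' < s1 ->
    `|g t x' - g t x - (x' - x) * q t x| <= K * (x' - x) ^+ 2) ->
  (forall s0 s1, 0 < s0 -> exists K : R, forall t t' x, 0 <= t -> t <= t' -> t' < T ->
    s0 < x < s1 ->
    `|g t' x - g t x - nu * (t' - t) * q t' x| <=
      B * x `^ ((al - 3) / 2) * (t' - t) + K * (t' - t) ^+ 2) ->
  (forall e : R, 0 < e -> exists S : R, forall t x, 0 <= t < T -> S <= x -> `|w t x - m| <= e) ->
  forall s t tau, 0 <= s -> s <= t -> t < T -> 0 < tau ->
  `|(w t tau - w 0 (tau + nu * t)) - (w s tau - w 0 (tau + nu * s))| <=
    4 / (1 - al) * B * (t - s) * tau `^ ((al - 1) / 2).
Proof.
move=> al01 nu0 B0 dw gx gt winf.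
set p := (al - 3) / 2; set p1 := (al - 1) / 2.
have p0 : p <= 0 by rewrite /p; lra.
have p1E : p1 - 1 = p by rewrite /p1 /p; lra.
(* [c * x ^ p1] is the integral of y^p from x to infinity, finite because p < -1. *)
have [c [c0 cE cD]] : exists c : R, [/\ 0 <= c, c * p1 = -1 & c = 2 / (1 - al)].
  by exists (2 / (1 - al)); split=> //; [rewrite divr_ge0//; lra|rewrite /p1; field; lra].
(* [Psi] is any function whose increments dominate the source along the line; it is chosen in two
   ways below. *)
have lines s t x Psi : 0 <= s -> s <= t -> t < T -> 0 < x ->
    (forall r r', s <= r -> r <= r' -> r' <= t ->
      B * (x + nu * (t - r)) `^ p * (r' - r) <= Psi r' - Psi r) ->
    `|g t x - g s (x + nu * (t - s))| <= Psi t - Psi s.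
  move=> s0 st tT x0 hPsi.
  have nts : 0 <= nu * (t - s) by rewrite mulr_ge0 ?subr_ge0// ltW.
  have x20 : 0 < x / 2 by rewrite divr_gt0.
  have [K1 hK1] := gx (x / 2) (x + nu * (t - s) + 1) x20.
  have [K2 hK2] := gt (x / 2) (x + nu * (t - s) + 1) x20.
  pose Phi r := g r (x + nu * (t - r)).
  have -> : g t x = Phi t by rewrite /Phi subrr mulr0 addr0.
  rewrite -/(Phi s); apply: (@quad_increment Phi Psi s t (K1 * nu ^+ 2 + K2)) => //.
  move=> r r' sr rr r't; rewrite /Phi.
  set y := x + nu * (t - r); set y' := x + nu * (t - r').
  have yy : y' - y = - (nu * (r' - r)) by rewrite /y /y'; ring.
  have inr z : s <= z -> z <= t -> x / 2 < x + nu * (t - z) < x + nu * (t - s) + 1.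
    move=> sz zt; have : 0 <= nu * (t - z) by rewrite mulr_ge0 ?subr_ge0// ltW.
    have : nu * (t - z) <= nu * (t - s) by rewrite ler_pM2l//; lra.
    lra.
  have r'T : 0 <= r' < T by lra.
  have h1 := hK1 r' y y' r'T (inr r sr (le_trans rr r't)) (inr r' (le_trans sr rr) r't).
  have h2 := hK2 r r' y (le_trans s0 sr) rr (le_lt_trans r't tT) (inr r sr (le_trans rr r't)).
  have h3 := hPsi r r' sr rr r't; rewrite -/y in h3.
  rewrite yy in h1.
  (* The step in scale and the step in time contribute opposite first-order terms in [q r' y], so
     only the source and quadratic errors remain. *)
  have -> : g r' y' - g r y = (g r' y' - g r' y - - (nu * (r' - r)) * q r' y) +
    (g r' y - g r y - nu * (r' - r) * q r' y) by ring.
  apply: le_trans (ler_normD _ _) _.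
  have e1 : K1 * (- (nu * (r' - r))) ^+ 2 = K1 * nu ^+ 2 * (r' - r) ^+ 2 by ring.
  by rewrite e1 in h1; rewrite mulrDl; lra.
(* The source is largest at the smallest scale of the line, which is [x]: a bound proportional to
   the elapsed time. *)
have line1 s t x : 0 <= s -> s <= t -> t < T -> 0 < x ->
    `|g t x - g s (x + nu * (t - s))| <= B * (t - s) * x `^ p.
  move=> s0 st tT x0.
  have -> : B * (t - s) * x `^ p = B * x `^ p * t - B * x `^ p * s by ring.
  apply: (@lines s t x (fun r => B * x `^ p * r)) => // r r' sr rr r't.
  rewrite -mulrBr ler_wpM2r ?subr_ge0// ler_wpM2l//; apply: powR_anti => //.
  by rewrite lerDl mulr_ge0 ?(ltW nu0)// subr_ge0 (le_trans rr).
(* Integrating the source exactly along the line gives a bound free of the elapsed time, at the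
   price of [nu^-1]. *)
have line2 s t x : 0 <= s -> s <= t -> t < T -> 0 < x ->
    `|g t x - g s (x + nu * (t - s))| <= c * B / nu * x `^ p1.
  move=> s0 st tT x0; pose Psi r := c * B / nu * (x + nu * (t - r)) `^ p1.
  have D0 : 0 <= c * B / nu by rewrite divr_ge0 ?mulr_ge0// ltW.
  apply: (@le_trans _ _ (Psi t - Psi s)); last first.
    by rewrite /Psi subrr mulr0 addr0 lerBlDr lerDl mulr_ge0// powR_ge0.
  apply: lines => // r r' sr rr r't.
  pose e := x / (2 * nu).
  have e0 : 0 < e by rewrite divr_gt0 ?mulr_gt0.
  have pos z : s - 1 < z < t + e -> 0 < x + nu * (t - z).
    move=> zz; have : - (x / 2) < nu * (t - z).
      have -> : x / 2 = nu * e by rewrite /e; field; rewrite gt_eqF.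
      by rewrite -mulrN ltr_pM2l//; lra.
    lra.
  have dPsi z : s - 1 < z < t + e -> deriv_at Psi z (B * (x + nu * (t - z)) `^ p).
    move=> zz; apply: deriv_at_eq.
      apply: deriv_atM; first exact: deriv_at_cst.
      apply: (@deriv_at_comp _ (fun y => y `^ p1)); first by apply: deriv_at_powR; exact: pos.
      apply: deriv_atD; first exact: deriv_at_cst.
      apply: deriv_atM; first exact: deriv_at_cst.
      by apply: deriv_atD; [exact: deriv_at_cst|apply: deriv_atN; exact: deriv_at_id].
    rewrite p1E !mul0r !add0r mulrN1.
    have -> : c * B / nu * (p1 * (x + nu * (t - z)) `^ p * - nu) =
      - (c * p1) * B * (x + nu * (t - z)) `^ p * (nu / nu) by ring.
    by rewrite cE divff ?gt_eqF//; ring.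
  have rin : s - 1 < r < t + e by lra.
  have r'in : s - 1 < r' < t + e by lra.
  have [z [+ + ->]] := MVT_oo dPsi rin r'in.
  rewrite (min_idPl rr) (max_idPr rr) => rz zr'.
  rewrite ler_wpM2r ?subr_ge0// ler_wpM2l//; apply: powR_anti => //.
    by apply: pos; lra.
  by rewrite lerD2l ler_pM2l//; lra.
move=> s t tau s0 st tT tau0; set h := t - s.
have h0 : 0 <= h by rewrite subr_ge0.
have nh0 : 0 <= nu * h by rewrite mulr_ge0// ltW.
have sT : 0 <= s < T by lra.
have tT' : 0 <= t < T by lra.
have T0 : 0 <= (0 : R) < T by rewrite lexx (le_lt_trans s0 (le_lt_trans st tT)).
have shift_deriv r y z : 0 <= r < T -> 0 <= y -> 0 < z ->
    deriv_at (fun x => w r (x + y)) z (g r (z + y)).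
  move=> rT y0 z0; apply: deriv_at_eq.
    apply: (@deriv_at_comp _ (w r)); first by apply: dw => //; lra.
    by apply: deriv_atD; [exact: deriv_at_id|exact: deriv_at_cst].
  by rewrite addr0 mulr1.
pose X := c * B * h * tau `^ p1.
have X0 : 0 <= X by rewrite !mulr_ge0// powR_ge0.
(* Along lines of duration [h], the first bound is integrated in scale from a large [S], where both
   values are close to [m], down to [tau]. *)
have D1 : `|w t tau - w s (tau + nu * h)| <= X.
  pose Del x := w t x - w s (x + nu * h).
  suff main e : 0 < e -> `|Del tau| <= X + e by apply/ler_addgt0Pr.
  move=> e0; have e2 : 0 < e / 2 by rewrite divr_gt0.
  have [S0 hS] := winf _ e2; pose S := Num.max S0 tau.
  have S0S : S0 <= S by rewrite le_max lexx.
  have tauS : tau <= S by rewrite le_max lexx orbT.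
  have : `|Del S - Del tau| <= - (c * B * h) * S `^ p1 - - (c * B * h) * tau `^ p1.
    apply: (@deriv_dominated Del (fun x => - (c * B * h) * x `^ p1)
      (fun x => g t x - g s (x + nu * h)) (fun x => B * h * x `^ p) tau S 0 (S + 1) tau0 tauS).
    - by rewrite ltrDl.
    - move=> x x0; apply: deriv_atD; first by apply: dw => //; lra.
      by apply: deriv_atN; apply: shift_deriv => //; lra.
    - move=> x x0; apply: deriv_at_eq.
        apply: deriv_atM; first exact: deriv_at_cst.
        by apply: deriv_at_powR; lra.
      rewrite p1E mul0r add0r.
      have -> : - (c * B * h) * (p1 * x `^ p) = - (c * p1) * (B * h * x `^ p) by ring.
      by rewrite cE; ring.
    - by move=> x xS; apply: line1 => //; lra.
  have := hS t S tT' S0S; have := hS s (S + nu * h) sT _.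
  move=> /(_ _) h1; have {}h1 := h1 ltac:(lra); move=> h2.
  have : 0 <= c * B * h * S `^ p1 by rewrite !mulr_ge0// powR_ge0.
  move: h1 h2; rewrite /X /Del !ler_norml; lra.
(* The remaining lines last for the uncontrolled time [s], but their contribution is compared
   between two scales at distance [nu * h], which cancels the [nu^-1] of the second bound. *)
have D2 : `|(w s (tau + nu * h) - w 0 (tau + nu * h + nu * s)) -
    (w s tau - w 0 (tau + nu * s))| <= X.
  pose F x := w s x - w 0 (x + nu * s).
  have ns0 : 0 <= nu * s by rewrite mulr_ge0// ltW.
  rewrite -/(F (tau + nu * h)) -/(F tau).
  have -> : X = c * B / nu * tau `^ p1 * (tau + nu * h) - c * B / nu * tau `^ p1 * tau.
    rewrite /X; field; by rewrite gt_eqF.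
  apply: (@deriv_dominated F (fun x => c * B / nu * tau `^ p1 * x)
    (fun x => g s x - g 0 (x + nu * s)) (fun=> c * B / nu * tau `^ p1) _ _ 0 (tau + nu * h + 1) tau0).
  - by rewrite lerDl.
  - by rewrite ltrDl.
  - move=> x x0; apply: deriv_atD; first by apply: dw => //; lra.
    by apply: deriv_atN; apply: shift_deriv => //; lra.
  - move=> x x0; apply: deriv_at_eq; first by apply: deriv_atM; [exact: deriv_at_cst|exact: deriv_at_id].
    by rewrite mul0r add0r mulr1.
  - move=> x xS; have x0 : 0 < x by lra.
    have := line2 0 s x (lexx _) s0 (le_lt_trans st tT) x0; rewrite subr0 => h1.
    apply: le_trans h1 _; apply: ler_wpM2l.
      exact: divr_ge0 (mulr_ge0 c0 B0) (ltW nu0).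
    by apply: powR_anti => //; [lra|rewrite /p1; lra].
have tE : tau + nu * h + nu * s = tau + nu * t by rewrite /h; ring.
have XE : 4 / (1 - al) * B * h * tau `^ p1 = X + X.
  by rewrite /X cD; field; lra.
rewrite tE in D2; rewrite XE.
have -> : w t tau - w 0 (tau + nu * t) - (w s tau - w 0 (tau + nu * s)) =
  (w t tau - w s (tau + nu * h)) + ((w s (tau + nu * h) - w 0 (tau + nu * t)) -
    (w s tau - w 0 (tau + nu * s))) by ring.
by apply: le_trans (ler_normD _ _) _; apply: lerD.
Qed.

End Transport.

(** * Convolutions of Hölder functions *)

Section HolderDecay.
Context {R : realType}.
Variable alpha : R.
Hypothesis alpha01 : 0 < alpha < 1.
Implicit Types (g h : R -> R).

Let alpha_ge0 : 0 <= alpha. Proof. by case/andP: alpha01 => /ltW. Qed.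
Let alpha_le1 : alpha <= 1. Proof. by case/andP: alpha01 => _ /ltW. Qed.

Lemma powR_ler (a b : R) : 0 <= a -> a <= b -> a `^ alpha <= b `^ alpha.
Proof. by move=> a0 ab; rewrite ge0_ler_powR ?nnegrE// (le_trans a0). Qed.

Lemma powR_subadditive (a b : R) : 0 <= a -> 0 <= b ->
  (a + b) `^ alpha <= a `^ alpha + b `^ alpha.
Proof.
move=> a0 b0; have [c0|cn0] := eqVneq (a + b) 0.
  have -> : a = 0 by lra.
  have -> : b = 0 by lra.
  by rewrite addr0 powR0 ?addr0// gt_eqF//; case/andP: alpha01.
have c0 : 0 < a + b by rewrite lt_def cn0 addr_ge0.
have key x : 0 <= x -> x <= a + b -> x / (a + b) * (a + b) `^ alpha <= x `^ alpha.
  move=> x0 xc; rewrite -[in leRHS](divfK cn0 x) powRM ?divr_ge0 ?(ltW c0)//.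
  rewrite ler_wpM2r ?powR_ge0//.
  have [->|xn0] := eqVneq x 0; first by rewrite mul0r powR_ge0.
  have x1 : 0 < x / (a + b) <= 1.
    by rewrite ler_pdivrMr// mul1r xc andbT divr_gt0// lt_def xn0.
  have := ger_powR x1 alpha_le1; rewrite powRr1//; lra.
have E : (a + b) `^ alpha = a / (a + b) * (a + b) `^ alpha + b / (a + b) * (a + b) `^ alpha.
  by rewrite -mulrDl -mulrDl divff// mul1r.
by rewrite E; apply: lerD; apply: key => //; lra.
Qed.

Lemma powR_holder (a b : R) : 0 <= a -> 0 <= b ->
  `|a `^ alpha - b `^ alpha| <= `|a - b| `^ alpha.
Proof.
wlog ab : a b / a <= b.
  move=> H a0 b0; have [ab|/ltW ba] := leP a b; first exact: H.
  by rewrite distrC [`|a - b|]distrC; exact: H.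
move=> a0 b0; have := powR_ler a0 ab => h.
rewrite distrC ger0_norm ?subr_ge0// distrC ger0_norm ?subr_ge0//.
rewrite lerBlDr; have {1}-> : b = (b - a) + a by ring.
by apply: powR_subadditive => //; rewrite subr_ge0.
Qed.

Lemma powR_sum (I : Type) (r : seq I) (a : I -> R) : (forall i, 0 <= a i) ->
  (\sum_(i <- r) a i) `^ alpha <= \sum_(i <- r) a i `^ alpha.
Proof.
move=> a0; elim: r => [|i r IH].
  by rewrite !big_nil powR0// gt_eqF//; case/andP: alpha01.
rewrite !big_cons; apply: le_trans (powR_subadditive _ _) _ => //.
  exact: sumr_ge0.
by rewrite lerD2l.
Qed.

Lemma powR_inv_lt (x e : R) : 0 <= x -> 0 < e -> x < e `^ alpha^-1 -> x `^ alpha < e.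
Proof.
move=> x0 e0 xe; have al0 : 0 < alpha by case/andP: alpha01.
have -> : e = (e `^ alpha^-1) `^ alpha.
  by rewrite -powRrM mulVf ?gt_eqF// powRr1// ltW.
by rewrite gt0_ltr_powR ?nnegrE// ?powR_ge0.
Qed.

(** This transfers the closure properties of [ucb] to functions of one variable. *)
Lemma ucb1_of_ucb g : ucb (fun x : 'rV[R]_1 => g (x 0 0)) -> ucb1 g.
Proof.
move=> [[M hM] ug]; split.
  by exists M => y; have := hM (const_mx y); rewrite mxE.
move=> e e0; have [del [d0 hd]] := ug e e0; exists del; split=> // x y xy.
by have := hd (const_mx x) (const_mx y); rewrite !mxE; apply=> i; rewrite !mxE.
Qed.

Lemma ucb1M g h : ucb1 g -> ucb1 h -> ucb1 (fun y => g y * h y).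
Proof.
move=> ug uh; apply: ucb1_of_ucb.
by apply: (ucbM (F := fun x => g (x 0 0)) (G := fun x => h (x 0 0))); exact: ucb_coord.
Qed.

Lemma ucb1_norm g : ucb1 g -> ucb1 (fun y => `|g y|).
Proof.
move=> ug; apply: ucb1_of_ucb.
by apply: (ucb_norm (F := fun x => g (x 0 0))); exact: ucb_coord.
Qed.

Lemma ucb1_cst (c : R) : ucb1 (fun=> c).
Proof. by apply: ucb1_of_ucb; exact: ucb_cst. Qed.

Lemma ucb1_torus_weight : ucb1 (torus_weight alpha : R -> R).
Proof.
have w0 (y : R) : 0 <= Num.max 0 (Num.min y (1 - y)) by rewrite le_max lexx.
have w1 (y : R) : Num.max 0 (Num.min y (1 - y)) <= 1.
  by rewrite ge_max ler01 ge_min; case: (leP y 1) => h; apply/orP; [left|right]; lra.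
have wl (x y : R) : `|Num.max 0 (Num.min x (1 - x)) - Num.max 0 (Num.min y (1 - y))| <= `|x - y|.
  have h1 := ler_norm (x - y); have h2 := ler_norm (- (x - y)); rewrite normrN in h2.
  rewrite ler_norml !maxElt !minElt; do ! case: ifP; lra.
split.
  exists 1 => y; rewrite ger0_norm ?powR_ge0//.
  by have := powR_ler (w0 y) (w1 y); rewrite powR1.
move=> e e0; exists (e `^ alpha^-1); split; first exact: powR_gt0.
move=> x y xy; apply: le_lt_trans (powR_holder (w0 x) (w0 y)) _.
by apply: powR_inv_lt => //; apply: le_lt_trans xy; exact: wl.
Qed.

Context {d : nat}.
Implicit Types (b c : 'I_d -> nat) (f F : 'rV[R]_d -> R) (x y z : 'rV[R]_d) (s : R).

(** The modulus is a sum over coordinates, so that against a product kernel only one factor at a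
    time is weighted. *)
Definition holder_coord (H : R) f : Prop :=
  forall x y, `|f x - f y| <= H * \sum_i `|x 0 i - y 0 i| `^ alpha.

Lemma ucb_holder_coord (H M : R) f : 0 <= H -> holder_coord H f -> (forall x, `|f x| <= M) -> ucb f.
Proof.
move=> H0 hf fM; split; first by exists M.
move=> e e0; pose D := H * d%:R + 1; have D0 : 0 < D by rewrite ltr_wpDl// mulr_ge0.
have eD : 0 < e / D by rewrite divr_gt0.
exists ((e / D) `^ alpha^-1); split; first exact: powR_gt0.
move=> x y xy; apply: le_lt_trans (hf x y) _.
apply: (@le_lt_trans _ _ (H * \sum_(i < d) e / D)).
  rewrite ler_wpM2l//; apply: ler_sum => i _; rewrite ltW//.
  exact: powR_inv_lt.
have qE : e / D * D = e by rewrite divfK// gt_eqF.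
rewrite sumr_const card_ord -mulr_natr -[ltRHS]qE.
by move: (e / D) eD => q q0; rewrite /D; lra.
Qed.

Lemma periodic_sum (V : Type) (f : 'rV[R]_d -> V) x (r : seq 'I_d) (P : pred 'I_d) :
  Zd_periodic f -> f (x + \sum_(i <- r | P i) evec R i) = f x.
Proof.
move=> pf; elim: r x => [|i r IH] x; first by rewrite big_nil addr0.
by rewrite big_cons; case: (P i) => //; rewrite addrA IH pf.
Qed.

(** By periodicity each coordinate of [y] above 1/2 may be lowered by 1, so that the increment is
    measured by the distance on the torus. *)
Lemma holder_torus (H : R) f x y : 0 <= H -> holder_coord H f -> Zd_periodic f -> unit_cube y ->
  `|f (x - y) - f x| <= H * \sum_i torus_weight alpha (y 0 i).
Proof.
move=> H0 hf pf yc; pose P (i : 'I_d) := 1 / 2 < y 0 i.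
rewrite -(periodic_sum (x - y) (index_enum _) P pf).
apply: le_trans (hf _ _) _; rewrite ler_wpM2l//; apply: ler_sum => i _.
have -> : (x - y + \sum_(i <- index_enum _ | P i) evec R i) 0 i - x 0 i = (P i)%:R - y 0 i.
  rewrite !mxE summxE.
  have -> : \sum_(j <- index_enum _ | P j) evec R j 0 i = (P i)%:R.
    rewrite big_mkcond (bigD1 i)//= big1 ?addr0 => [|j /negbTE ji].
      by rewrite mxE !eqxx; case: (P i).
    by rewrite mxE eq_sym ji andbF; case: ifP.
  by ring.
have := yc i; rewrite /torus_weight /P => yi.
have m0 : 0 <= Num.min (y 0 i) (1 - y 0 i) by rewrite le_min; lra.
rewrite (max_idPr m0); apply: powR_ler => //.
case: ltP => yi2 /=.
  by rewrite ger0_norm ?subr_ge0 ?(andP yi).2// le_min; lra.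
by rewrite sub0r normrN ger0_norm ?(andP yi).1// le_min; lra.
Qed.

Lemma chi_weight_bound b : exists C : R, 0 <= C /\ forall s, 0 < s ->
  tint (fun y => `|chi b s y| * \sum_k torus_weight alpha (y 0 k)) <=
    C * ((Num.sqrt s)^-1 ^+ mdeg b * Num.sqrt s `^ alpha).
Proof.
have al01 : 0 <= alpha <= 1 by rewrite alpha_ge0.
have [C hC] := choice (fun n => intJ_th_bound n al01).
exists (\sum_(k < d) \prod_i C (b i)); split.
  by apply: sumr_ge0 => k _; apply: prodr_ge0 => i _; exact: (hC _).1.
move=> s s0; have r0 : 0 < Num.sqrt s by rewrite sqrtr_gt0.
pose g (k i : 'I_d) (t : R) := `|th (b i) s t| * (if i == k then torus_weight alpha t else 1).
have ug k i : ucb1 (g k i).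
  apply: ucb1M; first by apply: ucb1_norm; exact: ucb1_th.
  by case: (i == k); [exact: ucb1_torus_weight|exact: ucb1_cst].
have -> : (fun y : 'rV[R]_d => `|chi b s y| * \sum_k torus_weight alpha (y 0 k)) =
    (fun y => \sum_k \prod_i g k i (y 0 i)).
  apply/funext => y; rewrite mulr_sumr; apply: eq_bigr => k _.
  rewrite /g big_split /= normr_prod; congr (_ * _).
  by rewrite -big_mkcond /= big_pred1_eq.
rewrite tint_sum; last by move=> k; apply: ucb_prod => i; exact: ucb_coord.
rewrite mulr_suml; apply: ler_sum => k _; rewrite tint_prod//.
have cw : continuous (torus_weight alpha : R -> R) by exact/ucb1_continuous/ucb1_torus_weight.
have -> : \prod_i C (b i) * ((Num.sqrt s)^-1 ^+ mdeg b * Num.sqrt s `^ alpha) =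
    \prod_i (C (b i) * (Num.sqrt s)^-1 ^+ b i * (if i == k then Num.sqrt s `^ alpha else 1)).
  rewrite !big_split /= -mulrA; congr (_ * (_ * _)); first by rewrite /mdeg -prodrXr.
  by rewrite -big_mkcond /= big_pred1_eq.
apply: ler_prod => i _; apply/andP; split.
  rewrite -[leLHS](@intJ_cst R 0); apply: intJ_le.
  - by move=> t; exact: cvg_cst.
  - exact: ucb1_continuous.
  - by move=> t _; rewrite /g mulr_ge0//; case: (i == k) => //; exact: powR_ge0.
have [h1 h2] := (hC (b i)).2 s s0 cw.
rewrite /g; case: (i == k); first exact: h2.
rewrite mulr1; apply: le_trans h1; rewrite le_eqVlt; apply/orP; left; apply/eqP.
by apply: eq_intJ => t _; rewrite mulr1.
Qed.

(** Subtracting [f x] times the mass of the kernel turns [f (x - y)] into [f (x - y) - f x], which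
    gains sqrt(s)^alpha. The case [mdeg b = 0] is the approximation of [f], the others are the decay
    of derivatives. *)
Lemma conv_holder b : exists C : R, 0 <= C /\ forall s x f (H : R), 0 < s -> 0 <= H ->
  holder_coord H f -> Zd_periodic f -> ucb f ->
  `|conv b s f x - (mdeg b == 0%N)%:R * f x| <=
    C * H * ((Num.sqrt s)^-1 ^+ mdeg b * Num.sqrt s `^ alpha).
Proof.
have [C [C0 hC]] := chi_weight_bound b; exists C; split=> // s x f H s0 H0 hf pf uf.
have uchi := ucb_chi b s0; have ufx : ucb (fun y => f (x - y)) by exact: ucb_reflect.
rewrite convE// -(tint_chi b s0) mulrC -tintZ// -tintB; last 2 first.
- exact: ucbM.
- exact: ucbZ.
have uw : ucb (fun y : 'rV[R]_d => \sum_k torus_weight alpha (y 0 k)).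
  by apply: ucb_sum => k; apply: ucb_coord; exact: ucb1_torus_weight.
have uF : ucb (fun y => chi b s y * f (x - y) - f x * chi b s y).
  by apply: ucbB; [exact: ucbM|exact: ucbZ].
have uG : ucb (fun y => `|chi b s y| * \sum_k torus_weight alpha (y 0 k)).
  by apply: ucbM => //; exact: ucb_norm.
apply: le_trans (tint_norm uF) _.
apply: (@le_trans _ _ (tint (fun y => H * (`|chi b s y| * \sum_k torus_weight alpha (y 0 k))))).
  apply: tint_le; [exact: ucb_norm|exact: ucbZ|] => y yc.
  have -> : chi b s y * f (x - y) - f x * chi b s y = chi b s y * (f (x - y) - f x) by ring.
  by rewrite normrM mulrCA ler_wpM2l//; exact: holder_torus.
by rewrite tintZ// [C * H]mulrC -mulrA ler_wpM2l//; exact: hC.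
Qed.

End HolderDecay.

(** * Convergence to the mean at large scales *)

Section LargeTime.
Context {R : realType}.

(** The mean over a period is 1, so the distance to 1 is at most the oscillation, which the first
    derivative bounds. Any rate of decay suffices for the boundary value at infinity. *)
Lemma th0_near1 : exists C : R, 0 <= C /\ forall s (y : R), 1 <= s -> 0 <= y <= 1 ->
  `|th 0 s y - 1| <= C / Num.sqrt s.
Proof.
have [C [C0 hC]] := @th_bound R 1; exists (4 * C); split; first by rewrite mulr_ge0.
move=> s y s1 y01; have s0 : 0 < s by lra.
have r1 : 1 <= Num.sqrt s by rewrite -sqrtr1 ler_wsqrtr.
have r0 : 0 < Num.sqrt s by lra.
have D0 : 0 <= C / Num.sqrt s by rewrite divr_ge0// ltW.
have dth (z : R) : 0 <= z <= 1 -> `|th 1 s z| <= 4 * C / Num.sqrt s.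
  move=> z01; have := hC s z 0 s0 z01 (lexx _); rewrite mul0r addr0 mul1r expr1 => h.
  have {}h := h ltac:(lra) ltac:(lra); apply: le_trans h _.
  rewrite -mulrA mulrC -[4 * C / _]mulrA [4 * _]mulrC mulrC -mulrA.
  rewrite ler_wpM2l// ler_pM2l ?invr_gt0//.
  have := kap_le_inv z r0; have := kap_le_inv (1 - z) r0.
  have : (Num.sqrt s)^-1 <= 1 by rewrite invf_le1.
  lra.
have cth : continuous (th 0 s : R -> R) by exact: continuous_th.
have E : th 0 s y - 1 = intJ (fun z => th 0 s y - th 0 s z).
  transitivity (intJ (fun z => th 0 s y + -1 * th 0 s z)).
    rewrite intJD ?intJZ ?intJ_cst ?intJ_theta//; first by rewrite mulr1.
      by move=> z; exact: cvg_cst.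
    by move=> z; apply: cvgM; [exact: cvg_cst|exact: cth].
  by apply: eq_intJ => z _; rewrite mulN1r.
rewrite E; apply: intJ_norm_le.
  by move=> z; apply: cvgB; [exact: cvg_cst|exact: cth].
move=> z z01; have dy (t : R) : -1 < t < 2 -> deriv_at (th 0 s) t (th 1 s t).
  by move=> _; exact: deriv_at_th_y.
have l1 : -1 < z < 2 by lra.
have l2 : -1 < y < 2 by lra.
have [c [c1 c2 ->]] := MVT_oo dy l1 l2.
have c01 : 0 <= c <= 1.
  by move: c1 c2; rewrite minElt maxElt; case: ifP => _ c1 c2; lra.
rewrite normrM -[leRHS]mulr1 ler_pM//; first exact: dth.
by rewrite ler_norml; lra.
Qed.

Lemma prod_near1 n (a : 'I_n -> R) (e B : R) : 1 <= B -> 0 <= e ->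
  (forall i, `|a i| <= B) -> (forall i, `|a i - 1| <= e) ->
  `|\prod_i a i| <= B ^+ n /\ `|\prod_i a i - 1| <= n%:R * e * B ^+ n.
Proof.
move=> B1 e0; have B0 : 0 <= B by lra.
elim: n a => [|n IH] a aB ae; first by rewrite !big_ord0 normr1 subrr normr0 !mul0r expr0.
rewrite !big_ord_recl; set P := \prod_(i < n) _.
have [h1 h2] := IH (fun i => a (lift ord0 i)) (fun i => aB _) (fun i => ae _).
rewrite -/P in h1 h2.
have Bn : 1 <= B ^+ n by exact: exprn_ege1.
split; first by rewrite normrM exprS ler_pM.
have -> : a ord0 * P - 1 = (a ord0 - 1) * P + (P - 1) by ring.
apply: le_trans (ler_normD _ _) _; rewrite normrM.
have h3 : `|a ord0 - 1| * `|P| <= e * B ^+ n by rewrite ler_pM.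
have h4 : n.+1%:R * e * B ^+ n <= n.+1%:R * e * B ^+ n.+1.
  by rewrite ler_wpM2l ?mulr_ge0// exprS ler_peMl//; lra.
apply: le_trans h4; rewrite -natr1 mulrDl mulrDl mul1r; lra.
Qed.

Lemma conv_mean {d : nat} : exists C : R, 0 <= C /\ forall (s : R) (x : 'rV[R]_d) f (M : R),
  1 <= s -> ucb f ->
  Zd_periodic f -> (forall y, `|f y| <= M) ->
  `|conv (fun=> 0%N) s f x - tint f| <= C * M / Num.sqrt s.
Proof.
have [C [C0 hC]] := th0_near1; pose B := 1 + C.
exists (d%:R * C * B ^+ d); split.
  by rewrite !mulr_ge0// exprn_ge0// /B; lra.
move=> s x f M s1 uf pf fM; have s0 : 0 < s by lra.
have r1 : 1 <= Num.sqrt s by rewrite -sqrtr1 ler_wsqrtr.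
have uchi := ucb_chi ((fun=> 0%N) : 'I_d -> nat) s0.
have ufx : ucb (fun y => f (x - y)) by exact: ucb_reflect.
rewrite convE// -(tint_reflect x uf pf) -tintB//; last exact: ucbM.
apply: tint_norm_le; first by apply: ucbB => //; exact: ucbM.
move=> y yc.
have -> : chi (fun=> 0%N) s y * f (x - y) - f (x - y) = (chi (fun=> 0%N) s y - 1) * f (x - y).
  by rewrite mulrBl mul1r.
have e0 : 0 <= C / Num.sqrt s by rewrite divr_ge0//; lra.
have near1 i : `|th 0 s (y 0 i) - 1| <= C / Num.sqrt s by exact: hC.
have eC : C / Num.sqrt s <= C.
  by rewrite ler_pdivrMr ?ler_peMr//; lra.
have [||||_ h] := @prod_near1 d (fun i => th 0 s (y 0 i)) (C / Num.sqrt s) B => //.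
- by rewrite /B; lra.
- move=> i; have := near1 i; have := ler_normD (th 0 s (y 0 i) - 1) 1.
  rewrite subrK normr1 /B; lra.
rewrite normrM; have M0 : 0 <= M := le_trans (normr_ge0 _) (fM 0).
apply: le_trans (ler_pM (normr_ge0 _) (normr_ge0 _) h (fM _)) _.
by rewrite le_eqVlt; apply/orP; left; apply/eqP; ring.
Qed.

End LargeTime.

(** * Increments of a time integral *)

Section TimeIncrement.
Context {R : realType}.
Local Notation mu := (@lebesgue_measure R).

(** The integrated equation is turned into a finite-difference statement; the error is the deviation
    of the integrand from a reference value [c], while [M] only ensures integrability. *)
Lemma integral_increment (A I : R -> R) (M t t' c e : R) : 0 <= t -> t <= t' ->
  measurable_fun `[0, t'] I -> (forall q, 0 <= q <= t' -> `|I q| <= M) ->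
  A t = A 0 + \int[mu]_(q in `[0, t]) I q -> A t' = A 0 + \int[mu]_(q in `[0, t']) I q ->
  (forall q, t <= q <= t' -> `|I q - c| <= e) ->
  `|A t' - A t - (t' - t) * c| <= e * (t' - t).
Proof.
move=> t0; rewrite le_eqVlt => /predU1P[<- _ _ _ _ _|tt' mI IM -> -> Ic].
  by rewrite !subrr mul0r subrr normr0 mulr0.
have bnd (f : R -> R) N a : 0 <= a -> a <= t' -> measurable_fun `]a, t'] f ->
    (forall q, a < q <= t' -> `|f q| <= N) -> mu.-integrable `]a, t'] (EFin \o f).
  move=> a0 at' mf fN; apply: measurable_bounded_integrable => //.
    by rewrite /= lebesgue_measure_itv/=; case: ifP => _; rewrite -?EFinB ltry.
  exists N; split; first exact: num_real.
  move=> y Ny q /=; rewrite in_itv/= => /fN h; exact: le_trans h (ltW Ny).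
have iI : mu.-integrable `[0, t'] (EFin \o I).
  apply: measurable_bounded_integrable => //.
    by rewrite /= lebesgue_measure_itv/=; case: ifP => _; rewrite -?EFinB ltry.
  exists M; split; first exact: num_real.
  move=> y My q /=; rewrite in_itv/= => /IM h; exact: le_trans h (ltW My).
have mI' : measurable_fun `]t, t'] I.
  apply: measurable_funS mI => // q /=; rewrite !in_itv/= => /andP[tq ->].
  by rewrite (le_trans t0 (ltW tq)).
have iI' : mu.-integrable `]t, t'] (EFin \o I).
  apply: integrableS iI => // q /=; rewrite !in_itv/= => /andP[tq ->].
  by rewrite (le_trans t0 (ltW tq)).
have ic (k : R) : mu.-integrable `]t, t'] (EFin \o (fun=> k)).
  by apply: (bnd _ `|k|) => //; exact: ltW.
have mulen : fine (mu `]t, t']) = t' - t.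
  by rewrite lebesgue_measure_itv/= lte_fin tt' -EFinB.
have -> : A 0 + \int[mu]_(q in `[0, t']) I q - (A 0 + \int[mu]_(q in `[0, t]) I q) =
    \int[mu]_(q in `]t, t']) I q.
  have := @Rintegral_itvB R I (BLeft 0) (BRight t') t iI.
  by move=> <-; rewrite ?bnd_simp//; [ring|exact: ltW].
have -> : (t' - t) * c = \int[mu]_(q in `]t, t']) c.
  by rewrite Rintegral_cst// mulen mulrC.
rewrite -RintegralB//.
have iB : mu.-integrable `]t, t'] (EFin \o (fun q => I q - c)).
  by have := integrableB _ iI' (ic c); apply.
apply: le_trans (le_normr_Rintegral _ iB) _ => //.
have -> : e * (t' - t) = \int[mu]_(q in `]t, t']) e.
  by rewrite Rintegral_cst// mulen.
apply: le_Rintegral => //.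
  by have := integrable_norm iB.
move=> q /=; rewrite in_itv/= => /andP[tq qt']; apply: Ic.
by rewrite qt' (ltW tq).
Qed.

End TimeIncrement.

(** * Divergence-free test fields built from kernels *)

Section TestFields.
Context {R : realType} {d : nat}.
Implicit Types (b c : 'I_d -> nat) (r : seq (R * ('I_d -> nat))) (x y : 'rV[R]_d) (s : R).

(** With [phi] left free, the same identities serve pointwise, for [chi], and after integration
    against a function, for [conv]. *)
Definition lin (phi : ('I_d -> nat) -> R) r : R := \sum_(p <- r) p.1 * phi p.2.

(* The field [psi_j = d_j d_l chi_b - delta_jl Delta chi_b] is divergence free, and tests a
   divergence free [u] as [- Delta chi_b] tests its [l]-th component: this removes the pressure. *)
Definition test_coeffs b (l j : 'I_d) : seq (R * ('I_d -> nat)) :=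
  (1, up 1 j (up 1 l b)) ::
    (if j == l then [seq (-1, up 2 k b) | k <- index_enum 'I_d] else [::]).

Lemma lin_test phi b l j : lin phi (test_coeffs b l j) =
  phi (up 1 j (up 1 l b)) - (j == l)%:R * \sum_k phi (up 2 k b).
Proof.
rewrite /lin /test_coeffs big_cons /= mul1r; congr (_ + _).
case: (j == l); last by rewrite big_nil mul0r oppr0.
by rewrite big_map mul1r -sumrN; apply: eq_bigr => k _ /=; rewrite mulN1r.
Qed.

Lemma lin_dcomb phi i r : lin phi (dcomb i r) = - lin (fun b => phi (up 1 i b)) r.
Proof.
by rewrite /lin /dcomb big_map -sumrN; apply: eq_bigr => p _ /=; rewrite mulNr.
Qed.

Lemma lin_laplace phi i b l j :
  lin phi (dcomb i (dcomb i (test_coeffs b l j))) = lin phi (test_coeffs (up 2 i b) l j).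
Proof.
rewrite !lin_dcomb opprK !lin_test up_up.
congr (_ - _ * _).
  by rewrite (up_comm 2 i 1 j) (up_comm 2 i 1 l).
by apply: eq_bigr => k _; rewrite up_up up_comm.
Qed.

Lemma lin_test_norm phi b l j : `|lin phi (test_coeffs b l j)| <=
  `|phi (up 1 j (up 1 l b))| + \sum_k `|phi (up 2 k b)|.
Proof.
rewrite lin_test; apply: le_trans (ler_normB _ _) _; rewrite lerD2l normrM.
apply: (@le_trans _ _ `|\sum_k phi (up 2 k b)|); last exact: ler_norm_sum.
by case: (j == l); rewrite ?normr1 ?mul1r// normr0 mul0r.
Qed.

Lemma decay_exponent (alpha : R) n s : 0 < s ->
  (Num.sqrt s)^-1 ^+ n * Num.sqrt s `^ alpha = s `^ ((alpha - n%:R) / 2).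
Proof.
move=> s0; have s_ge0 := ltW s0; have sn0 : s != 0 by rewrite gt_eqF.
rewrite exprVn -powR_mulrn ?sqrtr_ge0// -powRN -powR12_sqrt// -!powRrM -powRD ?sn0 ?implybT//.
by congr (_ `^ _); field.
Qed.

(** Each term carries exactly three derivatives, two from the test field and one from the divergence
    of the quadratic term. *)
Lemma lin_test_decay (alpha : R) : 0 < alpha < 1 -> exists C : R, 0 <= C /\
  forall s x (l i j : 'I_d) f (H : R), 0 < s -> 0 <= H ->
  holder_coord alpha H f -> Zd_periodic f -> ucb f ->
  `|lin (fun c => conv (up 1 i c) s f x) (test_coeffs (fun=> 0%N) l j)| <=
    C * H * s `^ ((alpha - 3) / 2).
Proof.
move=> al01; have [C hC] := choice (fun b => @conv_holder R alpha al01 d b).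
pose C1 (i j l : 'I_d) := C (up 1 i (up 1 j (up 1 l (fun=> 0%N)))).
pose C2 (i k : 'I_d) := C (up 1 i (up 2 k (fun=> 0%N))).
have C10 i j l : 0 <= C1 i j l by exact: (hC _).1.
have C20 i j : 0 <= C2 i j by exact: (hC _).1.
exists (\sum_i \sum_j \sum_l C1 i j l + \sum_i \sum_k C2 i k); split.
  by rewrite addr_ge0//; do ! (apply: sumr_ge0 => ? _).
move=> s x l i j f H s0 H0 hf pf uf.
have deg0 : mdeg ((fun=> 0%N) : 'I_d -> nat) = 0%N by rewrite /mdeg big1.
have key c : mdeg c = 3%N -> `|conv c s f x| <= C c * H * s `^ ((alpha - 3) / 2).
  move=> c3; have := (hC c).2 s x f H s0 H0 hf pf uf.
  by rewrite c3 mul0r subr0 decay_exponent.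
apply: le_trans (lin_test_norm _ _ _ _) _.
have D0 : 0 <= H * s `^ ((alpha - 3) / 2) by rewrite mulr_ge0// powR_ge0.
rewrite -mulrA mulrDl lerD//.
  apply: le_trans (key _ _) _; first by rewrite !mdeg_up deg0.
  rewrite -mulrA ler_wpM2r// -/(C1 i j l).
  rewrite (bigD1 i)//= (bigD1 j)//= (bigD1 l)//= -!addrA lerDl.
  by rewrite !addr_ge0//; do ! (apply: sumr_ge0 => ? _).
apply: (@le_trans _ _ ((\sum_k C2 i k) * (H * s `^ ((alpha - 3) / 2)))).
  rewrite mulr_suml; apply: ler_sum => k _.
  apply: le_trans (key _ _) _; first by rewrite !mdeg_up deg0.
  by rewrite -mulrA.
rewrite ler_wpM2r// [leRHS](bigD1 i)//= lerDl.
by apply: sumr_ge0 => ? _; apply: sumr_ge0 => ? _.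
Qed.

Definition test_field s x b l : 'rV[R]_d -> 'rV[R]_d :=
  fun y => \row_j comb s x (test_coeffs b l j) y.

Lemma test_fieldE s x b l j :
  (fun y => test_field s x b l y 0 j) = comb s x (test_coeffs b l j).
Proof. by apply/funext => y; rewrite mxE. Qed.

Lemma test_field_div_free s x b l : 0 < s -> div_free_test (test_field s x b l).
Proof.
move=> s0; split; first by move=> j; rewrite test_fieldE; exact: smooth_comb.
split; first by move=> y i; apply/rowP => j; rewrite !mxE; exact: comb_periodic.
move=> y; under eq_bigr do rewrite test_fieldE pderiv_comb//.
pose phi c := chi c s (x - y).
rewrite (eq_bigr (fun i => - phi (up 2 i (up 1 l b)) +
  (i == l)%:R * \sum_k phi (up 1 i (up 2 k b)))); last first.
  move=> i _; rewrite -[LHS]/(lin phi _) lin_dcomb lin_test up_up opprB addrC.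
  by [].
rewrite big_split /= sumrN (bigD1 l)//= [X in _ + X](bigD1 l)//= eqxx mul1r.
rewrite [X in _ + (_ + X)]big1 ?addr0; last by move=> i /negbTE ->; rewrite mul0r.
rewrite -(bigD1 l (P := xpredT) (F := fun i => phi (up 2 i (up 1 l b))))//=.
under [X in _ + X]eq_bigr do rewrite up_comm.
by rewrite addNr.
Qed.

End TestFields.

(** * The evolution of mollified components *)

Section NavierStokes.
Context {R : realType} {d : nat}.
Variables (nu T U : R) (u : R -> 'rV[R]_d -> 'rV[R]_d).
Hypothesis uU : forall t x j, 0 <= t < T -> `|u t x 0 j| <= U.
Hypothesis uc : forall t j, 0 <= t < T -> ucb (fun x => u t x 0 j).
Hypothesis uper : forall t, 0 <= t < T -> Zd_periodic (u t).
Hypothesis umeas : forall (x : 'rV[R]_d) (j : 'I_d), measurable_fun `[0, T[ (fun t => u t x 0 j).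
Hypothesis uNS : weak_NS nu T u (u 0).
Hypothesis nu_gt0 : 0 < nu.
Hypothesis T_gt0 : 0 < T.
Hypothesis U_ge0 : 0 <= U.

Local Notation cmp t j := (fun x : 'rV[R]_d => u t x 0 j).

(** For [b = 0] this is the scale derivative of the mollified component, by the heat equation of the
    kernel. General [b] is needed because the viscous term involves [up 2 i b]. *)
Definition lap_conv b s x l t : R := \sum_k conv (up 2 k b) s (cmp t l) x.

Definition flux b s x l t : R :=
  \sum_i \sum_j lin (fun c => conv (up 1 i c) s (fun y => u t y 0 i * u t y 0 j) x)
    (test_coeffs b l j).

Let T0 : 0 <= (0 : R) < T. Proof. by rewrite lexx. Qed.

Lemma ucb_prod2 t i j : 0 <= t < T -> ucb (fun y => u t y 0 i * u t y 0 j).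
Proof. by move=> tT; apply: ucbM; exact: uc. Qed.

Lemma test_pairing b s x l t : 0 < s -> 0 <= t < T ->
  tint (fun y => \sum_j u t y 0 j * test_field s x b l y 0 j) = - lap_conv b s x l t.
Proof.
move=> s0 tT.
have -> : (fun y => \sum_j u t y 0 j * test_field s x b l y 0 j) =
    (fun y => \sum_j u t y 0 j * comb s x (test_coeffs b l j) y).
  by apply/funext => y; apply: eq_bigr => j _; rewrite mxE.
rewrite tint_sum; last by move=> j; apply: ucbM; [exact: uc|exact: ucb_comb].
under eq_bigr do rewrite (tint_comb _ _ s0 (uc _ tT)).
rewrite (eq_bigr (fun j => conv (up 1 j (up 1 l b)) s (cmp t j) x -
    (j == l)%:R * lap_conv b s x l t)); last first.
  move=> j _; rewrite -[LHS]/(lin (fun c => conv c s (cmp t j) x) _) lin_test.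
  by case: eqP => [->//|_]; rewrite !mul0r.
rewrite sumrB.
(* The terms with two mixed derivatives form the pairing of [u] with a gradient, which vanishes by
   weak incompressibility. *)
have [_ [df _]] := uNS.
have := df t tT (comb s x [:: (1, up 1 l b)]) (smooth_comb _ _ s0) (comb_periodic _ _ s0).
have -> : (fun y => \sum_i u t y 0 i * pderiv i (comb s x [:: (1, up 1 l b)]) y) =
    (fun y => \sum_i u t y 0 i * comb s x [:: (-1, up 1 i (up 1 l b))] y).
  by apply/funext => y; apply: eq_bigr => i _; rewrite pderiv_comb.
rewrite tint_sum; last by move=> j; apply: ucbM; [exact: uc|exact: ucb_comb].
under eq_bigr do rewrite (tint_comb _ _ s0 (uc _ tT)) big_seq1 /= mulN1r.
rewrite sumrN => /eqP; rewrite oppr_eq0 => /eqP ->; rewrite sub0r; congr (- _).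
rewrite (bigD1 l)//= eqxx mul1r big1 ?addr0// => i /negbTE ->.
by rewrite mul0r.
Qed.

Lemma test_integrand b s x l t : 0 < s -> 0 <= t < T ->
  tint (fun y => \sum_i \sum_j
      u t y 0 i * u t y 0 j * pderiv i (fun z => test_field s x b l z 0 j) y
    + nu * \sum_j u t y 0 j *
        \sum_i pderiv i (pderiv i (fun z => test_field s x b l z 0 j)) y)
  = - (flux b s x l t + nu * \sum_i lap_conv (up 2 i b) s x l t).
Proof.
move=> s0 tT.
have uq i j r : ucb (fun y => u t y 0 i * u t y 0 j * comb s x r y).
  by apply: ucbM; [exact: ucb_prod2|exact: ucb_comb].
have ul j r : ucb (fun y => u t y 0 j * comb s x r y).
  by apply: ucbM; [exact: uc|exact: ucb_comb].
transitivity (tint (fun y => \sum_i \sum_j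
      u t y 0 i * u t y 0 j * comb s x (dcomb i (test_coeffs b l j)) y
    + nu * \sum_i \sum_j u t y 0 j * comb s x (test_coeffs (up 2 i b) l j) y)).
  congr tint; apply/funext => y; congr (_ + nu * _).
    by apply: eq_bigr => i _; apply: eq_bigr => j _; rewrite test_fieldE pderiv_comb.
  (* The Laplacian of a test field is a sum of test fields of orders [up 2 i b], so [test_pairing]
     applies again. *)
  rewrite exchange_big /=; apply: eq_bigr => j _; rewrite mulr_sumr.
  apply: eq_bigr => i _; rewrite test_fieldE !pderiv_comb//; congr (_ * _).
  exact: (lin_laplace (fun c => chi c s (x - y))).
rewrite tintD; last 2 first.
- by apply: ucb_sum => i; apply: ucb_sum => j; exact: uq.
- by apply: ucbZ; apply: ucb_sum => i; apply: ucb_sum => j; exact: ul.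
rewrite tintZ; last by apply: ucb_sum => i; apply: ucb_sum => j; exact: ul.
rewrite opprD -mulrN; congr (_ + nu * _).
  rewrite tint_sum; last by move=> i; apply: ucb_sum => j; exact: uq.
  rewrite /flux -sumrN; apply: eq_bigr => i _.
  rewrite tint_sum; last by move=> j; exact: uq.
  rewrite -sumrN; apply: eq_bigr => j _.
  rewrite (tint_comb x _ s0 (ucb_prod2 i j tT)).
  exact: (lin_dcomb (fun c => conv c s _ x)).
rewrite tint_sum; last by move=> i; apply: ucb_sum => j; exact: ul.
rewrite -sumrN; apply: eq_bigr => i _; rewrite -test_pairing//; congr tint.
by apply/funext => y; apply: eq_bigr => j _; rewrite mxE.
Qed.

Lemma lap_conv_duhamel b s x l t : 0 < s -> 0 <= t < T ->
  - lap_conv b s x l t = - lap_conv b s x l 0 + \int[lebesgue_measure]_(q in `[0, t])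
    - (flux b s x l q + nu * \sum_i lap_conv (up 2 i b) s x l q).
Proof.
move=> s0 tT; have [_ [_ ns]] := uNS.
have := ns t tT _ (test_field_div_free x b l s0).
rewrite !test_pairing// => ->; congr (_ + _).
apply: eq_Rintegral => q; rewrite inE/= in_itv/= => qt.
by apply: test_integrand => //; lra.
Qed.

Lemma measurable_source b s x l t : 0 < s -> 0 <= t < T ->
  measurable_fun `[0, t] (fun q => - (flux b s x l q + nu * \sum_i lap_conv (up 2 i b) s x l q)).
Proof.
move=> s0 tT; have sub : [set` `[0, t]] `<=` [set` `[0, T[].
  by move=> q /=; rewrite !in_itv/=; lra.
have um (y : 'rV[R]_d) j : measurable_fun `[0, t] (fun q => u q y 0 j).
  exact: measurable_funS (umeas y j).
have qT q : [set` `[0, t]] q -> 0 <= q < T by move=> /=; rewrite in_itv/=; lra.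
have mconv c f : (forall q, 0 <= q < T -> ucb (f q)) ->
    (forall y, measurable_fun `[0, t] (fun q => f q y)) ->
    measurable_fun `[0, t] (fun q => conv c s (f q) x).
  move=> uf mf; apply: measurable_tint => //.
    move=> q /qT qT'; apply: ucbM; last exact: uf.
    by apply: ucb_reflect; exact: ucb_chi.
  by move=> y; apply: measurable_funM => //; exact: measurable_cst.
have mconv1 c j : measurable_fun `[0, t] (fun q => conv c s (cmp q j) x).
  by apply: mconv => [q qT'|y]; [exact: uc|exact: um].
have mconv2 c i j : measurable_fun `[0, t] (fun q => conv c s (fun y => u q y 0 i * u q y 0 j) x).
  apply: (mconv c (fun q y => u q y 0 i * u q y 0 j)) => [q qT'|y]; first exact: ucb_prod2.
  by apply: measurable_funM; exact: um.
apply: measurable_funN; apply: measurable_funD.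
  apply: measurable_sum => i; apply: measurable_sum => j; apply: measurable_sum => p.
  by apply: measurable_funM => //; exact: measurable_cst.
apply: measurable_funM; first exact: measurable_cst.
by apply: measurable_sum => i; apply: measurable_sum => k; exact: mconv1.
Qed.

Lemma lap_conv_bounded b (s0 s1 : R) : 0 < s0 -> exists K : R, 0 <= K /\
  forall s x l t, s0 <= s <= s1 -> 0 <= t < T -> `|lap_conv b s x l t| <= K.
Proof.
move=> s00; have [K hK] := choice (fun k => conv_bounded (up 2 k b) s1 s00).
exists (\sum_k K k * U); split.
  by apply: sumr_ge0 => k _; rewrite mulr_ge0// (hK k).1.
move=> s x l t ss tT; apply: le_trans (ler_norm_sum _ _ _) _.
by apply: ler_sum => k _; apply: (hK k).2 => //; [exact: uc|move=> y; exact: uU].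
Qed.

Lemma flux_bounded b l (s0 s1 : R) : 0 < s0 -> exists K : R, 0 <= K /\
  forall s x t, s0 <= s <= s1 -> 0 <= t < T -> `|flux b s x l t| <= K.
Proof.
move=> s00; have [K hK] := choice (fun c : 'I_d -> nat => conv_bounded c s1 s00).
have K0 c : 0 <= K c * (U * U) by rewrite !mulr_ge0// (hK c).1.
pose D i j := K (up 1 i (up 1 j (up 1 l b))) * (U * U) +
  \sum_k K (up 1 i (up 2 k b)) * (U * U).
exists (\sum_i \sum_j D i j); split.
  apply: sumr_ge0 => i _; apply: sumr_ge0 => j _.
  by rewrite addr_ge0// sumr_ge0.
move=> s x t ss tT; apply: le_trans (ler_norm_sum _ _ _) _; apply: ler_sum => i _.
apply: le_trans (ler_norm_sum _ _ _) _; apply: ler_sum => j _.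
apply: le_trans (lin_test_norm _ _ _ _) _.
have key c : `|conv c s (fun y => u t y 0 i * u t y 0 j) x| <= K c * (U * U).
  apply: (hK c).2 => //; first exact: ucb_prod2.
  by move=> y; rewrite normrM ler_pM// uU.
by apply: lerD; [exact: key|apply: ler_sum => k _; exact: key].
Qed.

Lemma source_bounded b l (s0 s1 : R) : 0 < s0 -> exists K : R, 0 <= K /\
  forall s x t, s0 <= s <= s1 -> 0 <= t < T ->
  `|- (flux b s x l t + nu * \sum_i lap_conv (up 2 i b) s x l t)| <= K.
Proof.
move=> s00; have [K [K0 hK]] := flux_bounded b l s1 s00.
have [L hL] := choice (fun i => lap_conv_bounded (up 2 i b) s1 s00).
exists (K + nu * \sum_i L i); split.
  by rewrite addr_ge0// mulr_ge0 ?(ltW nu_gt0)// sumr_ge0// => i _; exact: (hL i).1.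
move=> s x t ss tT; rewrite normrN; apply: le_trans (ler_normD _ _) _.
apply: lerD; first exact: hK.
rewrite normrM (gtr0_norm nu_gt0) ler_wpM2l ?(ltW nu_gt0)//.
by apply: le_trans (ler_norm_sum _ _ _) _; apply: ler_sum => i _; exact: (hL i).2.
Qed.

Lemma lap_conv_increment b l (x : 'rV[R]_d) (s t t' c e : R) : 0 < s -> 0 <= t -> t <= t' -> t' < T ->
  (forall q, t <= q <= t' ->
    `|flux b s x l q + nu * \sum_i lap_conv (up 2 i b) s x l q - c| <= e) ->
  `|lap_conv b s x l t' - lap_conv b s x l t - (t' - t) * c| <= e * (t' - t).
Proof.
move=> s0 t0 tt' t'T hq.
have [M [M0 hM]] := source_bounded b l s s0.
have t'T' : 0 <= t' < T by lra.
have tT : 0 <= t < T by lra.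
have := @integral_increment R (fun t => - lap_conv b s x l t)
  (fun q => - (flux b s x l q + nu * \sum_i lap_conv (up 2 i b) s x l q)) M t t' (- c) e t0 tt'
  (measurable_source b x l s0 t'T') _ (lap_conv_duhamel b x l s0 tT) (lap_conv_duhamel b x l s0 t'T').
rewrite -normrN => H; suff -> : lap_conv b s x l t' - lap_conv b s x l t - (t' - t) * c =
    - (- lap_conv b s x l t' - - lap_conv b s x l t - (t' - t) * - c).
  apply: H => [q qt'|q qtt'].
    by apply: hM; [rewrite lexx|lra].
  by rewrite -opprD normrN; exact: hq.
by ring.
Qed.

(** The constant depends on [nu] and on the range of scales, so it cannot enter the final estimate;
    it controls only an error of second order in the time step. *)
Lemma lap_conv_lipschitz b l (s0 s1 : R) : 0 < s0 -> exists K : R, 0 <= K /\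
  forall s x t t', s0 <= s <= s1 -> 0 <= t -> t <= t' -> t' < T ->
  `|lap_conv b s x l t' - lap_conv b s x l t| <= K * (t' - t).
Proof.
move=> s00; have [K [K0 hK]] := source_bounded b l s1 s00.
exists K; split=> // s x t t' ss t0 tt' t'T.
have := @lap_conv_increment b l x s t t' 0 K; rewrite mulr0 subr0; apply => //; first by lra.
by move=> q qt; rewrite subr0 -normrN; apply: hK => //; lra.
Qed.

Lemma smooth_cst (c : R) : smooth_fn (fun _ : 'rV[R]_d => c).
Proof.
move=> k; elim: k c => [|k IH] c; (split; first exact/ucb_continuous/ucb_cst) => //.
move=> i; split; first by move=> y; exact: derivable_cst.
have -> : pderiv i (fun _ : 'rV[R]_d => c) = fun=> 0.
  by apply/funext => y; exact: derive_cst.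
exact: IH.
Qed.

(** Constant fields are admissible tests, and all their derivatives vanish. *)
Lemma mean_conserved l t : 0 <= t < T -> tint (cmp t l) = tint (cmp 0 l).
Proof.
move=> tT; have [_ [_ ns]] := uNS.
pose psi := fun _ : 'rV[R]_d => evec R l.
have psiE j : (fun y => psi y 0 j) = fun=> evec R l 0 j by [].
have dpsi i j : pderiv i (fun y => psi y 0 j) = fun=> 0.
  by apply/funext => y; rewrite psiE; exact: derive_cst.
have dpsi2 i : pderiv i (fun _ : 'rV[R]_d => 0 : R) = fun=> 0.
  by apply/funext => y; exact: derive_cst.
have pdf : div_free_test psi.
  split; first by move=> j; rewrite psiE; exact: smooth_cst.
  by split=> [//|y]; apply: big1 => i _; rewrite dpsi.
have pairing q : tint (fun y => \sum_j u q y 0 j * psi y 0 j) = tint (cmp q l).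
  congr tint; apply/funext => y; rewrite (bigD1 l)//= mxE !eqxx mulr1 big1 ?addr0//.
  by move=> j /negbTE jl; rewrite mxE jl andbF mulr0.
have := ns t tT psi pdf; rewrite !pairing => ->.
rewrite (@eq_Rintegral _ _ _ _ _ (fun=> 0)); last first.
  move=> q _; rewrite -[RHS](@tint_cst R d 0); congr tint; apply/funext => y.
  rewrite big1 ?add0r => [|i _]; last by apply: big1 => j _; rewrite dpsi mulr0.
  rewrite big1 ?mulr0// => j _; rewrite big1 ?mulr0// => i _.
  by rewrite dpsi dpsi2.
by rewrite Rintegral_cst// mul0r addr0.
Qed.

End NavierStokes.

(** * Time increments of one component *)

Section ScalarEstimate.
Context {R : realType} {d : nat}.
Variable alpha : R.
Hypothesis alpha01 : 0 < alpha < 1.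
Let zero : 'I_d -> nat := fun=> 0%N.

Lemma holder_coordM (H U : R) (f g : 'rV[R]_d -> R) :
  holder_coord alpha H f -> holder_coord alpha H g -> 
  (forall x, `|f x| <= U) -> (forall x, `|g x| <= U) ->
  holder_coord alpha (2 * U * H) (fun x => f x * g x).
Proof.
move=> hf hg fU gU x y.
have -> : f x * g x - f y * g y = (f x - f y) * g x + f y * (g x - g y) by ring.
apply: le_trans (ler_normD _ _) _; rewrite !normrM.
set S := \sum_i _.
have -> : 2 * U * H * S = (H * S) * U + U * (H * S) by ring.
by apply: lerD; apply: ler_pM.
Qed.

Lemma mollified_increment : exists C : R, 0 <= C /\
  forall (nu T U H : R) (u : R -> 'rV[R]_d -> 'rV[R]_d),
  (forall t x j, 0 <= t < T -> `|u t x 0 j| <= U) ->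
  (forall t j, 0 <= t < T -> holder_coord alpha H (fun x => u t x 0 j)) ->
  (forall t, 0 <= t < T -> Zd_periodic (u t)) ->
  (forall (x : 'rV[R]_d) (j : 'I_d), measurable_fun `[0, T[ (fun t => u t x 0 j)) ->
  weak_NS nu T u (u 0) -> 0 < nu -> 0 < T -> 0 <= U -> 0 <= H ->
  forall (x : 'rV[R]_d) (l : 'I_d) (s t tau : R), 0 <= s -> s <= t -> t < T -> 0 < tau ->
  let w t r := conv zero r (fun y => u t y 0 l) x in
  `|(w t tau - w 0 (tau + nu * t)) - (w s tau - w 0 (tau + nu * s))| <=
    C * (U * H) * (t - s) * tau `^ ((alpha - 1) / 2).
Proof.
have [C [C0 hC]] := @lin_test_decay R d alpha alpha01.
have [Cm [Cm0 hCm]] := @conv_mean R d.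
(* The sum runs over the entries of the quadratic term; the 2 comes from the Hölder constant
   [2 * U * H] of a product of components. *)
pose N := \sum_(i < d) \sum_(j < d) (2 * C : R).
have N0 : 0 <= N by apply: sumr_ge0 => i _; apply: sumr_ge0 => j _; rewrite mulr_ge0.
exists (4 / (1 - alpha) * N); split; first apply: mulr_ge0 => //.
  by case/andP: alpha01 => _ /ltW al1; rewrite divr_ge0// subr_ge0.
move=> nu T U H u uU uH uper umeas uNS nu0 T0 U0 H0 x l.
have uc t j : 0 <= t < T -> ucb (fun y => u t y 0 j).
  move=> tT; apply: (ucb_holder_coord alpha01 H0 (uH t j tT)) => y; exact: uU.
have pc t j : 0 <= t < T -> Zd_periodic (fun y => u t y 0 j).
  by move=> tT y i; rewrite uper.
have B0 : 0 <= N * (U * H) by rewrite !mulr_ge0.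
move=> s t tau s0 st tT tau0; cbv zeta.
pose w t r := conv zero r (fun y => u t y 0 l) x.
have E : 4 / (1 - alpha) * N * (U * H) = 4 / (1 - alpha) * (N * (U * H)) by ring.
rewrite E.
apply: (@transport_estimate R alpha nu (N * (U * H)) T (tint (fun y => u 0 y 0 l)) w
  (fun t r => lap_conv u zero r x l t)
  (fun t r => \sum_i lap_conv u (up 2 i zero) r x l t)) => //.
- by move=> q r qT r0; apply: deriv_at_conv => //; exact: uc.
- move=> s0' s1 s00.
  have [K hK] := choice (fun k => conv_taylor (up 2 k zero) s1 s00).
  exists (\sum_k K k * U) => q r r' qT rs r's.
  rewrite /lap_conv mulr_sumr -!sumrB mulr_suml.
  apply: le_trans (ler_norm_sum _ _ _) _; apply: ler_sum => k _.
  by apply: (hK k).2 => //; [exact: uc|move=> y; exact: uU].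
- move=> s0' s1 s00.
  have [L hL] := choice (fun i => lap_conv_lipschitz uU uc umeas uNS nu0 T0 U0 (up 2 i zero) l s1 s00).
  (* The viscous term is frozen at the later time [q']; its variation since [q] is Lipschitz and
     becomes the quadratic error. *)
  exists (nu * \sum_i L i) => q q' r q0 qq' q'T rs.
  have r0 : 0 < r by lra.
  have -> : nu * (q' - q) * \sum_i lap_conv u (up 2 i zero) r x l q' =
    (q' - q) * (nu * \sum_i lap_conv u (up 2 i zero) r x l q') by ring.
  have -> : N * (U * H) * r `^ ((alpha - 3) / 2) * (q' - q) +
      nu * (\sum_i L i) * (q' - q) ^+ 2 =
    (N * (U * H) * r `^ ((alpha - 3) / 2) + nu * (\sum_i L i) * (q' - q)) * (q' - q) by ring.
  apply: (lap_conv_increment uU uc umeas uNS nu0 T0 U0) => // p pq.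
  have pT : 0 <= p < T by lra.
  have -> : flux u zero r x l p + nu * \sum_i lap_conv u (up 2 i zero) r x l p -
      nu * \sum_i lap_conv u (up 2 i zero) r x l q' =
    flux u zero r x l p - nu * (\sum_i lap_conv u (up 2 i zero) r x l q' -
      \sum_i lap_conv u (up 2 i zero) r x l p) by ring.
  apply: le_trans (ler_normB _ _) _; apply: lerD.
    rewrite /N mulr_suml mulr_suml; apply: le_trans (ler_norm_sum _ _ _) _.
    apply: ler_sum => i _; rewrite mulr_suml mulr_suml.
    apply: le_trans (ler_norm_sum _ _ _) _; apply: ler_sum => j _.
    have := hC r x l i j (fun y => u p y 0 i * u p y 0 j) (2 * U * H) r0 _ _ _ _.
    move=> hh; have -> : 2 * C * (U * H) * r `^ ((alpha - 3) / 2) =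
      C * (2 * U * H) * r `^ ((alpha - 3) / 2) by ring.
    apply: hh.
    - by rewrite !mulr_ge0.
    - apply: holder_coordM; [exact: uH|exact: uH|..] => y; exact: uU.
    - by move=> y k; rewrite uper.
    - by apply: ucbM; exact: uc.
  rewrite normrM (gtr0_norm nu0) -mulrA ler_pM2l// -sumrB mulr_suml.
  apply: le_trans (ler_norm_sum _ _ _) _; apply: ler_sum => i _.
  have Li := (hL i).1; apply: le_trans ((hL i).2 r x p q' _ _ _ q'T) _; try lra.
  by rewrite ler_wpM2l//; lra.
move=> e e0.
(* The square makes [Cm * U / sqrt r <= e]; the added 1 places [r] in the range of [conv_mean]. *)
pose S := (Cm * U / e) ^+ 2 + 1; exists S => q r qT Sr.
have r1 : 1 <= r by apply: le_trans Sr; rewrite /S lerDr sqr_ge0.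
rewrite -(mean_conserved uNS l qT).
apply: le_trans (hCm r x _ U r1 (uc q l qT) (pc q l qT) _) _.
  by move=> y; exact: uU.
have sr0 : 0 < Num.sqrt r by rewrite sqrtr_gt0; lra.
have k0 : 0 <= Cm * U / e by rewrite divr_ge0 ?mulr_ge0// ltW.
have kr : Cm * U / e <= Num.sqrt r.
  rewrite -(ger0_norm k0) -sqrtr_sqr ler_wsqrtr//.
  by apply: le_trans Sr; rewrite /S lerDl.
by move: kr; rewrite !ler_pdivrMr// [e * _]mulrC.
Qed.

(** The scale derivative is of size H s^((alpha - 2)/2), which is integrated exactly. The difference
    of powers is kept because its two uses estimate it differently. *)
Lemma conv_scale_difference : exists C : R, 0 <= C /\
  forall (f : 'rV[R]_d -> R) (H r r' : R) x, 0 <= H -> holder_coord alpha H f ->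
  Zd_periodic f -> ucb f -> 0 < r -> r <= r' ->
  `|conv zero r' f x - conv zero r f x| <= C * H * (r' `^ (alpha / 2) - r `^ (alpha / 2)).
Proof.
have al0 : 0 < alpha by case/andP: alpha01.
have [C hC] := choice (fun k : 'I_d => @conv_holder R alpha alpha01 d (up 2 k zero)).
pose D := \sum_k C k; have D0 : 0 <= D by apply: sumr_ge0 => k _; exact: (hC k).1.
exists (D * (2 / alpha)); split; first by apply: mulr_ge0 => //; apply: divr_ge0 => //; exact: ltW.
move=> f H r r' x H0 hf pf uf r0 rr'.
rewrite mulrBr.
have deg2 k : mdeg (up 2 k zero) = 2%N by rewrite mdeg_up /mdeg big1.
apply: (@deriv_dominated R (fun s => conv zero s f x)
  (fun s => D * (2 / alpha) * H * s `^ (alpha / 2))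
  (fun s => \sum_k conv (up 2 k zero) s f x)
  (fun s => D * H * s `^ ((alpha - 2) / 2)) r r' 0 (r' + 1) r0 rr').
- by rewrite ltrDl.
- by move=> s /andP[s0 _]; exact: deriv_at_conv.
- move=> s /andP[s0 _]; apply: deriv_at_eq.
    by apply: deriv_atM; [exact: deriv_at_cst|exact: deriv_at_powR].
  have -> : alpha / 2 - 1 = (alpha - 2) / 2 by field.
  by field; rewrite gt_eqF.
move=> s /andP[rs _]; have s0 := lt_le_trans r0 rs.
apply: le_trans (ler_norm_sum _ _ _) _; rewrite /D mulr_suml mulr_suml.
apply: ler_sum => k _; have := (hC k).2 s x f H s0 H0 hf pf uf.
by rewrite deg2 mul0r subr0 decay_exponent.
Qed.

Lemma conv_approx : exists C : R, 0 <= C /\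
  forall (f : 'rV[R]_d -> R) (H r : R) x, 0 <= H -> holder_coord alpha H f ->
  Zd_periodic f -> ucb f -> 0 < r -> `|conv zero r f x - f x| <= C * H * r `^ (alpha / 2).
Proof.
have [C [C0 hC]] := @conv_holder R alpha alpha01 d zero; exists C; split=> //.
move=> f H r x H0 hf pf uf r0; have := hC r x f H r0 H0 hf pf uf.
have deg0 : mdeg zero = 0%N by rewrite /mdeg big1.
by rewrite deg0 mul1r decay_exponent// subr0.
Qed.

Definition heat_comp (r : R) (f : 'rV[R]_d -> R) x : R := if r == 0 then f x else conv zero r f x.

Lemma heatE (r : R) (f : 'rV[R]_d -> 'rV[R]_d) x l : 0 <= r -> Zd_periodic f ->
  ucb (fun y => f y 0 l) -> heat r f x 0 l = heat_comp r (fun y => f y 0 l) x.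
Proof.
move=> r_ge0 pf uf; rewrite /heat /heat_comp; case: eqP => // /eqP rn0.
have r0 : 0 < r by rewrite lt_def rn0.
rewrite mxE convE//; last by move=> y i; rewrite pf.
congr tint; apply/funext => y; congr (_ * _).
by apply: eq_bigr => i _; exact: theta_th.
Qed.

(** The semigroup law is bypassed by comparing the scales [tau + r] and [r] directly; subadditivity
    of the power [alpha / 2] makes the bound independent of [r]. *)
Lemma heat_mollify : exists C : R, 0 <= C /\
  forall (f : 'rV[R]_d -> R) (H r tau : R) x, 0 <= H -> holder_coord alpha H f ->
  Zd_periodic f -> ucb f -> 0 <= r -> 0 < tau ->
  `|conv zero (tau + r) f x - heat_comp r f x| <= C * H * tau `^ (alpha / 2).
Proof.
have [C1 [C10 h1]] := conv_scale_difference; have [C2 [C20 h2]] := conv_approx.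
exists (C1 + C2); split; first exact: addr_ge0.
move=> f H r tau x H0 hf pf uf; rewrite le_eqVlt => /predU1P[<-|r0] tau0.
  rewrite addr0 /heat_comp eqxx; apply: le_trans (h2 _ _ _ _ H0 hf pf uf tau0) _.
  by rewrite ler_wpM2r ?powR_ge0// ler_wpM2r// lerDr.
rewrite /heat_comp gt_eqF//.
have rr : r <= tau + r by rewrite lerDr ltW.
apply: le_trans (h1 f H r (tau + r) x H0 hf pf uf r0 rr) _.
apply: ler_pM; rewrite ?mulr_ge0//.
- have b0 : 0 <= alpha / 2 by case/andP: alpha01 => /ltW h _; exact: divr_ge0.
  by rewrite subr_ge0 ge0_ler_powR ?nnegrE ?(ltW r0) ?(le_trans (ltW r0) rr).
- by rewrite ler_wpM2r// lerDl.
rewrite lerBlDr; apply: powR_subadditive; rewrite ?ltW//.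
by move: alpha01 => /andP[a0 a1]; apply/andP; split; lra.
Qed.

Lemma difference_estimate : exists C : R, 0 <= C /\
  forall (nu T U H : R) (u : R -> 'rV[R]_d -> 'rV[R]_d),
  (forall t x j, 0 <= t < T -> `|u t x 0 j| <= U) ->
  (forall t j, 0 <= t < T -> holder_coord alpha H (fun x => u t x 0 j)) ->
  (forall t, 0 <= t < T -> Zd_periodic (u t)) ->
  (forall (x : 'rV[R]_d) (j : 'I_d), measurable_fun `[0, T[ (fun t => u t x 0 j)) ->
  weak_NS nu T u (u 0) -> 0 < nu -> 0 < T -> 0 < U -> 0 <= H ->
  forall (x : 'rV[R]_d) (l : 'I_d) (s t : R), 0 <= s -> s < t -> t < T ->
  let ut q := u q x 0 l - heat_comp (nu * q) (fun y => u 0 y 0 l) x in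
  `|ut t - ut s| <= C * (U `^ alpha * H) * (t - s) `^ alpha.
Proof.
have [C1 [C10 h1]] := mollified_increment; have [C2 [C20 h2]] := conv_approx.
have [C3 [C30 h3]] := heat_mollify.
exists (C1 + 2 * C2 + 2 * C3); split; first by rewrite !addr_ge0// mulr_ge0.
move=> nu T U H u uU uH uper umeas uNS nu0 T0 U0 H0 x l s t s0 st tT; cbv zeta.
have uc q j : 0 <= q < T -> ucb (fun y => u q y 0 j).
  move=> qT; apply: (ucb_holder_coord alpha01 H0 (uH q j qT)) => y; exact: uU.
have pc q j : 0 <= q < T -> Zd_periodic (fun y => u q y 0 j).
  by move=> qT y i; rewrite uper.
set h := t - s; have h_gt0 : 0 < h by rewrite subr_gt0.
have hU : 0 < h * U by exact: mulr_gt0.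
(* This balances the transport error U H h tau^((alpha - 1)/2) against the mollification error H
   tau^(alpha/2). *)
pose tau := (h * U) ^+ 2; have tau0 : 0 < tau by rewrite exprn_gt0.
have tauE (a : R) : tau `^ (a / 2) = (h * U) `^ a.
  by rewrite /tau -powR_mulrn ?(ltW hU)// -powRrM; congr (_ `^ _); field.
have sT : 0 <= s < T by rewrite s0 (lt_trans st).
have tT' : 0 <= t < T by rewrite tT (le_trans s0 (ltW st)).
have zT : 0 <= (0 : R) < T by rewrite lexx.
have := h1 nu T U H u uU uH uper umeas uNS nu0 T0 (ltW U0) H0 x l s t tau s0 (ltW st) tT tau0.
cbv zeta; rewrite tauE -/h.
have := h2 _ H tau x H0 (uH t l tT') (pc t l tT') (uc t l tT') tau0.
have := h2 _ H tau x H0 (uH s l sT) (pc s l sT) (uc s l sT) tau0.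
have nt : 0 <= nu * t by rewrite mulr_ge0// ?(ltW nu0)// (le_trans s0 (ltW st)).
have ns : 0 <= nu * s by rewrite mulr_ge0// ltW.
have := h3 _ H (nu * t) tau x H0 (uH 0 l zT) (pc 0 l zT) (uc 0 l zT) nt tau0.
have := h3 _ H (nu * s) tau x H0 (uH 0 l zT) (pc 0 l zT) (uc 0 l zT) ns tau0.
rewrite tauE.
have -> : C1 * (U * H) * h * (h * U) `^ (alpha - 1) = C1 * H * (h * U) `^ alpha.
  rewrite powRB; last by rewrite (gt_eqF hU) implybT.
  by rewrite powRr1 ?(ltW hU)//; field; rewrite !gt_eqF.
have E : (h * U) `^ alpha = U `^ alpha * h `^ alpha.
  by rewrite powRM ?(ltW h_gt0) ?(ltW U0)// mulrC.
have -> : (C1 + 2 * C2 + 2 * C3) * (U `^ alpha * H) * h `^ alpha =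
  C1 * H * (h * U) `^ alpha + 2 * (C2 * H * (h * U) `^ alpha) + 2 * (C3 * H * (h * U) `^ alpha).
  by rewrite E; ring.
set X1 := C1 * H * _; set X2 := C2 * H * _; set X3 := C3 * H * _.
set w1 := conv zero tau (fun y => u t y 0 l) x.
set w2 := conv zero tau (fun y => u s y 0 l) x.
set v1 := conv zero (tau + nu * t) _ x; set v2 := conv zero (tau + nu * s) _ x.
set a1 := heat_comp (nu * t) _ x; set a2 := heat_comp (nu * s) _ x.
move: (u t x 0 l) (u s x 0 l) => b1 b2.
move: X1 X2 X3 w1 w2 v1 v2 a1 a2 => X1 X2 X3 w1 w2 v1 v2 a1 a2.
rewrite !ler_norml => /andP[? ?] /andP[? ?] /andP[? ?] /andP[? ?] /andP[? ?].
by apply/andP; split; lra.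
Qed.

(* Interpolation between [(r + k)^b - r^b <= k^b] and [(r + k)^b - r^b <= k r^(b - 1)]. *)
Lemma powR_increment (r k : R) : 0 < r -> 0 <= k ->
  (r + k) `^ (alpha / 2) - r `^ (alpha / 2) <= k `^ alpha * r `^ (- (alpha / 2)).
Proof.
move: alpha01 => /andP[a0 a1] r0 k0; set b := alpha / 2.
have b0 : 0 < b by rewrite /b; lra.
have b1 : b <= 1 by rewrite /b; lra.
have ba : b <= alpha by rewrite /b; lra.
have b01 : 0 < b < 1 by apply/andP; split => //; rewrite /b; lra.
have [z z0 kE] : exists2 z, 0 <= z & k = r * z.
  by exists (k / r); [rewrite divr_ge0// ltW|rewrite mulrC divfK// gt_eqF].
have -> : r + k = r * (1 + z) by rewrite kE; ring.
have z1 : 0 <= 1 + z by lra.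
rewrite kE !powRM ?(ltW r0)//.
have -> : r `^ alpha * z `^ alpha * r `^ (- b) = r `^ b * z `^ alpha.
  rewrite mulrAC -powRD; last by rewrite (gt_eqF r0) implybT.
  by congr (_ `^ _ * _); rewrite /b; field.
have -> : r `^ b * (1 + z) `^ b - r `^ b = r `^ b * ((1 + z) `^ b - 1) by ring.
rewrite ler_pM2l ?powR_gt0// lerBlDl.
have [zle|zge] := leP z 1.
  apply: (@le_trans _ _ (1 + z)); first by apply: ler1_powR => //; lra.
  rewrite lerD2l; have [->|zn0] := eqVneq z 0; first exact: powR_ge0.
  have z01 : 0 < z <= 1 by rewrite zle lt_def zn0 z0.
  by have := ger_powR z01 (ltW a1); rewrite powRr1.
apply: le_trans (powR_subadditive b01 ler01 z0) _; rewrite powR1 lerD2l.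
by apply: ler_powR => //; exact: ltW.
Qed.

(** The bound is nu^alpha (nu s)^(-alpha/2) = (s/nu)^(-alpha/2), which is at most a^(-alpha/2) when
    s > a nu: this is why the initial layer has length proportional to [nu]. *)
Lemma heat_increment : exists C : R, 0 <= C /\
  forall (f : 'rV[R]_d -> R) (H nu a s t : R) x, 0 <= H -> holder_coord alpha H f ->
  Zd_periodic f -> ucb f -> 0 < nu -> 0 < a -> a * nu < s -> s <= t ->
  `|heat_comp (nu * t) f x - heat_comp (nu * s) f x| <=
    C * (a `^ (- alpha / 2) * H) * (t - s) `^ alpha.
Proof.
have [C [C0 hC]] := conv_scale_difference; exists C; split=> //.
move=> f H nu a s t x H0 hf pf uf nu0 a0 as' st.
have s0 : 0 < s by apply: lt_trans as'; exact: mulr_gt0.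
have t0 : 0 < t := lt_le_trans s0 st.
have ns0 : 0 < nu * s by exact: mulr_gt0.
rewrite /heat_comp !gt_eqF ?mulr_gt0//.
have nst : nu * s <= nu * t by rewrite ler_pM2l.
apply: le_trans (hC f H _ _ x H0 hf pf uf ns0 nst) _.
have -> : C * (a `^ (- alpha / 2) * H) * (t - s) `^ alpha =
  C * H * (a `^ (- alpha / 2) * (t - s) `^ alpha) by ring.
rewrite ler_wpM2l ?mulr_ge0//.
have ts0 : 0 <= t - s by rewrite subr_ge0.
have -> : nu * t = nu * s + nu * (t - s) by ring.
apply: le_trans (powR_increment ns0 (mulr_ge0 (ltW nu0) ts0)) _.
rewrite (powRM _ (ltW nu0) ts0) mulrAC; rewrite ler_wpM2r ?powR_ge0//.
have al0 : 0 <= alpha / 2 by case/andP: alpha01 => /ltW h _; rewrite divr_ge0.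
have -> : nu `^ alpha * (nu * s) `^ (- (alpha / 2)) = (s / nu) `^ (- (alpha / 2)).
  rewrite !powRM ?invr_ge0 ?(ltW nu0) ?(ltW s0)//.
  rewrite -(powR_inv1 (ltW nu0)) -powRrM mulrA -powRD; last by rewrite (gt_eqF nu0) implybT.
  by rewrite [RHS]mulrC; congr (_ `^ _ * _); field.
rewrite mulNr; apply: powR_anti => //; last by rewrite oppr_le0.
by rewrite ler_pdivlMr// ltW.
Qed.

End ScalarEstimate.

(** * From the norms of the statement to components *)

Section Norms.
Context {R : realType} {d : nat}.
Implicit Types (v x y : 'rV[R]_d) (f : 'rV[R]_d -> 'rV[R]_d).

Lemma enorm_ge0 v : 0 <= enorm v.
Proof. exact: sqrtr_ge0. Qed.

Lemma component_le_enorm v i : `|v 0 i| <= enorm v.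
Proof.
rewrite -sqrtr_sqr ler_wsqrtr// (bigD1 i)//= lerDl.
by apply: sumr_ge0 => j _; exact: sqr_ge0.
Qed.

Lemma enorm_le_sum v : enorm v <= \sum_i `|v 0 i|.
Proof.
have S0 : 0 <= \sum_i `|v 0 i| by exact: sumr_ge0.
rewrite -[leRHS](ger0_norm S0) -sqrtr_sqr ler_wsqrtr//.
rewrite expr2 mulr_suml; apply: ler_sum => i _.
rewrite -(real_normK (num_real (v 0 i))) expr2 ler_wpM2l//.
by rewrite (bigD1 i)//= lerDl sumr_ge0.
Qed.

Lemma enorm_le_component v (M : R) : (forall i, `|v 0 i| <= M) -> enorm v <= d%:R * M.
Proof.
move=> vM; apply: le_trans (enorm_le_sum v) _.
apply: (@le_trans _ _ (\sum_(i < d) M)); first exact: ler_sum.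
by rewrite sumr_const card_ord mulr_natl.
Qed.

Lemma enorm_eq0 v : enorm v = 0 -> v = 0.
Proof.
move=> v0; apply/rowP => i; apply/eqP; rewrite mxE -normr_eq0 eq_le normr_ge0 andbT.
by rewrite -v0 component_le_enorm.
Qed.

Lemma enorm_sub_gt0 x y : x != y -> 0 < enorm (x - y).
Proof.
move=> xy; rewrite lt_def enorm_ge0 andbT; apply: contra xy => /eqP /enorm_eq0 /eqP.
by rewrite subr_eq0.
Qed.

Variable alpha : R.
Hypothesis alpha01 : 0 < alpha < 1.

Lemma holx_le f (H : R) x y : (holx alpha f <= H%:E)%E ->
  enorm (f x - f y) <= H * enorm (x - y) `^ alpha.
Proof.
move=> fH; have [->|xy] := eqVneq x y.
  have -> : enorm (f y - f y) = 0.
    by rewrite subrr /enorm big1 ?sqrtr0// => i _; rewrite mxE expr0n.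
  have -> : enorm (y - y) = 0.
    by rewrite subrr /enorm big1 ?sqrtr0// => i _; rewrite mxE expr0n.
  by rewrite powR0 ?mulr0// gt_eqF//; case/andP: alpha01.
rewrite -ler_pdivrMr ?powR_gt0 ?enorm_sub_gt0// -lee_fin; apply: le_trans fH.
by apply: ereal_sup_ubound; exists x, y.
Qed.

Lemma holx_holder_coord f (H : R) i : 0 <= H -> (holx alpha f <= H%:E)%E ->
  holder_coord alpha H (fun x => f x 0 i).
Proof.
move=> H0 fH x y; have := component_le_enorm (f x - f y) i; rewrite !mxE => h.
apply: le_trans h _; apply: le_trans (holx_le x y fH) _; rewrite ler_wpM2l//.
apply: (@le_trans _ _ ((\sum_i `|x 0 i - y 0 i|) `^ alpha)).
  apply: powR_ler => //; first exact: enorm_ge0.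
  apply: le_trans (enorm_le_sum _) _.
  by apply: ler_sum => j _; rewrite !mxE.
by apply: powR_sum.
Qed.

(** Two distinct points are needed, as the supremum of the empty set is minus infinity. *)
Lemma holx_ge0 f : (0 < d)%N -> (0 <= holx alpha f)%E.
Proof.
case: d f => // n f _; pose x : 'rV[R]_n.+1 := const_mx 1.
have x0 : x != 0.
  by apply/eqP => /rowP/(_ ord0); rewrite !mxE => /eqP; rewrite oner_eq0.
apply: (@le_trans _ _ (Num.sqrt (\sum_i ((f x - f 0) 0 i) ^+ 2) / enorm (x - 0) `^ alpha)%:E).
  by rewrite lee_fin divr_ge0 ?sqrtr_ge0 ?powR_ge0.
by apply: ereal_sup_ubound; exists x, 0.
Qed.

End Norms.

Lemma ereal_sum_finite (R : realType) (a b : \bar R) : (0 <= a)%E -> (0 <= b)%E ->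
  (a + b < +oo)%E -> exists x y : R, [/\ a = x%:E, b = y%:E, 0 <= x & 0 <= y].
Proof.
by case: a b => [x| |] [y| |]//; rewrite !lee_fin => x0 y0 _; exists x, y.
Qed.

Lemma conv_eq0 (R : realType) (d : nat) b (s : R) (f : 'rV[R]_d -> R) x :
  (forall y, f y = 0) -> conv b s f x = 0.
Proof.
move=> f0; rewrite /conv -[RHS](@tint_cst R d 0); congr tint.
by apply/funext => y; rewrite f0 mulr0.
Qed.

(** * Consequences of finite norms for the velocity *)

Section HolderNorms.
Context {R : realType} {d : nat}.
Variables (alpha nu T U H : R) (u : R -> 'rV[R]_d -> 'rV[R]_d).
Hypothesis alpha01 : 0 < alpha < 1.
Hypothesis nu_gt0 : 0 < nu.
Hypothesis T_gt0 : 0 < T.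
Hypothesis uper : forall t, 0 <= t < T -> Zd_periodic (u t).
Hypothesis U_ge0 : 0 <= U.
Hypothesis H_ge0 : 0 <= H.
Hypothesis supU : supnorm T u = U%:E.
Hypothesis supH : Linf_holx alpha T u = H%:E.

Lemma component_le_supnorm t x j : 0 <= t < T -> `|u t x 0 j| <= U.
Proof.
move=> tT; apply: le_trans (component_le_enorm _ _) _.
by rewrite -lee_fin -supU; apply: ereal_sup_ubound; exists t, x.
Qed.

Lemma holx_le_Linf t : 0 <= t < T -> (holx alpha (u t) <= H%:E)%E.
Proof. by move=> tT; rewrite -supH; apply: ereal_sup_ubound; exists t. Qed.

Lemma component_holder t j : 0 <= t < T -> holder_coord alpha H (fun x => u t x 0 j).
Proof. by move=> tT; apply: holx_holder_coord => //; exact: holx_le_Linf. Qed.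

Lemma component_ucb t j : 0 <= t < T -> ucb (fun x => u t x 0 j).
Proof.
move=> tT; apply: (ucb_holder_coord alpha01 H_ge0 (component_holder j tT)) => x.
exact: component_le_supnorm.
Qed.

Let T0 : 0 <= (0 : R) < T. Proof. by rewrite lexx. Qed.

Lemma heat_component t x l : 0 <= t ->
  heat (nu * t) (u 0) x 0 l = heat_comp (nu * t) (fun y => u 0 y 0 l) x.
Proof.
move=> t0; apply: heatE; first by rewrite mulr_ge0// ltW.
  exact: uper.
exact: component_ucb.
Qed.

End HolderNorms.

Lemma component_estimates (R : realType) (alpha : R) (d : nat) :
  0 < alpha < 1 -> exists C : R, 0 <= C /\
  forall (nu T U H H0 : R) (u : R -> 'rV[R]_d -> 'rV[R]_d), 
    0 < nu -> 0 < T -> (forall t, 0 <= t < T -> Zd_periodic (u t)) ->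
    (forall (x : 'rV[R]_d) (j : 'I_d), measurable_fun `[0, T[ (fun t => u t x 0 j)) ->
    0 <= U -> 0 <= H -> 0 <= H0 -> supnorm T u = U%:E -> Linf_holx alpha T u = H%:E ->
    holx alpha (u 0) = H0%:E -> weak_NS nu T u (u 0) ->
  (forall x l s t, 0 <= s < T -> 0 <= t < T ->
    `|(u t x - heat (nu * t) (u 0) x) 0 l - (u s x - heat (nu * s) (u 0) x) 0 l| <=
      C * (U `^ alpha * H) * `|t - s| `^ alpha) /\
  (forall x l a s t, 0 < a -> a * nu < s < T -> a * nu < t < T ->
    `|u t x 0 l - u s x 0 l| <=
      C * (U `^ alpha * H + a `^ (- alpha / 2) * H0) * `|t - s| `^ alpha).
Proof.
move=> al01; have [C1 [C10 h1]] := @difference_estimate R d alpha al01.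
have [C2 [C20 h2]] := @heat_increment R d alpha al01.
exists (C1 + C2); split; first exact: addr_ge0.
move=> nu T U H H0 u nu0 T0 uper umeas U0 H_0 H0_0 supU supH supH0 uNS.
have uU := component_le_supnorm supU.
have uH := component_holder al01 H_0 supH.
have uc := component_ucb al01 H_0 supU supH.
have zT : 0 <= (0 : R) < T by rewrite lexx.
have hc := heat_component al01 nu0 T0 uper H_0 supU supH.
have P0 : 0 <= U `^ alpha * H by rewrite mulr_ge0// powR_ge0.
have first x l s t : 0 <= s < T -> 0 <= t < T ->
    `|(u t x - heat (nu * t) (u 0) x) 0 l - (u s x - heat (nu * s) (u 0) x) 0 l| <=
      C1 * (U `^ alpha * H) * `|t - s| `^ alpha.
  wlog st : s t / s <= t.
    move=> W sT tT; have [st|/ltW ts] := leP s t; first exact: W.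
    by rewrite distrC [`|t - s|]distrC; exact: W.
  move=> /andP[s0 sT] /andP[t0 tT]; rewrite !mxE !hc//.
  move: st; rewrite le_eqVlt => /predU1P[->|st].
    by rewrite !subrr normr0 !mulr_ge0 ?powR_ge0.
  (* The choice of scale in [difference_estimate] degenerates for [U = 0]; there [u] vanishes
     identically. *)
  have [Un|Up] := eqVneq U 0.
    have uz q y : 0 <= q < T -> u q y 0 l = 0.
      move=> qT; apply/eqP; rewrite -normr_eq0 eq_le normr_ge0 andbT -Un.
      exact: uU.
    have hz q : heat_comp (nu * q) (fun y => u 0 y 0 l) x = 0.
      rewrite /heat_comp; case: eqP => _; first exact: uz.
      by apply: conv_eq0 => y; exact: uz.
    rewrite !hz !uz ?subrr ?normr0 ?mulr_ge0 ?powR_ge0// ?s0 ?t0//.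
  have Ug : 0 < U by rewrite lt_def Up.
  have := h1 nu T U H u uU uH uper umeas uNS nu0 T0 Ug H_0 x l s t s0 st tT.
  by cbv zeta; rewrite [`|t - s|]gtr0_norm ?subr_gt0.
split=> [x l s t sT tT|x l a s t a0].
  apply: le_trans (first x l s t sT tT) _.
  by rewrite ler_wpM2r ?powR_ge0// ler_wpM2r// lerDl.
wlog st : s t / s <= t.
  move=> W sT tT; have [st|/ltW ts] := leP s t; first exact: W.
  by rewrite distrC [`|t - s|]distrC; exact: W.
move=> /andP[as' sT] /andP[at' tT].
have an0 : 0 < a * nu by exact: mulr_gt0.
have s0 : 0 <= s by rewrite ltW// (lt_trans an0).
have t0 : 0 <= t by rewrite ltW// (lt_trans an0).
have e1 := first x l s t ltac:(by rewrite s0) ltac:(by rewrite t0).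
have u0H : holder_coord alpha H0 (fun y => u 0 y 0 l).
  by apply: holx_holder_coord => //; rewrite supH0.
have p0 : Zd_periodic (fun y => u 0 y 0 l) by move=> y i; rewrite uper.
have e2 := h2 _ H0 nu a s t x H0_0 u0H p0 (uc 0 l zT) nu0 a0 as' st.
move: e1; rewrite !mxE !hc// => e1.
move: e1 e2; rewrite [`|t - s|]ger0_norm ?subr_ge0//.
set A := heat_comp _ _ _; set B := heat_comp _ _ _; set P := U `^ alpha * H.
set Q := a `^ _ * H0; set h := (t - s) `^ alpha => e1 e2.
have -> : u t x 0 l - u s x 0 l = (u t x 0 l - A - (u s x 0 l - B)) + (A - B) by ring.
have Q0 : 0 <= Q by rewrite mulr_ge0// powR_ge0.
have hh : 0 <= h by exact: powR_ge0.
apply: le_trans (ler_normD _ _) _; apply: le_trans (lerD e1 e2) _.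
rewrite -mulrDl ler_wpM2r//.
have := mulr_ge0 C10 Q0; have := mulr_ge0 C20 P0; rewrite -/P; lra.
Qed.

Theorem theorem1p1 (R : realType) (alpha : R) (d : nat) :
  0 < alpha < 1 -> (2 <= d)%N ->
  exists C : R, 0 < C /\
  forall (nu T : R) (u : R -> 'rV[R]_d -> 'rV[R]_d) (u0 : 'rV[R]_d -> 'rV[R]_d),
    0 < nu -> 0 < T ->
    (forall t, 0 <= t < T -> Zd_periodic (u t)) -> Zd_periodic u0 ->
    (forall (x : 'rV[R]_d) (j : 'I_d), measurable_fun `[0, T[ (fun t => u t x 0 j)) ->
    (Linf_Cx alpha T u < +oo)%E ->
    u 0 = u0 ->
    weak_NS nu T u u0 ->
    let ut := fun t x => u t x - heat (nu * t) u0 x in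
    (Linfx_holt alpha T ut
       <= C%:E * (poweR (supnorm T u) alpha * Linf_holx alpha T u))%E /\
    (forall a : R, 0 < a ->
       (Chol_tx alpha (a * nu) T u
          <= C%:E * (poweR (supnorm T u) alpha * Linf_holx alpha T u
                     + Linf_Cx alpha T u
                     + (a `^ (- alpha / 2))%:E * holx alpha u0))%E).
Proof.
move=> al01 d2; have d0 : (0 < d)%N by exact: ltnW.
have [K [K0 hK]] := @component_estimates R alpha d al01.
pose D : R := d%:R; have D0 : 0 <= D by [].
(* The 1 serves the sup norm; passing from components to [enorm] costs [D], once for the spatial
   increment and once, with [K], for the time increment. *)
exists (1 + D * (1 + K)); split.
  by rewrite ltr_pwDl// mulr_ge0// addr_ge0.
move=> nu T u u0 nu0 T0 uper _ umeas ufin u00 uNS ut; subst u0.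
have zT : 0 <= (0 : R) < T by rewrite lexx.
have holx0 : (0 <= holx alpha (u 0%R))%E by exact: holx_ge0.
have sup0 : (0 <= supnorm T u)%E.
  apply: (@le_trans _ _ (enorm (u 0 0))%:E); first by rewrite lee_fin enorm_ge0.
  by apply: ereal_sup_ubound; exists 0, 0.
have holxL : (holx alpha (u 0%R) <= Linf_holx alpha T u)%E.
  by apply: ereal_sup_ubound; exists 0.
have [U [H [supU supH U0 H0]]] := ereal_sum_finite sup0 (le_trans holx0 holxL) ufin.
have [H1 [holxE H1_0]] : exists x : R, holx alpha (u 0) = x%:E /\ 0 <= x.
  rewrite supH in holxL; case: (holx alpha (u 0)) holx0 holxL => [x| |]//.
  by rewrite lee_fin => x0 _; exists x.
have [est1 est2] := hK nu T U H H1 u nu0 T0 uper umeas U0 H0 H1_0 supU supH holxE uNS.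
have P0 : 0 <= U `^ alpha * H by rewrite mulr_ge0// powR_ge0.
have DK0 : 0 <= D * K by exact: mulr_ge0.
have CE : K * D <= 1 + D * (1 + K) by rewrite mulrDr mulr1 mulrC; lra.
rewrite supU supH holxE poweR_EFin; split.
  rewrite -!EFinM; apply: ge_ereal_sup => _ [x [t [s [tT [sT [ts ->]]]]]].
  have ts0 : 0 < `|t - s| by rewrite normr_gt0 subr_eq0.
  rewrite lee_fin ler_pdivrMr ?powR_gt0//.
  apply: le_trans (enorm_le_component (M := K * (U `^ alpha * H) * `|t - s| `^ alpha) _) _.
    by move=> l; have := est1 x l s t sT tT; rewrite /ut !mxE.
  have -> : d%:R * (K * (U `^ alpha * H) * `|t - s| `^ alpha) =
    K * D * (U `^ alpha * H) * `|t - s| `^ alpha by rewrite /D; ring.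
  by rewrite ler_wpM2r ?powR_ge0// ler_wpM2r.
move=> a a0; rewrite /Linf_Cx supU supH /Chol_tx.
set Q := a `^ _; have Q0 : 0 <= Q by exact: powR_ge0.
have QH0 : 0 <= Q * H1 by exact: mulr_ge0.
pose M := K * (U `^ alpha * H + Q * H1) + H.
have sup1 : (ereal_sup [set z | exists t x, (a * nu < t < T)%R /\ z = (enorm (u t x))%:E] <= U%:E)%E.
  apply: ge_ereal_sup => _ [t [x [/andP[at' tT] ->]]]; rewrite -supU.
  apply: ereal_sup_ubound; exists t, x; split=> //.
  by rewrite tT andbT ltW// (lt_trans _ at')// mulr_gt0.
have sup2 : (ereal_sup [set z | exists t x s y, (a * nu < t < T)%R /\ (a * nu < s < T)%R /\
    (t, x) != (s, y) /\
    z = (enorm (u t x - u s y) / (`|t - s| + enorm (x - y)) `^ alpha)%:E] <= (D * M)%:E)%E.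
  apply: ge_ereal_sup => _ [t [x [s [y [tT [sT [txsy ->]]]]]]].
  have exy := enorm_ge0 (x - y).
  have q0 : 0 < `|t - s| + enorm (x - y).
    have [ts|ts] := eqVneq t s; last by rewrite ltr_pwDl// normr_gt0 subr_eq0.
    rewrite ts subrr normr0 add0r; apply: enorm_sub_gt0.
    by apply: contra txsy => /eqP ->; rewrite ts.
  rewrite lee_fin ler_pdivrMr ?powR_gt0//; set q := _ + _ in q0 *.
  rewrite -mulrA; apply: enorm_le_component => l.
  have sT0 : 0 <= s < T.
    by case/andP: sT => as' ->; rewrite andbT ltW// (lt_trans _ as')// mulr_gt0.
  have e1 := est2 x l a s t a0 sT tT.
  have uH : (holx alpha (u s) <= H%:E)%E by rewrite -supH; apply: ereal_sup_ubound; exists s.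
  have e2 := holx_le al01 x y uH.
  have e3 := component_le_enorm (u s x - u s y) l; rewrite !mxE in e3 *.
  (* The joint increment passes through the point (s, x), and both distances are at most [q]. *)
  have -> : u t x 0 l - u s y 0 l = (u t x 0 l - u s x 0 l) + (u s x 0 l - u s y 0 l) by ring.
  apply: le_trans (ler_normD _ _) _; rewrite /M mulrDl; apply: lerD.
    apply: le_trans e1 _; rewrite ler_wpM2l ?mulr_ge0 ?addr_ge0//.
    by apply: powR_ler => //; rewrite /q lerDl.
  apply: le_trans e3 (le_trans e2 _); rewrite ler_wpM2l//.
  by apply: powR_ler => //; rewrite /q lerDr.
apply: le_trans (leeD sup1 sup2) _.
rewrite -[adde U%:E H%:E]/(U + H)%:E -!EFinM -!EFinD lee_fin /M.
set A := U `^ alpha * H; set B := Q * H1; rewrite -/A in P0; rewrite -/B in QH0.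
have h1 := mulr_ge0 D0 P0; have h2 := mulr_ge0 D0 QH0; have h3 := mulr_ge0 D0 U0.
have h4 := mulr_ge0 DK0 U0; have h5 := mulr_ge0 DK0 H0; have h6 := mulr_ge0 DK0 P0.
have -> : U + D * (K * (A + B) + H) = U + D * H + D * K * A + D * K * B by ring.
have -> : (1 + D * (1 + K)) * (A + (U + H) + B) =
  A + U + H + B + (D * A + D * U + D * H + D * B) +
  (D * K * A + D * K * U + D * K * H + D * K * B) by ring.
lra.
Qed.
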